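(* Let $\mathcal{H}$ be a separable complex Hilbert space and let $M\subset B(\mathcal{H})$ be a von Neumann algebra. Then $M$ is contained in $\mathrm{ap}_{\mathcal{H}}(M)$ if and only if $M$ is a direct sum $A\oplus\bigoplus_{k\geq 1}M_k$ where $A$ is an abelian, diffuse von Neumann algebra, and where each $M_k$ is a finite-dimensional factor. In other words, $M\subset\mathrm{ap}_{\mathcal{H}}(M)$ if and only if $M$ is a direct sum of von Neumann algebras each of which is either abelian or finite-dimensional.
   Context: $U_M$ denotes the group of unitary elements of $M$, a topological group for the weak operator topology (which coincides on $U_M$ with the strong, ultraweak and ultrastrong topologies). For a topological group $G$, $C_b(G)$ is the $C^*$-algebra of bounded continuous functions $f:G\to\mathbb{C}$ with the sup norm. For $g\in G$, $(g\cdot f)(s)=f(g^{-1}s)$ and $(f\cdot g)(s)=f(sg)$ are the left and right translates of $f$, with orbits $Gf=\{g\cdot f:g\in G\}$ and $fG=\{f\cdot g:g\in G\}$. $C_{b,r}(G)$ is the $C^*$-subalgebra of all $f\in C_b(G)$ with $\|g\cdot f-f\|_\infty\to 0$ as $g\to 1$. $\mathrm{AP}(G)$ is the set of all almost periodic functions, i.e. all $f\in C_{b,r}(G)$ whose orbits $Gf$ and $fG$ are relatively compact in the norm topology. For $T\in B(\mathcal{H})$ and $\xi,\eta\in\mathcal{H}$, let $(\xi\star T\star\eta)(u)=\langle uTu^*\xi|\eta\rangle$ for $u\in U_M$. The set $\mathrm{ap}_{\mathcal{H}}(M)$ consists of all $T\in B(\mathcal{H})$ such that $\xi\star T\star\eta\in\mathrm{AP}(U_M)$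 for all $\xi,\eta\in\mathcal{H}$. A (non-zero) projection $e$ of a von Neumann algebra $N$ is an atom if $eNe=\mathbb{C}e$; $N$ is diffuse if it contains no atoms. Direct sums are von Neumann algebra ($\ell^\infty$-) direct sums, over at most countable families; the diffuse abelian summand $A$, or some or all of the summands $M_k$, may be absent (zero). *)

(* Defs.v *)
From HB Require Import structures.
From mathcomp Require Import all_boot all_order all_algebra.
From mathcomp Require Import sesquilinear.
From mathcomp Require Import complex.
From mathcomp Require Import all_classical all_reals all_analysis.

Set Implicit Arguments.
Unset Strict Implicit.
Unset Printing Implicit Defensive.

Import Order.TTheory GRing.Theory Num.Theory.
Import numFieldNormedType.Exports.

Local Open Scope classical_set_scope.
Local Open Scope ring_scope.

(* R[i] itself carries no topology in the library; R[i]^o is R[i] as a normed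
   space over itself. *)
Notation cplx R := (R[i]^o).

(* The inner product is linear in its first argument. *)
HB.mixin Record CompleteNormedModule_isHilbert (R : realType) H
    & CompleteNormedModule (R[i] : numClosedFieldType) H := {
  inner : {dot H for (@Num.conj (R[i] : numClosedFieldType))} ;
  inner_norm : forall x : H, inner x x = `|x| ^+ 2
}.

#[short(type="hilbertType")]
HB.structure Definition Hilbert (R : realType) :=
  {H of CompleteNormedModule R[i] H & CompleteNormedModule_isHilbert R H}.

Definition separable_space (T : topologicalType) :=
  exists2 D : set T, countable D & dense D.

(* Joint continuity of the group operations plays no role in the definition of
   almost periodic functions, so it is not made part of the structure. *)
#[short(type="groupTopologicalType")]
HB.structure Definition GroupTopological := {G of Group G & Topological G}.

Section almost_periodic.
Context {R : realType} {G : groupTopologicalType}.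
Implicit Types f : G -> cplx R.

Definition ltranslate (g : G) f : {uniform G -> cplx R} :=
  fun s => f (g^-1 * s)%g.
Definition rtranslate f (g : G) : {uniform G -> cplx R} :=
  fun s => f (s * g)%g.

Definition Cb : set (G -> cplx R) :=
  [set f | continuous f /\ bounded_fun f].

Definition Cbr : set (G -> cplx R) :=
  [set f | Cb f /\ {uniform, ltranslate g f @[g --> (1%g : G)] --> f}].

(* Cb is closed in {uniform G -> cplx R}, so relative compactness may be
   taken in the latter space. *)
Definition AP : set (G -> cplx R) :=
  [set f | [/\ Cbr f, precompact (range (fun g => ltranslate g f)) &
               precompact (range (rtranslate f))]].

End almost_periodic.

Section operators.
Context {R : realType} {H : hilbertType R}.
Implicit Types (S T p e : H -> H) (N : set (H -> H)).

Definition bounded_operator : set (H -> H) :=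
  [set T | linear T /\ continuous T].

Definition adjoint_spec T S := forall x y, inner (T x) y = inner x (S y).

(* The Hilbert space adjoint of a bounded operator; it exists by the Riesz
   representation theorem and is unique. The default value 0 is only reached by
   maps T that are not bounded operators. *)
Definition adjoint T : H -> H := xget 0 (adjoint_spec T).

(* H -> H with the weak operator topology: the coarsest one for which all the
   maps T |-> <T x | y> are continuous. *)
Definition wot : Type := initial_topology
  (fun T : H -> H => (fun z => inner (T z.1) z.2) : {ptws H * H -> cplx R}).
HB.instance Definition _ := Topological.on wot.

(* N is a von Neumann algebra with unit p. Then p is a projection and
   N = p N p acts on the Hilbert space p H; p = id gives the von Neumann
   algebras in B(H), and other p are needed for the summands of a direct sum.
   The zero algebra (p = 0) is allowed. *)
Record von_neumann_on p N : Prop := {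
  vn_bounded : N `<=` bounded_operator ;
  vn_unit : N p ;
  vn_unitl : forall T, N T -> p \o T = T ;
  vn_unitr : forall T, N T -> T \o p = T ;
  vn_linear : forall (c : R[i]) S T, N S -> N T -> N (c *: S + T) ;
  vn_comp : forall S T, N S -> N T -> N (S \o T) ;
  vn_adjoint : forall T, N T -> N (adjoint T) ;
  vn_wot_closed : closure (N : set wot) `&` bounded_operator `<=` N
}.

Definition unitary T :=
  [/\ bounded_operator T, adjoint T \o T = idfun & T \o adjoint T = idfun].

Definition projection T :=
  [/\ bounded_operator T, T \o T = T & adjoint T = T].

Definition atom N e :=
  [/\ N e, projection e, e <> 0 &
      [set e \o (T \o e) | T in N] = [set c *: e | c in [set: R[i]]]].

Definition is_diffuse N := forall e, ~ atom N e.

Definition is_abelian N := forall S T, N S -> N T -> S \o T = T \o S.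

Definition vn_center N : set (H -> H) :=
  [set S | N S /\ forall T, N T -> S \o T = T \o S].

Definition is_factor p N :=
  p <> 0 /\ vn_center N = [set c *: p | c in [set: R[i]]].

Definition is_finite_dimensional N := exists n (e : 'I_n -> (H -> H)),
  (forall i, N (e i)) /\
  forall T, N T -> exists c : 'I_n -> R[i], T = \sum_i c i *: e i.

(* M is the l^oo-direct sum of the von Neumann algebras N i, where N i acts on
   p i H and H is the Hilbert space direct sum of the p i H: the elements of M
   are the operators (+)_i t i with t i in N i and sup_i |t i| < +oo. Countably
   many summands are indexed by nat, zero summands being allowed. *)
Definition direct_sum (M : set (H -> H)) (p : nat -> H -> H)
    (N : nat -> set (H -> H)) :=
  [/\ forall i, von_neumann_on (p i) (N i),
      forall i j, i <> j -> p i \o p j = 0,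
      forall x, \sum_(i < n) p i x @[n --> \oo] --> x &
      M = [set T | exists t : nat -> H -> H,
             [/\ forall i, N i (t i),
                 exists C : R[i], forall i x, `|t i x| <= C * `|x| &
                 forall x, \sum_(i < n) t i x @[n --> \oo] --> T x]]].

End operators.

Arguments wot {R} H.
Arguments bounded_operator {R H}.

Record vonNeumannAlgebra (R : realType) (H : hilbertType R) := VonNeumannAlgebra {
  vn_set :> set (H -> H) ;
  vn_setP : von_neumann_on idfun vn_set
}.

Section unitary_group.
Context {R : realType} {H : hilbertType R} (M : vonNeumannAlgebra H).

Lemma inner_inj (x y : H) : (forall z, inner z x = inner z y) -> x = y.
Proof.
move=> xy; apply/eqP; rewrite -subr_eq0 -normr_eq0 -sqrf_eq0 -inner_norm.
by rewrite linearBr/= xy subrr.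
Qed.

Lemma adjointE (S T : H -> H) : adjoint_spec T S -> adjoint T = S.
Proof.
move=> TS; have aT : adjoint_spec T (adjoint T).
  exact: (xgetPex (0 : H -> H) (ex_intro _ S TS)).
by apply/funext => y; apply: inner_inj => x; rewrite -aT TS.
Qed.

Lemma unitary_adjointP (T : H -> H) : unitary T -> adjoint_spec T (adjoint T).
Proof.
move=> [_ + _]; have [exS _|nexS] := pselect (exists S, adjoint_spec T S).
  exact: (xgetPex (0 : H -> H) exS).
rewrite /adjoint xgetPN; last by move=> S TS; apply: nexS; exists S.
move=> T0 x y.
have z0 (z : H) : z = 0 by have /(congr1 (@^~ z)) := T0.
by rewrite (z0 (T x)) (z0 x) (z0 y).
Qed.

Lemma unitary_id : unitary (idfun : H -> H).
Proof.
have id_adj : adjoint (idfun : H -> H) = idfun by exact: adjointE.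
by split; rewrite ?id_adj//; split=> // x; exact: cvg_id.
Qed.

Lemma unitary_comp (S T : H -> H) : unitary S -> unitary T -> unitary (S \o T).
Proof.
move=> uS uT.
have ST : adjoint (S \o T) = adjoint T \o adjoint S.
  by apply: adjointE => x y /=; rewrite (unitary_adjointP uS) (unitary_adjointP uT).
case: uS uT => [[lS cS] aS Sa] [[lT cT] aT Ta]; split.
- split; last by move=> x; apply: continuous_comp; [exact: cT|exact: cS].
  by move=> c x y /=; rewrite lT lS.
- by rewrite ST compA -(compA _ _ S) aS.
- by rewrite ST compA -(compA _ _ (adjoint T)) Ta.
Qed.

Lemma unitary_adjoint (T : H -> H) : vn_set M T -> unitary T -> unitary (adjoint T).
Proof.
move=> MT uT.
have aa : adjoint (adjoint T) = T.
  apply: adjointE => x y.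
  by rewrite hermC/= -(unitary_adjointP uT y x) [RHS]hermC.
case: uT => bT aT Ta; split; rewrite ?aa//.
exact/(vn_bounded (vn_setP M))/(vn_adjoint (vn_setP M)).
Qed.

Definition unitaries : set (wot H) := [set u : H -> H | vn_set M u /\ unitary u].

(* U_M with the weak operator topology *)
Definition unitary_group : Type := unitaries.
HB.instance Definition _ := Topological.on unitary_group.

End unitary_group.

Section unitary_group_structure.
Context {R : realType} {H : hilbertType R} (M : vonNeumannAlgebra H).
Let U := unitary_group M.
Let op (u : U) : H -> H := set_val u.
Let op_inj : injective op. Proof. exact: val_inj. Qed.

Let one_subproof : (idfun : H -> H) \in unitaries M.
Proof.
by rewrite inE; split; [exact: vn_unit (vn_setP M)|exact: unitary_id].
Qed.
Let mul_subproof (u v : U) : (op u \o op v) \in unitaries M.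
Proof.
move: (valP u) (valP v); rewrite !inE => -[Mu uu] [Mv uv]; split.
  exact: (vn_comp (vn_setP M)).
exact: unitary_comp.
Qed.
Let inv_subproof (u : U) : adjoint (op u) \in unitaries M.
Proof.
move: (valP u); rewrite !inE => -[Mu uu]; split.
  exact: (vn_adjoint (vn_setP M)).
exact: (unitary_adjoint Mu uu).
Qed.

Let in_U (v : H -> H) (Uv : v \in unitaries M) : U :=
  exist (fun v => v \in unitaries M) v Uv.
Let one : U := in_U one_subproof.
Let mul (u v : U) : U := in_U (mul_subproof u v).
Let inv (u : U) : U := in_U (inv_subproof u).

Let mulA : associative mul. Proof. by move=> u v w; exact: op_inj. Qed.
Let mul1 : left_id one mul. Proof. by move=> u; exact: op_inj. Qed.
Let mulr1 : right_id one mul. Proof. by move=> u; exact: op_inj. Qed.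
Let mulV : left_inverse one inv mul.
Proof. by move=> u; apply: op_inj; have /set_mem[_ []] := valP u. Qed.
Let mulrV : right_inverse one inv mul.
Proof. by move=> u; apply: op_inj; have /set_mem[_ []] := valP u. Qed.

HB.instance Definition _ :=
  isGroup.Build (unitary_group M) mulA mul1 mulr1 mulV mulrV.

End unitary_group_structure.

Definition star_coef (R : realType) (H : hilbertType R)
    (M : vonNeumannAlgebra H) (xi : H) (T : H -> H) (eta : H) :
    unitary_group M -> cplx R :=
  fun u => let v : H -> H := set_val u in inner (v (T (adjoint v xi))) eta.

Definition ap (R : realType) (H : hilbertType R) (M : vonNeumannAlgebra H) :
    set (H -> H) :=
  [set T | bounded_operator T /\
           forall xi eta : H, AP (star_coef (M := M) xi T eta)].

(* Main.v *)
Require Import Defs.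
From mathcomp Require Import all_boot all_order all_algebra complex.
From mathcomp Require Import all_classical all_reals all_analysis.
From HB Require Import structures.
From mathcomp Require Import ring lra zify.

(** The group acts on its coefficient functions by right translates, and the
    right translate of u |-> <u T u^* xi | eta> by g is the same coefficient of
    the conjugate g T g^*. Relative compactness of the right orbits therefore
    says that the conjugates of T by unitaries of M are totally bounded,
    uniformly over the vectors in a unitary orbit; a sequence of conjugates that stays separated
    on such orbits excludes it (ap_not_separated).

    Necessity. Let M be contained in ap(M). If a projection e of M does not
    commute with some S in M, then (replacing S by its adjoint if necessary)
    v = e S (1 - e) is not 0. Suppose that there is no minimal projection under
    e. Then a maximal chain of projections under e is continuous, and, as for
    the Rademacher functions on an interval, it yields symmetries w_n of e M e
    such that the vectors w_n v x are orthogonal. But the conjugate of v by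
    w_n + (1 - e) is w_n v, so these conjugates stay separated. Hence there is a
    minimal projection q under e (ap_minimal_projection). For a minimal q the
    space M q carries the inner product b^* a, with values in the multiples of
    q. It is finite-dimensional, because infinitely many orthonormal vectors
    could be moved onto one of them by symmetries, which separates again
    (ap_no_orthonormal_sequence). If b runs over an orthonormal basis of M q,
    the sum z of the b b^* is the central support of q, and M z is a factor with
    matrix units b_i b_j^* (minimal_projection_summand). Such summands are
    orthogonal, and there are countably many of them by separability. In the
    complement of their sum every projection commutes with M, since otherwise
    there would be a minimal projection under it; so this complement is
    abelian, and it is diffuse (ap_direct_sum).

    Projections are needed in M in sufficient number. In place of the spectral
    theorem, the binary digits of an operator between 0 and 1 are found one at a
    time (first_digit) from the sign of a selfadjoint operator (sign_operator),
    which is a strong limit of polynomials.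

    Sufficiency. Let P_n be the sum of the first n central projections of the
    decomposition. As P_n xi tends to xi and P_n is central, the coefficients of
    T are uniform limits of those of g T g^* P_n. On an abelian summand this
    conjugate does not depend on g, and on a finite-dimensional one it stays in
    a bounded set of a finite-dimensional space (direct_sum_ap). So the right
    orbit is totally bounded; the left orbit consists of the columns of the
    matrix f(s g) whose rows form the right orbit, and it is totally bounded as
    well (finitely_coloured_transpose). *)


Set Implicit Arguments.
Unset Strict Implicit.
Unset Printing Implicit Defensive.

Import Order.TTheory GRing.Theory Num.Theory.
Import numFieldNormedType.Exports.

Local Open Scope classical_set_scope.
Local Open Scope ring_scope.

Local Notation Re := complex.Re.
Local Notation Im := complex.Im.

(** * The real inner product and Riesz representation *)

Section inner_product.
Context {R : realType} {H : hilbertType R}.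
Local Notation C := R[i].
Implicit Types x y z : H.

Lemma innerDl x y z : inner (x + y) z = inner x z + inner y z.
Proof. exact: linearDl. Qed.
Lemma innerDr x y z : inner z (x + y) = inner z x + inner z y.
Proof. exact: linearDr. Qed.
Lemma innerNl x z : inner (- x) z = - inner x z.
Proof. exact: linearNl. Qed.
Lemma innerNr x z : inner z (- x) = - inner z x.
Proof. exact: linearNr. Qed.
Lemma innerBl x y z : inner (x - y) z = inner x z - inner y z.
Proof. exact: linearBl. Qed.
Lemma innerBr x y z : inner z (x - y) = inner z x - inner z y.
Proof. exact: linearBr. Qed.
Lemma innerZl (a : C) x z : inner (a *: x) z = a * inner x z.
Proof. exact: linearZl_LR. Qed.
Lemma innerZr (a : C) x z : inner z (a *: x) = a^*%C * inner z x.
Proof. exact: linearZr_LR. Qed.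
Lemma inner0l z : inner (0 : H) z = 0. Proof. exact: linear0l. Qed.
Lemma inner0r z : inner z (0 : H) = 0. Proof. exact: linear0r. Qed.
Lemma innerC x y : inner x y = (inner y x)^*%C.
Proof. by rewrite hermC/= mul1r. Qed.

(** The real part of the inner product makes H a real Hilbert space, in which
    estimates are inequalities between elements of R and so can be decided by
    linear arithmetic. *)
Definition rin x y : R := Re (inner x y).
Definition nsq x : R := rin x x.

Lemma rinC x y : rin x y = rin y x.
Proof. by rewrite /rin innerC; case: (inner y x). Qed.
Lemma rinDl x y z : rin (x + y) z = rin x z + rin y z.
Proof. by rewrite /rin innerDl; case: (inner x z) (inner y z) => ? ? []. Qed.
Lemma rinDr x y z : rin z (x + y) = rin z x + rin z y.
Proof. by rewrite !(rinC z) rinDl. Qed.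
Lemma rinNl x z : rin (- x) z = - rin x z.
Proof. by rewrite /rin innerNl; case: (inner x z). Qed.
Lemma rinNr x z : rin z (- x) = - rin z x.
Proof. by rewrite !(rinC z) rinNl. Qed.
Lemma rinBl x y z : rin (x - y) z = rin x z - rin y z.
Proof. by rewrite rinDl rinNl. Qed.
Lemma rinBr x y z : rin z (x - y) = rin z x - rin z y.
Proof. by rewrite rinDr rinNr. Qed.
Lemma rin0l z : rin (0 : H) z = 0. Proof. by rewrite /rin inner0l. Qed.
Lemma rin0r z : rin z (0 : H) = 0. Proof. by rewrite /rin inner0r. Qed.
Lemma rinZl (a : R) x z : rin (a%:C%C *: x) z = a * rin x z.
Proof. by rewrite /rin innerZl; case: (inner x z) => u v /=; rewrite mul0r subr0. Qed.
Lemma rinZr (a : R) x z : rin z (a%:C%C *: x) = a * rin z x.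
Proof. by rewrite !(rinC z) rinZl. Qed.
Lemma rin_iZr x y : rin x ('i%C *: y) = Im (inner x y).
Proof. by rewrite /rin innerZr; case: (inner x y) => u v /=; ring. Qed.

Lemma inner_rin x y : inner x y = (rin x y +i* rin x ('i%C *: y))%C.
Proof. by rewrite rin_iZr /rin; case: (inner x y). Qed.

Lemma innerxx x : inner x x = (nsq x)%:C%C.
Proof.
rewrite inner_rin; congr Complex; rewrite rin_iZr.
by have := innerC x x; case: (inner x x) => u v /= [] vE; lra.
Qed.

Lemma normE x : `|x| = (Num.sqrt (nsq x))%:C%C.
Proof.
have nx : `|x| \is Num.real by [].
rewrite -(RRe_real nx); congr (_%:C)%C.
have := inner_norm x; rewrite innerxx -(RRe_real nx) -rmorphXn/= => -[->].
by rewrite sqrtr_sqr ger0_norm// -ler0c (RRe_real nx).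
Qed.

Lemma nsq_ge0 x : 0 <= nsq x.
Proof. by rewrite -ler0c -innerxx inner_norm exprn_ge0. Qed.

Lemma nsq_eq0 x : nsq x = 0 -> x = 0.
Proof. by move=> x0; apply/normr0_eq0; rewrite normE x0 sqrtr0. Qed.

Lemma nsq0 : nsq 0 = 0. Proof. exact: rin0l. Qed.
Lemma nsq_gt0 x : x <> 0 -> 0 < nsq x.
Proof.
move=> x0; rewrite lt_def nsq_ge0 andbT; apply/eqP => /nsq_eq0; exact: x0.
Qed.
Lemma nsqD x y : nsq (x + y) = nsq x + nsq y + 2 * rin x y.
Proof. by rewrite /nsq !(rinDl, rinDr) (rinC y x); ring. Qed.
Lemma nsqB x y : nsq (x - y) = nsq x + nsq y - 2 * rin x y.
Proof. by rewrite /nsq !(rinBl, rinBr) (rinC y x); ring. Qed.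
Lemma nsqN x : nsq (- x) = nsq x.
Proof. by rewrite /nsq rinNl rinNr opprK. Qed.
Lemma nsqZ (a : C) x : nsq (a *: x) = (Re a ^+ 2 + Im a ^+ 2) * nsq x.
Proof.
rewrite /nsq /rin innerZl innerZr innerxx mulrA.
by case: a => a b; rewrite /=; ring.
Qed.
Lemma nsqZr (a : R) x : nsq (a%:C%C *: x) = a ^+ 2 * nsq x.
Proof. by rewrite nsqZ/= expr0n addr0. Qed.

Lemma rin_le x y : 2 * rin x y <= nsq x + nsq y.
Proof. by have := nsq_ge0 (x - y); rewrite nsqB; lra. Qed.
(** Used in place of the triangle inequality, to avoid square roots. *)
Lemma nsqD_le x y : nsq (x + y) <= 2 * nsq x + 2 * nsq y.
Proof. by rewrite nsqD; have := rin_le x y; lra. Qed.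

Lemma rin_sqr_le x y : rin x y ^+ 2 <= nsq x * nsq y.
Proof.
have [->|/eqP y0] := eqVneq y 0; first by rewrite rin0r nsq0; lra.
have yp := nsq_gt0 y0; have := nsq_ge0 (x - (rin x y / nsq y)%:C%C *: y).
rewrite nsqB rinZr nsqZr => h; rewrite -subr_ge0.
have -> : nsq x * nsq y - rin x y ^+ 2 =
   nsq y * (nsq x + (rin x y / nsq y) ^+ 2 * nsq y - 2 * (rin x y / nsq y * rin x y)).
  by field; rewrite gt_eqF.
by rewrite mulr_ge0 // nsq_ge0.
Qed.

(** The Cauchy-Schwarz inequality: multiply y by <x, y> to reduce it to the real
    part. *)
Lemma normc_inner_sqr x y :
  Re (inner x y) ^+ 2 + Im (inner x y) ^+ 2 <= nsq x * nsq y.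
Proof.
set a := inner x y; set s := _ + _.
have E : rin x (a *: y) = s.
  by rewrite /rin innerZr -/a /s; case: (a) => u v /=; ring.
have := rin_sqr_le x (a *: y); rewrite E nsqZ -/s => h.
have s0 : 0 <= s by rewrite /s addr_ge0 ?sqr_ge0.
have [->|sn0] := eqVneq s 0; first by rewrite mulr_ge0 ?nsq_ge0.
have sp : 0 < s by rewrite lt_def sn0.
by rewrite -(ler_pM2l sp); move: h; rewrite expr2 mulrCA.
Qed.

Lemma inner_ext x y : (forall z, rin x z = rin y z) -> x = y.
Proof.
move=> xy; apply/eqP; rewrite -subr_eq0; apply/eqP/nsq_eq0.
by rewrite /nsq rinBl xy subrr.
Qed.

Lemma ball_nsq x y (e : R) : 0 < e ->
  ball x e%:C%C y <-> nsq (x - y) < e ^+ 2.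
Proof.
move=> e0; rewrite -ball_normE /ball_/= normE ltcR.
by rewrite -[X in _ < X](ger0_norm (ltW e0)) -sqrtr_sqr ltr_sqrt ?exprn_gt0.
Qed.

(** The norm of H takes its values in R[i]; the next lemmas restate its topology
    by inequalities in R. *)
Lemma cvg_nsqP (F : set_system H) (FF : Filter F) x :
  F --> x <-> (forall e : R, 0 < e -> \forall y \near F, nsq (y - x) < e).
Proof.
split=> [/cvg_ballP Fx e e0|Fx].
  have s0 : 0 < Num.sqrt e by rewrite sqrtr_gt0.
  have := Fx (Num.sqrt e)%:C%C; rewrite ltcR => /(_ s0); apply: filterS => y.
  by move/(ball_nsq _ _ s0); rewrite sqr_sqrtr ?ltW// -nsqN opprB.
apply/cvg_ballP => e e0.
have eR : (Re e)%:C%C = e by rewrite RRe_real// gtr0_real.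
have re0 : 0 < Re e by rewrite -ltcR eR.
have := Fx (Re e ^+ 2); rewrite exprn_gt0// => /(_ isT); apply: filterS => y yx.
by rewrite -eR; apply/ball_nsq => //; rewrite -nsqN opprB.
Qed.

Lemma cauchy_nsqP (F : set_system H) (FF : ProperFilter F) :
  (forall e : R, 0 < e -> exists2 A, F A & forall y z, A y -> A z ->
     nsq (y - z) < e) -> exists x, F --> x.
Proof.
move=> FC; have : cvg F.
  apply: cauchy_cvg; apply/cauchy_ballP => e e0.
  have eR : (Re e)%:C%C = e by rewrite RRe_real// gtr0_real.
  have re0 : 0 < Re e by rewrite -ltcR eR.
  have [A FA Ae] := FC (Re e ^+ 2) (exprn_gt0 _ re0).
  exists (A, A) => //= -[y z] [/= Ay Az]; rewrite -eR; apply/ball_nsq => //.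
  exact: Ae.
by move=> ?; exists (lim F).
Qed.

Lemma cvg_rin (F : set_system H) (FF : Filter F) x z (e : R) :
  F --> x -> 0 < e -> \forall y \near F, `|rin y z - rin x z| < e.
Proof.
move=> /cvg_nsqP Fx e0; set c := 1 + nsq z.
have c0 : 0 < c by rewrite /c; have := nsq_ge0 z; lra.
have ec0 : 0 < e ^+ 2 / c by rewrite divr_gt0 ?exprn_gt0.
have := Fx _ ec0; apply: filterS => y; rewrite ltr_pdivlMr// => yx.
rewrite -rinBl -[e](ger0_norm (ltW e0)) -ltr_sqr ?nnegrE// real_normK ?num_real//.
rewrite real_normK ?num_real//; have := rin_sqr_le (y - x) z.
by rewrite /c in yx; have := nsq_ge0 (y - x); nra.
Qed.

End inner_product.

Section bounded.
Context {R : realType} {H : hilbertType R}.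
Local Notation C := R[i].
Implicit Types T : H -> H.

Lemma bounded_operatorP T : bounded_operator T <->
  linear T /\ exists2 c : R, 0 < c & forall x, nsq (T x) <= c * nsq x.
Proof.
split=> [[lT cT]|[lT [c c0 Tc]]]; split=> //.
  have T0 : T 0 = 0 by have := lT (-1) 0 0; rewrite !scaleN1r !addNr.
  have /cvg_nsqP := cT 0; rewrite T0 => /(_ 1 ltr01).
  rewrite near_simpl => /nbhs_ballP[e /= e0 eT].
  have eR : (Re e)%:C%C = e by rewrite RRe_real// gtr0_real.
  have re0 : 0 < Re e by rewrite -ltcR eR.
  set d := Re e / 2; have d0 : 0 < d by rewrite /d; lra.
  exists (d ^- 2); first by rewrite invr_gt0 exprn_gt0.
  have TZ a x : T (a *: x) = a *: T x by have := lT a x 0; rewrite T0 !addr0.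
  move=> x; have [->|/eqP x0] := eqVneq x 0; first by rewrite T0 nsq0; lra.
  have xp := nsq_gt0 x0; set a := d / Num.sqrt (nsq x).
  have sx : 0 < Num.sqrt (nsq x) by rewrite sqrtr_gt0.
  have a2 : a ^+ 2 = d ^+ 2 / nsq x.
    by rewrite /a expr_div_n sqr_sqrtr ?ltW.
  have : ball 0 e (a%:C%C *: x).
    rewrite -eR; apply/ball_nsq => //; rewrite sub0r nsqN nsqZr a2 divfK ?gt_eqF//.
    by rewrite /d; nra.
  move/eT => /=; rewrite subr0 TZ nsqZr a2 => h.
  have d2 : 0 < d ^+ 2 by rewrite exprn_gt0.
  rewrite mulrC ler_pdivlMr// mulrC; move: h; rewrite mulrAC ltr_pdivrMr// mul1r.
  exact: ltW.
move=> x; apply/cvg_nsqP => e e0; have ec : 0 < e / c by rewrite divr_gt0.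
have TB y z : T (y - z) = T y - T z.
  by have := lT (-1) z y; rewrite !scaleN1r (addrC _ y) => ->; rewrite addrC.
have /cvg_nsqP/(_ _ ec) : nbhs x --> x by exact: cvg_id.
apply: filterS => y; rewrite ltr_pdivlMr// => h; rewrite /= -TB.
by apply: le_lt_trans (Tc _) _; rewrite mulrC.
Qed.

(** Riesz representation. The representing vector minimizes
    |y|^2 - 2 Re f(y); a minimizing filter is Cauchy by the parallelogram law. *)
Lemma riesz_representation (f : H -> C) (c : R) :
  (forall a x y, f (a *: x + y) = a * f x + f y) ->
  (forall x, Re (f x) ^+ 2 <= c * nsq x) -> exists y, forall x, f x = inner x y.
Proof.
move=> lf fc.
have f0 : f 0 = 0 by have := lf (-1) 0 0; rewrite scaleN1r mulN1r !addNr.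
have fD x y : f (x + y) = f x + f y by have := lf 1 x y; rewrite scale1r mul1r.
have fZ a x : f (a *: x) = a * f x by have := lf a x 0; rewrite f0 !addr0.
pose g x := Re (f x).
have gD x y : g (x + y) = g x + g y.
  by rewrite /g fD; case: (f x) (f y) => ? ? [].
have gZ (a : R) x : g (a%:C%C *: x) = a * g x.
  by rewrite /g fZ; case: (f x) => u v /=; rewrite mul0r subr0.
have g_i x : Im (f x) = - g ('i%C *: x).
  by rewrite /g fZ; case: (f x) => u v /=; ring.
have gN x : g (- x) = - g x.
  have -> : - x = ((-1 : R)%:C)%C *: x by rewrite rmorphN1 scaleN1r.
  by rewrite gZ mulN1r.
pose J x : R := nsq x - 2 * g x.
have gB x : g x ^+ 2 <= `|c| * nsq x.
  by apply: le_trans (fc x) _; rewrite ler_wpM2r ?nsq_ge0// ler_norm.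
have Jlb x : - (1 + `|c|) <= J x.
  rewrite /J; have := gB x; have := nsq_ge0 x; have := normr_ge0 c.
  move: (nsq x) (g x) `|c| => n b k k0 n0 h.
  have [b0|b0] := leP b 0; first lra.
  suff : b <= (n + k) / 2 by lra.
  suff : b ^+ 2 <= ((n + k) / 2) ^+ 2 by rewrite ler_sqr ?nnegrE//; lra.
  by have := sqr_ge0 (n - k); nra.
pose E := range J.
have hE : has_inf E.
  split; first by exists (J 0); exists 0.
  by exists (- (1 + `|c|)) => _ [x _ <-].
pose m := inf E.
have mJ x : m <= J x by apply: ge_inf; [exact: hE.2|exists x].
pose F : set_system H := filter_from [set e : R | 0 < e] (fun e => [set x | J x < m + e]).
have FP : ProperFilter F.
  apply: filter_from_proper; last first.
    move=> e e0; have [_ [x _ <-] xm] := inf_adherent e0 hE.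
    by exists x.
  apply: filter_from_filter; first by exists 1; rewrite /= ltr01.
  move=> e1 e2 /= h1 h2; exists (Num.min e1 e2); first by rewrite /= lt_min h1.
  by move=> x /= xm; split => /=; apply: lt_le_trans xm _; rewrite lerD2l ge_min lexx ?orbT.
have [y Fy] : exists y : H, F --> y.
  apply: cauchy_nsqP => e e0; have e8 : 0 < e / 8 by lra.
  exists [set x | J x < m + e / 8]; first by exists (e / 8).
  move=> y z /= hy hz; have := mJ ((2^-1 : R)%:C%C *: (y + z)).
  move: hy hz; rewrite /J nsqZr gZ gD nsqD nsqB => ? ? ?.
  by lra.
exists y.
have Jy : J y <= m.
  apply/ler_addgt0Pr => e e0; rewrite -/m.
  (* J is compared at y and at a point x of small J near y; the constants make
     each of the three terms of J x - J y at most e / 4. *)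
  pose k := 1 + `|c| + nsq y; have k0 : 0 < k.
    by rewrite /k; have := nsq_ge0 y; have := normr_ge0 c; lra.
  have e20 : 0 < e / 2 by lra.
  have d0 : 0 < Num.min 1 ((e / 32) ^+ 2 / (2 * k)).
    by rewrite lt_min ltr01 divr_gt0 ?exprn_gt0 ?mulr_gt0//; lra.
  have /cvg_nsqP/(_ _ d0) h := Fy.
  have Fe : F [set x | J x < m + e / 2] by exists (e / 2).
  have [x []] := filter_ex (filterI h Fe).
  rewrite lt_min => /andP[x1 xe] /= Jx.
  have -> : y = x - (x - y) by rewrite opprB addrC subrK.
  move: xe x1; set w := x - y => we w1.
  have xw : x = y + w by rewrite /w addrC subrK.
  rewrite /J gD gN nsqB; rewrite /J in Jx.
  have gw := gB w; have rw := rin_sqr_le x w.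
  have nx : nsq x <= 2 * nsq y + 2 by rewrite xw; have := nsqD_le y w; lra.
  move: we; rewrite ltr_pdivlMr ?mulr_gt0// => we.
  have n0 := nsq_ge0 w; have c0 := normr_ge0 c; have y0 := nsq_ge0 y.
  have k1 : 1 <= k by rewrite /k; lra.
  have b0 : 2 * k * nsq w <= (e / 32) ^+ 2 by lra.
  have e2 := sqr_ge0 e.
  have b1 : `|g w| <= e / 8.
    rewrite -ler_sqr ?nnegrE//; last lra.
    rewrite real_normK ?num_real//; apply: le_trans gw _.
    have : `|c| * nsq w <= k * nsq w by rewrite ler_wpM2r// /k; lra.
    by lra.
  have b2 : `|rin x w| <= e / 16.
    rewrite -ler_sqr ?nnegrE//; last lra.
    rewrite real_normK ?num_real//; apply: le_trans rw _.
    have : nsq x * nsq w <= 2 * k * nsq w by rewrite ler_wpM2r// /k; lra.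
    by lra.
  have b3 : nsq w <= e / 8.
    rewrite -ler_sqr ?nnegrE//; last lra.
    have : nsq w ^+ 2 <= nsq w by rewrite expr2 ler_piMr// ltW.
    have : 1 * nsq w <= k * nsq w by rewrite ler_wpM2r.
    by lra.
  by have := ler_norm (g w); have := ler_norm (- rin x w); rewrite normrN; lra.
have gE x : g x = rin x y.
  (* At a minimum of J the derivative in the direction x vanishes; the value of
     t below minimizes the quadratic bound, but for the summand 1, which covers
     the case x = 0. *)
  have Jt (t : R) : 0 <= t ^+ 2 * nsq x + 2 * t * (rin x y - g x).
    have := le_trans Jy (mJ (y + t%:C%C *: x)).
    by rewrite /J nsqD gD gZ nsqZr rinZr (rinC y x); lra.
  set b := rin x y - g x; suff : b = 0 by rewrite /b; lra.
  have := Jt (- b / (1 + nsq x)); rewrite -/b => h.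
  have n0 := nsq_ge0 x; have n1 : 0 < 1 + nsq x by lra.
  have : 0 <= - b ^+ 2 * (2 + nsq x) / (1 + nsq x) ^+ 2.
    by rewrite (_ : _ / _ = (- b / (1 + nsq x)) ^+ 2 * nsq x +
       2 * (- b / (1 + nsq x)) * b)//; field; rewrite gt_eqF.
  rewrite pmulr_lge0 ?invr_gt0 ?exprn_gt0// => h2.
  by apply/eqP; rewrite -sqrf_eq0; apply/eqP; have := sqr_ge0 b; nra.
move=> x; have -> : f x = (g x +i* - g ('i%C *: x))%C.
  by rewrite -g_i /g; case: (f x).
rewrite inner_rin !gE; congr Complex; rewrite -rinNr.
rewrite /rin innerZl innerNr innerZr; case: (inner x y) => u v /=; ring.
Qed.

End bounded.

(** * The ring of bounded operators *)

(** Bounded operators are packaged as a type so that they form a ring under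
    composition; the zero ring is possible, as H may be trivial. *)
Record bop (R : realType) (H : hilbertType R) :=
  Bop { bfun :> H -> H ; bfunP : bounded_operator bfun }.

Section bop_structure.
Context {R : realType} {H : hilbertType R}.
Local Notation C := R[i].
Implicit Types S T : bop H.

HB.instance Definition _ := gen_eqMixin (bop H).
HB.instance Definition _ := gen_choiceMixin (bop H).

Lemma bop_ext S T : (forall x, S x = T x) -> S = T.
Proof.
case: S T => [S bS] [T bT] /= /funext ST; subst T.
by congr Bop; exact: Prop_irrelevance.
Qed.

HB.instance Definition _ T :=
  GRing.isLinear.Build C H H *:%R T (proj1 (bfunP T)).

Lemma bop_bounded T : exists2 c : R, 0 < c & forall x, nsq (T x) <= c * nsq x.
Proof. by have /bounded_operatorP[_] := bfunP T. Qed.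

Lemma make_bop (f : H -> H) (c : R) : linear f ->
  (forall x, nsq (f x) <= c * nsq x) -> bounded_operator f.
Proof.
move=> lf fc; apply/bounded_operatorP; split=> //; exists (1 + `|c|).
  by have := normr_ge0 c; lra.
move=> x; apply: le_trans (fc x) _; rewrite ler_wpM2r ?nsq_ge0//.
by have := ler_norm c; lra.
Qed.

Let zero_bounded : bounded_operator (fun=> 0 : H).
Proof.
apply: (@make_bop _ 0) => [a x y|x]; first by rewrite scaler0 addr0.
by rewrite nsq0 mul0r.
Qed.
Let one_bounded : bounded_operator (idfun : H -> H).
Proof. by apply: (@make_bop _ 1) => // x; rewrite mul1r. Qed.
Let scale_bounded (a : C) T : bounded_operator (fun x => a *: T x).
Proof.
have [c c0 Tc] := bop_bounded T.
apply: (@make_bop _ ((Re a ^+ 2 + Im a ^+ 2) * c)) => [b x y|x].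
  by rewrite linearP scalerDr !scalerA mulrC.
by rewrite nsqZ -mulrA ler_wpM2l// addr_ge0 ?sqr_ge0.
Qed.
Let add_bounded S T : bounded_operator (fun x => S x + T x).
Proof.
have [c c0 Tc] := bop_bounded T; have [d d0 Sd] := bop_bounded S.
apply: (@make_bop _ (2 * d + 2 * c)) => [b x y|x].
  by rewrite !linearP scalerDr addrACA.
by apply: le_trans (nsqD_le _ _) _; have := Tc x; have := Sd x; lra.
Qed.
Let mul_bounded S T : bounded_operator (fun x => S (T x)).
Proof.
have [c c0 Tc] := bop_bounded T; have [d d0 Sd] := bop_bounded S.
apply: (@make_bop _ (d * c)) => [b x y|x]; first by rewrite !linearP.
by apply: le_trans (Sd _) _; rewrite -mulrA ler_wpM2l// ltW.
Qed.

Definition bop0 := Bop zero_bounded.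
Definition bop1 := Bop one_bounded.
Definition bopZ a T := Bop (scale_bounded a T).
Definition bopD S T := Bop (add_bounded S T).
Definition bopM S T := Bop (mul_bounded S T).

Let b_addA : associative bopD. Proof. by move=> *; apply: bop_ext => x /=; rewrite addrA. Qed.
Let b_addC : commutative bopD. Proof. by move=> *; apply: bop_ext => x /=; rewrite addrC. Qed.
Let b_add0 : left_id bop0 bopD. Proof. by move=> *; apply: bop_ext => x /=; rewrite add0r. Qed.
Let b_addN : left_inverse bop0 (bopZ (-1)) bopD.
Proof. by move=> *; apply: bop_ext => x /=; rewrite scaleN1r addNr. Qed.
HB.instance Definition _ := GRing.isZmodule.Build (bop H) b_addA b_addC b_add0 b_addN.

Let b_mulA : associative bopM. Proof. by move=> *; exact: bop_ext. Qed.
Let b_mul1 : left_id bop1 bopM. Proof. by move=> *; exact: bop_ext. Qed.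
Let b_mulr1 : right_id bop1 bopM. Proof. by move=> *; exact: bop_ext. Qed.
Let b_mulDl : left_distributive bopM bopD. Proof. by move=> *; exact: bop_ext. Qed.
Let b_mulDr : right_distributive bopM bopD.
Proof. by move=> *; apply: bop_ext => x /=; rewrite linearD. Qed.
HB.instance Definition _ :=
  GRing.Zmodule_isPzRing.Build (bop H) b_mulA b_mul1 b_mulr1 b_mulDl b_mulDr.

Let scaleA a b T : bopZ a (bopZ b T) = bopZ (a * b) T.
Proof. by apply: bop_ext => x /=; rewrite scalerA. Qed.
Let scale1 : left_id 1 bopZ. Proof. by move=> T; apply: bop_ext => x /=; rewrite scale1r. Qed.
Let scaleDr : right_distributive bopZ +%R.
Proof. by move=> a S T; apply: bop_ext => x /=; rewrite scalerDr. Qed.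
Let scaleDl T : {morph bopZ^~ T : a b / a + b}.
Proof. by move=> a b; apply: bop_ext => x /=; rewrite scalerDl. Qed.
HB.instance Definition _ :=
  GRing.Zmodule_isLmodule.Build C (bop H) scaleA scale1 scaleDr scaleDl.

Lemma bopDE S T x : (S + T) x = S x + T x. Proof. by []. Qed.
Lemma bopNE T x : (- T) x = - T x. Proof. exact: scaleN1r. Qed.
Lemma bopBE S T x : (S - T) x = S x - T x. Proof. by rewrite bopDE bopNE. Qed.
Lemma bopME S T x : (S * T) x = S (T x). Proof. by []. Qed.
Lemma bopZE a T x : (a *: T) x = a *: T x. Proof. by []. Qed.
Lemma bop1E x : (1 : bop H) x = x. Proof. by []. Qed.
Lemma bop0E x : (0 : bop H) x = 0. Proof. by []. Qed.
Lemma bop_sumE I (r : seq I) (P : pred I) (F : I -> bop H) x :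
  (\sum_(i <- r | P i) F i) x = \sum_(i <- r | P i) F i x.
Proof. by elim/big_rec2: _ => // i y T _ <-. Qed.

Lemma bopZl a S T : (a *: S) * T = a *: (S * T). Proof. exact: bop_ext. Qed.
Lemma bopZr a S T : S * (a *: T) = a *: (S * T).
Proof. by apply: bop_ext => x; rewrite !(bopME, bopZE) linearZ. Qed.

Lemma adjoint_exists T : exists S : bop H, adjoint_spec T S.
Proof.
have [c c0 Tc] := bop_bounded T.
have h y : exists z, forall x, inner (T x) y = inner x z.
  apply: (@riesz_representation _ _ _ (c * nsq y)) => [a x z|x].
    by rewrite linearP innerDl innerZl.
  apply: le_trans (rin_sqr_le _ _) _; rewrite mulrAC ler_wpM2r ?nsq_ge0//.
have [S ST] := choice h.
have bS : bounded_operator S.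
  apply: (@make_bop _ c) => [a x y|y].
    apply: inner_ext => z; rewrite rinC (rinC _ z) rinDr /rin -ST innerDr innerZr !ST.
    by rewrite innerZr; case: (_ * _) (inner z (S y)) => ? ? [].
  have := rin_sqr_le (T (S y)) y; rewrite {1}/rin ST -/(rin _ _) -/(nsq _) => h2.
  have [->|/eqP y0] := eqVneq (S y) 0; first by rewrite nsq0 mulr_ge0 ?nsq_ge0 ?ltW.
  rewrite -(ler_pM2l (nsq_gt0 y0)) -expr2; apply: le_trans h2 _.
  by rewrite mulrCA mulrA ler_wpM2r ?nsq_ge0.
by exists (Bop bS).
Qed.

Definition adj T : bop H := projT1 (cid (adjoint_exists T)).

Lemma adjP T : adjoint_spec T (adj T).
Proof. exact: (projT2 (cid (adjoint_exists T))). Qed.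

Lemma adjoint_bop T : adjoint T = adj T.
Proof. exact/adjointE/adjP. Qed.

Lemma rin_adj T x y : rin (T x) y = rin x (adj T y).
Proof. by rewrite /rin adjP. Qed.
Lemma inner_adjl T x y : inner (adj T x) y = inner x (T y).
Proof. by rewrite innerC -adjP -innerC. Qed.
Lemma rin_adjl T x y : rin (adj T x) y = rin x (T y).
Proof. by rewrite /rin inner_adjl. Qed.

Lemma adj_uniq S T : (forall x y, rin (T x) y = rin x (S y)) -> adj T = S.
Proof.
by move=> ST; apply: bop_ext => y; apply: inner_ext => x; rewrite rin_adjl rinC ST rinC.
Qed.

Lemma adjK : involutive adj.
Proof. by move=> T; apply: adj_uniq => x y; exact: rin_adjl. Qed.
Lemma adjD S T : adj (S + T) = adj S + adj T.
Proof. by apply: adj_uniq => x y; rewrite !bopDE rinDl rinDr !rin_adj. Qed.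
Lemma adjM S T : adj (S * T) = adj T * adj S.
Proof. by apply: adj_uniq => x y; rewrite !bopME !rin_adj. Qed.
Lemma adjZ a T : adj (a *: T) = (a^*)%C *: adj T.
Proof.
apply: adj_uniq => x y; rewrite !bopZE /rin innerZl innerZr -adjP.
by case: a => u v /=; rewrite opprK.
Qed.
Lemma adjZr (a : R) T : adj (a%:C%C *: T) = a%:C%C *: adj T.
Proof. by rewrite adjZ conjc_real. Qed.
Lemma adjN T : adj (- T) = - adj T.
Proof. by rewrite -scaleN1r adjZ rmorphN1 scaleN1r. Qed.
Lemma adjB S T : adj (S - T) = adj S - adj T.
Proof. by rewrite adjD adjN. Qed.
Lemma adj1 : adj 1 = 1. Proof. exact: adj_uniq. Qed.
Lemma adj0 : adj 0 = 0.
Proof. by apply: adj_uniq => x y; rewrite rin0l rin0r. Qed.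
Lemma adj_sum I (r : seq I) (P : pred I) (F : I -> bop H) :
  adj (\sum_(i <- r | P i) F i) = \sum_(i <- r | P i) adj (F i).
Proof. by elim/big_rec2: _ => [|i S T _ <-]; rewrite ?adj0 ?adjD. Qed.

Lemma nsq_bop T x : nsq (T x) = rin ((adj T * T) x) x.
Proof. by rewrite bopME rin_adjl. Qed.

Lemma bop_eq0 T : adj T * T = 0 -> T = 0.
Proof.
move=> TT; apply: bop_ext => x; apply: nsq_eq0.
by rewrite nsq_bop TT rin0l.
Qed.

Definition proj T := T * T = T /\ adj T = T.
Definition ple S T := S * T = S.

Implicit Types p q e : bop H.

Lemma proj_id p : proj p -> p * p = p. Proof. by case. Qed.
Lemma proj_adj p : proj p -> adj p = p. Proof. by case. Qed.
Lemma proj0 : proj 0. Proof. by split; rewrite ?mul0r ?adj0. Qed.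
Lemma proj_one : proj 1. Proof. by split; rewrite ?mul1r ?adj1. Qed.
Lemma ple_sym p q : proj p -> proj q -> ple p q -> q * p = p.
Proof.
move=> [_ ap] [_ aq] pq.
by have := congr1 adj pq; rewrite adjM ap aq.
Qed.
Lemma ple_refl p : proj p -> ple p p. Proof. by case. Qed.
Lemma ple_trans p q e : ple p q -> ple q e -> ple p e.
Proof. by rewrite /ple => pq qe; rewrite -pq -mulrA qe. Qed.
Lemma ple_antisym p q : proj p -> proj q -> ple p q -> ple q p -> p = q.
Proof. by move=> Pp Pq pq qp; rewrite -pq (ple_sym Pq Pp qp). Qed.
Lemma ple0 p : ple 0 p. Proof. exact: mul0r. Qed.
Lemma proj_nsq p x : proj p -> nsq (p x) = rin (p x) x.
Proof. by move=> [pp ap]; rewrite nsq_bop ap pp. Qed.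
Lemma projB p q : proj p -> proj q -> ple p q -> proj (q - p).
Proof.
move=> Pp Pq pq; split; last by rewrite adjB !proj_adj.
by rewrite mulrBl !mulrBr (proj_id Pp) (proj_id Pq) pq (ple_sym Pp Pq pq) subrr subr0.
Qed.
Lemma projC p : proj p -> proj (1 - p).
Proof. by move=> Pp; apply: projB => //; exact: proj_one. Qed.
Lemma nsq_projB p q x : proj p -> proj q -> ple p q ->
  nsq ((q - p) x) = nsq (q x) - nsq (p x).
Proof.
by move=> Pp Pq pq; rewrite !proj_nsq//; [rewrite bopBE rinBl|exact: projB].
Qed.
Lemma ple_nsq p q x : proj p -> proj q -> ple p q -> nsq (p x) <= nsq (q x).
Proof. by move=> Pp Pq pq; rewrite -subr_ge0 -nsq_projB// nsq_ge0. Qed.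
Lemma nsq_proj_le p x : proj p -> nsq (p x) <= nsq x.
Proof. by move=> Pp; apply: (@ple_nsq p 1) => //; exact: proj_one. Qed.
Lemma projD p q : proj p -> proj q -> p * q = 0 -> proj (p + q).
Proof.
move=> Pp Pq pq.
have qp : q * p = 0 by have := congr1 adj pq; rewrite adjM (proj_adj Pp) (proj_adj Pq) adj0.
split; last by rewrite adjD !proj_adj.
by rewrite mulrDl !mulrDr !proj_id// pq qp addr0 add0r.
Qed.

End bop_structure.
Arguments ple {R H}.

(** * Strong limits and the weak operator topology *)

Section strong_limits.
Context {R : realType} {H : hilbertType R}.
Implicit Types (S T P : bop H) (x y z : H).

Lemma bop_raddD T x y : T (x + y) = T x + T y. Proof. exact: linearD. Qed.
Lemma bop_raddN T x : T (- x) = - T x. Proof. exact: linearN. Qed.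
Lemma bop_raddB T x y : T (x - y) = T x - T y. Proof. exact: linearB. Qed.
Lemma bop_raddZ T a x : T (a *: x) = a *: T x. Proof. exact: linearZ. Qed.
Lemma bop_radd0 T : T 0 = 0. Proof. exact: linear0. Qed.

(** Expands the real inner products of expressions in operators. Equality of
    two such operators, tested by bop_ext and inner_ext, then becomes linear
    arithmetic. *)
Definition rin_expand := (@bopDE _ H, @bopBE _ H, @bopNE _ H, @bopME _ H, @bopZE _ H, @bop1E _ H, @bop0E _ H,
  bop_raddD, bop_raddN, bop_raddB, bop_raddZ, bop_radd0,
  @rinDl _ H, @rinBl _ H, @rinNl _ H, @rinZl _ H, @rin0l _ H,
  @rinDr _ H, @rinBr _ H, @rinNr _ H, @rinZr _ H, @rin0r _ H).

(** The filter of tails of a directed set D. *)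
Definition section_filter {I} (D : set I) (le : I -> I -> Prop) : set_system I :=
  filter_from D (fun i => [set j | D j /\ le i j]).

Lemma section_filter_proper {I} (D : set I) (le : I -> I -> Prop) :
  D !=set0 -> (forall i, D i -> le i i) ->
  (forall i j k, le i j -> le j k -> le i k) ->
  (forall i j, D i -> D j -> exists2 k, D k & le i k /\ le j k) ->
  ProperFilter (section_filter D le).
Proof.
move=> D0 lexx letr dir; apply: filter_from_proper; last first.
  by move=> i Di; exists i; split=> //; exact: lexx.
apply: filter_from_filter => // i j Di Dj; have [k Dk [ik jk]] := dir _ _ Di Dj.
by exists k => // l [Dl kl]; split; split => //; [exact: letr kl|exact: letr kl].
Qed.

(** The squared norms increase to their supremum and, by the condition on the
    increments, a net with this property is Cauchy. The condition holds for
    p_i x when the p_i are increasing projections. *)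
Lemma increasing_cvg {I} (D : set I) (le : I -> I -> Prop) (u : I -> H) (c : R) :
  ProperFilter (section_filter D le) -> (forall i, D i -> le i i) ->
  (forall i j, D i -> D j -> le i j ->
    nsq (u j - u i) <= nsq (u j) - nsq (u i)) ->
  (forall i, D i -> nsq (u i) <= c) ->
  exists y, u @ section_filter D le --> y.
Proof.
move=> FP lexx incr uc.
have D0 : D !=set0.
  by have [i Di _] : section_filter D le setT := filterT; exists i.
pose E := [set nsq (u i) | i in D].
have hE : has_sup E.
  split; first by have [i Di] := D0; exists (nsq (u i)); exists i.
  by exists c => _ [i Di <-]; exact: uc.
apply: cauchy_nsqP => e e0; have e4 : 0 < e / 4 by lra.
have [_ [i Di <-] hi] := sup_adherent e4 hE.
exists (u @` [set j | D j /\ le i j]).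
  exists i => // j ij; by exists j.
move=> _ _ [j [Dj ij] <-] [k [Dk ik] <-].
have hj : nsq (u j) <= sup E by apply: ub_le_sup; [exact: hE.2|exists j].
have hk : nsq (u k) <= sup E by apply: ub_le_sup; [exact: hE.2|exists k].
have := incr _ _ Di Dj ij; have := incr _ _ Di Dk ik => h1 h2.
have -> : u j - u k = (u j - u i) + - (u k - u i) by rewrite opprB addrA subrK.
by apply: le_lt_trans (nsqD_le _ _) _; rewrite nsqN; lra.
Qed.

Lemma cvg_rin_le (F : set_system H) (FF : ProperFilter F) x z (a : R) :
  F --> x -> (\forall y \near F, rin y z <= a) -> rin x z <= a.
Proof.
move=> Fx Fa; apply/ler_addgt0Pr => e e0.
have [y [ya]] := filter_ex (filterI Fa (cvg_rin _ z Fx e0)).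
by rewrite ltr_norml => /andP[h1 h2]; lra.
Qed.

Lemma cvg_rin_ge (F : set_system H) (FF : ProperFilter F) x z (a : R) :
  F --> x -> (\forall y \near F, a <= rin y z) -> a <= rin x z.
Proof.
move=> Fx Fa; rewrite -lerN2 -rinNr; apply: cvg_rin_le Fx _.
by apply: filterS Fa => y; rewrite rinNr lerN2.
Qed.

Lemma cvg_nsq_le (F : set_system H) (FF : ProperFilter F) x (a : R) :
  F --> x -> (\forall y \near F, nsq y <= a) -> nsq x <= a.
Proof.
move=> Fx Fa; have a0 : 0 <= a.
  by have [y ya] := filter_ex Fa; apply: le_trans ya; exact: nsq_ge0.
have : rin x x <= (a + nsq x) / 2.
  apply: cvg_rin_le Fx _; apply: filterS Fa => y ya.
  by have := rin_le y x; lra.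
by rewrite -/(nsq x); lra.
Qed.

Lemma cvg_nsq_ge (F : set_system H) (FF : ProperFilter F) x (a : R) :
  F --> x -> (\forall y \near F, a <= nsq y) -> a <= nsq x.
Proof.
move=> Fx Fa; apply/ler_addgt0Pr => e e0.
have e1 : 0 < e / (4 + 4 * nsq x + 4 * e) * e.
  by rewrite mulr_gt0// divr_gt0//; have := nsq_ge0 x; lra.
set d := e / _ * e in e1.
have /cvg_nsqP/(_ _ e1) h := Fx.
have e2 : 0 < e / 4 by lra.
have [y [[ya yx] yr]] := filter_ex (filterI (filterI Fa h) (cvg_rin _ x Fx e2)).
have n0 := nsq_ge0 x.
have de : d <= e / 4.
  rewrite /d mulrAC ler_pdivrMr; last lra.
  by nra.
move: yr; rewrite ltr_norml -/(nsq x) => /andP[_ yr].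
by move: yx; rewrite nsqB; lra.
Qed.

Lemma cvg_near_eq {I : Type} (F : set_system I) (FF : Filter F) (f g : I -> H) y :
  (\forall t \near F, f t = g t) -> g @ F --> y -> f @ F --> y.
Proof.
move=> fg /cvg_nsqP gy; apply/cvg_nsqP => e e0.
by apply: filterS2 fg (gy e e0) => t /= ->.
Qed.

Lemma cvg_bop {I : Type} (F : set_system I) (FF : Filter F) (u : I -> H) T y :
  u @ F --> y -> (fun i => T (u i)) @ F --> T y.
Proof.
move=> /cvg_nsqP uy; apply/cvg_nsqP => e e0; have [c c0 Tc] := bop_bounded T.
have := uy _ (divr_gt0 e0 c0); rewrite !near_simpl; apply: filterS => i.
rewrite ltr_pdivlMr// mulrC => h; rewrite /= -bop_raddB.
exact: le_lt_trans (Tc _) h.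
Qed.

Lemma strong_limit (F : set_system (bop H)) (FF : ProperFilter F) (c : R) :
  F [set T | forall x, nsq (T x) <= c * nsq x] ->
  (forall x, exists y : H, (fun T : bop H => T x) @ F --> y) ->
  exists2 P : bop H, (forall x, (fun T : bop H => T x) @ F --> P x) &
    forall x, nsq (P x) <= c * nsq x.
Proof.
move=> Fc /choice[P FP].
have Pc x : nsq (P x) <= c * nsq x.
  by apply: cvg_nsq_le (FP x) _; rewrite near_simpl; apply: filterS Fc => T; exact.
have lP : linear P.
  move=> a x y; apply: (cvg_unique _ (FP _)) => //.
  have -> : (fun T : bop H => T (a *: x + y)) = (fun T : bop H => a *: T x + T y).
    by apply/funext => T; rewrite linearP.
  by apply: cvgD; [apply: cvgZr; exact: FP|exact: FP].
by exists (Bop (make_bop lP Pc)).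
Qed.

End strong_limits.

Section cplx_ball.
Context {R : realType}.
Lemma cplx_ball (z w : R[i]) (e : R) : 0 < e ->
  ball (z : cplx R) e%:C%C w <-> Re (z - w) ^+ 2 + Im (z - w) ^+ 2 < e ^+ 2.
Proof.
move=> e0; rewrite -ball_normE /ball_/= normc_def ltcR.
by rewrite -[X in _ < X](ger0_norm (ltW e0)) -sqrtr_sqr ltr_sqrt ?exprn_gt0.
Qed.

Lemma cvg_cplxP {T} (F : set_system T) (FF : Filter F) (f : T -> cplx R) (z : cplx R) :
  f @ F --> z <-> (forall e : R, 0 < e ->
    \forall t \near F, Re (f t - z) ^+ 2 + Im (f t - z) ^+ 2 < e).
Proof.
split=> [/cvg_ballP Fx e e0|Fx].
  have s0 : 0 < Num.sqrt e by rewrite sqrtr_gt0.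
  have := Fx (Num.sqrt e)%:C%C; rewrite ltcR => /(_ s0); apply: filterS => t.
  move/(cplx_ball _ _ s0); rewrite sqr_sqrtr ?ltW//.
  by case: (f t) z {Fx} => a b [u v]/=; rewrite -sqrrN opprB -[in X in _ + X]sqrrN opprB.
apply/cvg_ballP => e e0.
have eR : (Re e)%:C%C = e by rewrite RRe_real// gtr0_real.
have re0 : 0 < Re e by rewrite -ltcR eR.
have := Fx (Re e ^+ 2); rewrite exprn_gt0// => /(_ isT); apply: filterS => t tx.
rewrite -eR; apply/cplx_ball => //; move: tx.
by case: (f t) z {Fx} => a b [u v]/=; rewrite -sqrrN opprB -[in X in _ + X]sqrrN opprB.
Qed.

End cplx_ball.

Section wot.
Context {R : realType} {H : hilbertType R}.

Lemma wot_cvg {T} (F : set_system T) (FF : Filter F) (f : T -> (H -> H)) (P : H -> H) :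
  (forall x y, (fun t => inner (f t x) y : cplx R) @ F --> (inner (P x) y : cplx R)) ->
  f @ F --> (P : wot H).
Proof.
move=> FP A [_ [[B Bop <-] /= BP BA]].
apply: (@filterS _ F _ (fun t => B (fun z => inner (f t z.1) z.2))); first by move=> t Bt; exact: BA.
have : {ptws, (fun t z => inner (f t z.1) z.2 : cplx R) @ F --> (fun z => inner (P z.1) z.2)}.
  by apply/(@pointwise_cvgP (discrete_topology (H * H)%type)) => -[x y]; exact: FP.
by apply; exact: open_nbhs_nbhs.
Qed.

Lemma wot_inner_continuous x y :
  continuous (fun T : wot H => inner (T x) y : cplx R).
Proof.
move=> T; have : {ptws, (fun (S : wot H) z => inner (S z.1) z.2 : cplx R) @ nbhs T -->
    (fun z => inner (T z.1) z.2)}.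
  exact: (@initial_continuous _ _ (fun T : H -> H => (fun z => inner (T z.1) z.2) : {ptws H * H -> cplx R})).
by move/(@pointwise_cvgP (discrete_topology (H * H)%type))/(_ (x, y)).
Qed.

End wot.

(** * Signs of selfadjoint operators *)

Section von_neumann.
Context {R : realType} {H : hilbertType R} (M : vonNeumannAlgebra H).
Local Notation C := R[i].
Implicit Types (S T P h k p q : bop H) (x y z : H).

Definition vnb : set (bop H) := [set T | vn_set M T].

Lemma vnb_lift (f : H -> H) : vn_set M f -> exists2 T : bop H, vnb T & bfun T = f.
Proof. by move=> Mf; exists (Bop (vn_bounded (vn_setP M) Mf)). Qed.
Lemma vnb1 : vnb 1. Proof. exact: vn_unit (vn_setP M). Qed.
Lemma vnbP a S T : vnb S -> vnb T -> vnb (a *: S + T).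
Proof. exact: vn_linear (vn_setP M) a S T. Qed.
Lemma vnbM S T : vnb S -> vnb T -> vnb (S * T).
Proof. exact: vn_comp (vn_setP M) S T. Qed.
Lemma vnb_adj T : vnb T -> vnb (adj T).
Proof. by move=> MT; rewrite /vnb/= -adjoint_bop; exact: vn_adjoint (vn_setP M) T MT. Qed.
Lemma vnb0 : vnb 0.
Proof. by rewrite -(addNr (1 : bop H)) -scaleN1r; apply: vnbP; exact: vnb1. Qed.
Lemma vnbZ a T : vnb T -> vnb (a *: T).
Proof. by move=> MT; rewrite -[_ *: _]addr0; apply: vnbP => //; exact: vnb0. Qed.
Lemma vnbD S T : vnb S -> vnb T -> vnb (S + T).
Proof. by move=> MS MT; rewrite -[S]scale1r; exact: vnbP. Qed.
Lemma vnbN T : vnb T -> vnb (- T).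
Proof. by rewrite -scaleN1r; exact: vnbZ. Qed.
Lemma vnbB S T : vnb S -> vnb T -> vnb (S - T).
Proof. by move=> MS /vnbN; exact: vnbD. Qed.
Lemma vnb_sum I (r : seq I) (Q : pred I) (F : I -> bop H) :
  (forall i, Q i -> vnb (F i)) -> vnb (\sum_(i <- r | Q i) F i).
Proof. by move=> MF; elim/big_ind: _ => //; [exact: vnb0|exact: vnbD]. Qed.
Lemma vnbX T n : vnb T -> vnb (T ^+ n).
Proof. by move=> MT; elim: n => [|n IH]; rewrite ?expr0 ?exprS; [exact: vnb1|exact: vnbM]. Qed.

(** Strong limits are weak limits, and M is closed for the latter. *)
Lemma vnb_lim (F : set_system (bop H)) (FF : ProperFilter F) P :
  F vnb -> (forall x, (fun T : bop H => T x) @ F --> P x) -> vnb P.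
Proof.
move=> FM FP; apply: (vn_wot_closed (vn_setP M)); split; last exact: bfunP.
have FP' : (fun T : bop H => bfun T) @ F --> (bfun P : wot H).
  apply: wot_cvg => x y; apply/cvg_cplxP => e e0.
  have c0 : 0 < 1 + nsq y by have := nsq_ge0 y; lra.
  have ec : 0 < e / (1 + nsq y) by rewrite divr_gt0.
  have /cvg_nsqP/(_ _ ec) := FP x; rewrite near_simpl; apply: filterS => T.
  rewrite ltr_pdivlMr// => h; rewrite -innerBl.
  by apply: le_lt_trans (normc_inner_sqr _ _) _; have := nsq_ge0 (T x - P x); lra.
move=> A /FP' /= FA; have [T [MT TA]] := filter_ex (filterI FM (FA : F (fun T => A (bfun T)))).
by exists (bfun T).
Qed.

Definition sa T := adj T = T.
Definition contractive T := forall x, nsq (T x) <= nsq x.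
(** 0 <= T <= 1 in the order of selfadjoint operators. *)
Definition unit_interval T := forall x, 0 <= rin (T x) x <= nsq x.

Lemma rin_sa T x y : sa T -> rin (T x) y = rin x (T y).
Proof. by move=> sT; rewrite rin_adj sT. Qed.

(** T^2 <= T: positivity of T at x - T x gives
    <T x, x> >= 2 |T x|^2 - <T (T x), T x>,
    and T <= 1 bounds the last term by |T x|^2. *)
Lemma unit_interval_nsq T x : sa T -> unit_interval T -> nsq (T x) <= rin (T x) x.
Proof.
move=> sT uT; have /andP[a0 a1] := uT x; have /andP[b0 b1] := uT (T x).
have pos (t : R) : 0 <= rin (T x) x + t ^+ 2 * rin (T (T x)) (T x) - 2 * t * nsq (T x).
  have /andP[+ _] := uT (x - t%:C%C *: T x); rewrite !rin_expand.
  by rewrite (rin_sa (T x) x sT) -/(nsq (T x)); lra.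
by have := pos 1; lra.
Qed.

Lemma sa_limit (F : set_system (bop H)) (FF : ProperFilter F) P :
  F [set T | sa T] -> (forall x, (fun T : bop H => T x) @ F --> P x) -> sa P.
Proof.
move=> Fsa FP; apply: adj_uniq => x y; apply/eqP; rewrite eq_sym -subr_eq0 -normr_le0.
apply/ler_addgt0Pr => e e0; rewrite add0r; have e2 : 0 < e / 2 by lra.
have h1 : F (fun T : bop H => `|rin (T x) y - rin (P x) y| < e / 2).
  by exact: (cvg_rin _ y (FP x) e2).
have h2 : F (fun T : bop H => `|rin (T y) x - rin (P y) x| < e / 2).
  by exact: (cvg_rin _ x (FP y) e2).
have [T [[sT d1] d2]] := filter_ex (filterI (filterI Fsa h1) h2).
rewrite (rinC x) -(subrKA (rin (T x) y)).
have E : rin (T x) y = rin (T y) x by rewrite rin_sa// rinC.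
apply: le_trans (ler_normD _ _) _.
by rewrite {1}E distrC; lra.
Qed.

End von_neumann.

(** Polynomials with nonnegative coefficients in a positive operator d: a cone
    of positive operators that is stable under products. *)
Section positive_cone.
Context {R : realType} {H : hilbertType R} (d : bop H).
Hypotheses (sd : sa d) (pd : forall x, 0 <= rin (d x) x).
Local Notation C := R[i].
Implicit Types (S T P c k : bop H) (x y z : H).

Inductive cone : bop H -> Prop :=
  | cone0 : cone 0
  | coneS (a : R) i c : 0 <= a -> cone c -> cone (a%:C%C *: d ^+ i + c).

Lemma coneD c1 c2 : cone c1 -> cone c2 -> cone (c1 + c2).
Proof.
move=> h1 h2; elim: h1 => [|a i c a0 _ IH]; first by rewrite add0r.
by rewrite -addrA; exact: coneS.
Qed.

Lemma cone_scale (a : R) c : 0 <= a -> cone c -> cone (a%:C%C *: c).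
Proof.
move=> a0; elim=> [|b i c' b0 _ IH]; first by rewrite scaler0; exact: cone0.
by rewrite scalerDr scalerA -rmorphM; apply: coneS => //; exact: mulr_ge0.
Qed.

Lemma coneX i : cone (d ^+ i).
Proof.
rewrite -[d ^+ i]addr0 -[d ^+ i](scale1r) -(rmorph1 (real_complex R)).
by apply: coneS; [exact: ler01|exact: cone0].
Qed.

Lemma coneM c1 c2 : cone c1 -> cone c2 -> cone (c1 * c2).
Proof.
move=> h1 h2; elim: h1 => [|a i c a0 _ IH]; first by rewrite mul0r; exact: cone0.
rewrite mulrDl; apply: coneD IH; rewrite bopZl; apply: cone_scale a0 _.
elim: h2 => [|b j c' b0 _ IH]; first by rewrite mulr0; exact: cone0.
by rewrite mulrDr bopZr -exprD; exact: coneS.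
Qed.

Lemma cone_comm c T : cone c -> T * d = d * T -> T * c = c * T.
Proof.
move=> cc Td; elim: cc => [|a i c' a0 _ IH]; first by rewrite mulr0 mul0r.
rewrite mulrDr mulrDl IH bopZr bopZl; congr (_ *: _ + _).
by elim: i => [|i IHi]; rewrite ?expr0 ?mulr1 ?mul1r// exprS mulrA Td -mulrA IHi mulrA.
Qed.

Lemma cone_commd c : cone c -> d * c = c * d.
Proof. by move=> cc; exact: cone_comm. Qed.
Lemma cone_commute c1 c2 : cone c1 -> cone c2 -> c1 * c2 = c2 * c1.
Proof. by move=> h1 h2; apply: cone_comm => //; rewrite cone_commd. Qed.

Lemma sa_expr T i : sa T -> sa (T ^+ i).
Proof.
rewrite /sa => sT; elim: i => [|i IH]; first by rewrite expr0 adj1.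
by rewrite exprS adjM IH sT -exprSr exprS.
Qed.

Lemma cone_sa c : cone c -> sa c.
Proof.
rewrite /sa; elim=> [|a i c' a0 _ IH]; first exact: adj0.
by rewrite adjD adjZr IH sa_expr.
Qed.

Lemma cone_pos c x : cone c -> 0 <= rin (c x) x.
Proof.
elim=> [|a i c' a0 _ IH]; first by rewrite rin0l.
rewrite bopDE bopZE rinDl rinZl addr_ge0// mulr_ge0//.
rewrite -(odd_double_half i) addnC -addnn exprD exprD -mulrA bopME rin_sa; last exact: sa_expr.
rewrite -exprD addnC exprD bopME; case: (odd i); last by rewrite expr0 bop1E nsq_ge0.
by rewrite expr1 pd.
Qed.

Variable M : vonNeumannAlgebra H.
Lemma cone_vnb c : vnb M d -> cone c -> vnb M c.
Proof.
move=> Md; elim=> [|a i c' a0 _ IH]; first exact: vnb0.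
by apply: vnbP => //; exact: vnbX.
Qed.

End positive_cone.

(** With b = 1 - a^2 the left factor is a (3 - a^2) / 2, and the right side shows
    how fast a^2 approaches 1. *)
Lemma newton_schulz_step {R : realType} {H : hilbertType R} (a b : bop H) :
  a * b = b * a -> a * a = 1 - b ->
  (a + (2^-1 : R)%:C%C *: (a * b)) * (a + (2^-1 : R)%:C%C *: (a * b)) =
  1 - (4^-1 : R)%:C%C *: (3%:C%C *: (b * b) + b * (b * b)).
Proof.
move=> ab aa; rewrite mulrDl !mulrDr !bopZl !bopZr.
have -> : a * b * a = b * (a * a) by rewrite ab mulrA.
have -> : a * b * (a * b) = b * (a * a) * b by rewrite ab -mulrA -ab !mulrA.
rewrite mulrA aa; apply: bop_ext => x; apply: inner_ext => z.
by rewrite !rin_expand; lra.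
Qed.

(** The sign of a selfadjoint contraction k, as the strong limit of the
    Newton-Schulz iteration k_(n+1) = k_n (3 - k_n^2) / 2. With d = 1 - k^2, all
    k_n are products of k by a polynomial in d with nonnegative coefficients,
    and k_n^2 increases. *)
Section sign.
Context {R : realType} {H : hilbertType R} (M : vonNeumannAlgebra H) (k : bop H).
Hypotheses (Mk : vnb M k) (sk : sa k) (kc : contractive k).
Implicit Types (S T P c : bop H) (x y z : H).

Let d := 1 - k * k.
Let sd : sa d. Proof. by rewrite /sa adjB adj1 adjM sk. Qed.
Let pd x : 0 <= rin (d x) x.
Proof. by rewrite !rin_expand rin_sa// -!/(nsq _) subr_ge0; exact: kc. Qed.
Let Md : vnb M d. Proof. by apply: vnbB; [exact: vnb1|exact: vnbM]. Qed.
Let kd : k * d = d * k. Proof. by rewrite mulrBr mulrBl mulr1 mul1r mulrA. Qed.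

Let step (y : bop H) := (4^-1 : R)%:C%C *: (3%:C%C *: (y * y) + y * (y * y)).
Let D n := iter n step d.
Let f := fix f n := if n is n'.+1 then f n' + (2^-1 : R)%:C%C *: (f n' * D n') else 1.
Let s n := k * f n.

Let coneD_ n : cone d (D n).
Proof.
elim: n => [|n IH]; first by rewrite -[D 0]expr1; exact: coneX.
apply: cone_scale; first by lra.
apply: coneD; last by do 2?apply: coneM => //.
by apply: cone_scale; [lra|exact: coneM].
Qed.

Let cone_f n : cone d (f n).
Proof.
elim: n => [|n IH]; first by rewrite -[f 0](expr0 d); exact: coneX.
by apply: coneD => //; apply: cone_scale; [lra|exact: coneM].
Qed.

Let cone_fB m n : (n <= m)%N -> cone d (f m - f n).
Proof.
move=> /subnK <-; elim: (m - n)%N => [|i IH]; first by rewrite add0n subrr; exact: cone0.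
rewrite addSn /= addrAC; apply: coneD => //; apply: cone_scale; first lra.
exact: coneM.
Qed.

Let s_sa n : sa (s n).
Proof.
by rewrite /sa adjM sk (cone_sa sd (cone_f n)) -(cone_comm (cone_f n) kd).
Qed.

Let ssE n : s n * s n = 1 - D n.
Proof.
have kf i : k * f i = f i * k by exact: cone_comm (cone_f i) kd.
elim: n => [|n IH]; first by rewrite /s /= !mulr1 /d opprB addrC subrK.
have fD : f n * D n = D n * f n by exact: cone_commute.
have sD : s n * D n = D n * s n.
  by rewrite /s -mulrA fD mulrA (cone_comm (coneD_ n) kd) -mulrA.
have -> : s n.+1 = s n + (2^-1 : R)%:C%C *: (s n * D n).
  by rewrite /s /= mulrDr bopZr mulrA.
exact: newton_schulz_step.
Qed.

Let s_nsq n x : nsq (s n x) = nsq x - rin (D n x) x.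
Proof. by rewrite nsq_bop s_sa ssE !rin_expand. Qed.

Let s_contr n : contractive (s n).
Proof. by move=> x; rewrite s_nsq; have := cone_pos sd pd x (coneD_ n); lra. Qed.

Let s_incr n m x : (n <= m)%N -> nsq (s m x - s n x) <= nsq (s m x) - nsq (s n x).
Proof.
move=> nm; pose g := f m - f n; have cg : cone d g by exact: cone_fB.
have -> : s m x - s n x = k (g x) by rewrite /s !bopME -bop_raddB -bopBE.
have -> : s m x = s n x + k (g x).
  by rewrite /s /g !bopME bopBE bop_raddB addrC subrK.
rewrite nsqD; have : 0 <= rin (s n x) (k (g x)).
  have -> : s n x = f n (k x) by rewrite /s (cone_comm (cone_f n) kd).
  have -> : k (g x) = g (k x) by rewrite -!bopME (cone_comm cg kd).
  rewrite -(rin_sa _ _ (cone_sa sd cg)) -bopME.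
  by apply: (cone_pos sd pd); exact: coneM.
by lra.
Qed.

(** That t is the sign of k is expressed by t^3 = t, t k >= 0 and t^2 k = k. *)
Lemma sign_operator : exists t : bop H, [/\ vnb M t, sa t, contractive t,
   t * k = k * t & t * t * t = t] /\
   (forall x, 0 <= rin (t (k x)) x) /\ t * t * k = k.
Proof.
pose le (n m : nat) : Prop := (n <= m)%N.
have FP : ProperFilter (section_filter [set: nat] le).
  apply: section_filter_proper.
  - by exists 0%N.
  - by move=> i _; exact: leqnn.
  - by move=> i j l; exact: leq_trans.
  - by move=> i j _ _; exists (maxn i j) => //; rewrite /le leq_maxl leq_maxr.
set F := section_filter _ _ in FP.
have lims x : exists y : H, (fun T : bop H => T x) @ (s @ F) --> y.
  apply: (increasing_cvg (c := nsq x) (u := fun n => s n x) FP).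
  - by move=> i _; exact: leqnn.
  - by move=> i j _ _ ij; exact: s_incr.
  - by move=> i _; exact: s_contr.
have [|t st tc] := strong_limit (fmap_proper_filter s FP) (c := 1) _ lims.
  rewrite /= nbhs_filterE; apply: filterS filterT => n _ x /=.
  by rewrite mul1r; exact: s_contr.
have {}tc : contractive t by move=> x; rewrite -[nsq x]mul1r.
have {st} st x : (fun n => s n x) @ F --> t x by exact: st.
have Mt : vnb M t.
  apply: (@vnb_lim _ _ M (s @ F)) => //.
  rewrite /= nbhs_filterE; apply: filterS filterT => n _ /=; apply: vnbM => //.
  exact: cone_vnb (cone_f n).
have sat : sa t.
  apply: (sa_limit (F := s @ F)) => //.
  by rewrite /= nbhs_filterE; apply: filterS filterT => n _; exact: s_sa.
have comp (u : nat -> H) y : u @ F --> y -> (fun n => s n (u n)) @ F --> t y.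
  move=> uy; apply/cvg_nsqP => e e0; have e4 : 0 < e / 4 by lra.
  have /cvg_nsqP/(_ _ e4) h1 := uy; have /cvg_nsqP/(_ _ e4) h2 := st y.
  rewrite !near_simpl in h1 h2 *; apply: filterS2 h1 h2 => n /= h1 h2.
  have -> : s n (u n) - t y = s n (u n - y) + (s n y - t y).
    by rewrite bop_raddB addrA subrK.
  apply: le_lt_trans (nsqD_le _ _) _; have := s_contr n (u n - y); lra.
have tk : t * k = k * t.
  apply: bop_ext => x; apply: (@cvg_unique H _ ((fun n => s n (k x)) @ F)).
  - exact: norm_hausdorff.
  - exact: st.
  - have -> : (fun n => s n (k x)) = k \o (fun n => s n x).
      by apply/funext => n /=; rewrite -!bopME /s -mulrA -(cone_comm (cone_f n) kd).
    exact: cvg_bop (st x).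
have ttt : t * t * t = t.
  apply: bop_ext => x; rewrite !bopME.
  have h : (fun n => s n (s n (s n x))) @ F --> t (t (t x)) by exact: comp (comp _ _ (st x)).
  have h' : (fun n => s n x - s n (s n (s n x))) @ F --> t x - t (t (t x)) by exact: cvgB.
  apply/esym/eqP; rewrite -subr_eq0; apply/eqP/nsq_eq0/eqP.
  rewrite eq_le nsq_ge0 andbT; apply/ler_addgt0Pr => e e0; rewrite add0r.
  apply: cvg_nsq_le h' _; rewrite near_simpl.
  have e16 : 0 < e / 16 by lra.
  have /cvg_nsqP/(_ _ e16) := st x; rewrite near_simpl => -[N _ hN].
  exists N => // n [_ Nn].
  have h1 : nsq (s n.+1 x - t x) < e / 16 := hN _ (conj I (leqW Nn)).
  have h2 : nsq (s n x - t x) < e / 16 := hN _ (conj I Nn).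
  change (nsq (s n x - s n (s n (s n x))) <= e).
  have E : s n x - s n (s n (s n x)) = 2%:C%C *: (s n.+1 x - s n x).
    have -> : s n (s n x) = x - D n x.
      by rewrite -[LHS]/((s n * s n) x) ssE bopBE.
    rewrite bop_raddB.
    have -> : s n.+1 x = s n x + (2^-1 : R)%:C%C *: s n (D n x).
      change (k (f n x + (2^-1 : R)%:C%C *: f n (D n x)) = s n x + (2^-1 : R)%:C%C *: s n (D n x)).
      by rewrite bop_raddD bop_raddZ.
    rewrite opprB addrC subrK addrAC subrr add0r scalerA.
    by rewrite -rmorphM/= divff ?pnatr_eq0// scale1r.
  rewrite E nsqZr.
  have -> : s n.+1 x - s n x = (s n.+1 x - t x) + - (s n x - t x).
    by rewrite opprB addrA subrK.
  by have := nsqD_le (s n.+1 x - t x) (- (s n x - t x)); rewrite nsqN; lra.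
exists t; split; first by split.
split=> [x|].
  apply: cvg_rin_ge (st (k x)) _; rewrite near_simpl.
  apply: filterS filterT => n _ /=.
  by rewrite rin_sa//; exact: (cone_pos sd pd _ (cone_f n)).
apply: bop_ext => x; apply/esym/eqP; rewrite -subr_eq0; apply/eqP/nsq_eq0/eqP.
rewrite eq_le nsq_ge0 andbT; pose y := x - t (t x).
have -> : k x - (t * t * k) x = s 0%N y.
  change (k x - t (t (k x)) = k y); rewrite /y bop_raddB; congr (_ - _).
  by rewrite -[t (k x)]/((t * k) x) tk bopME -[t (k _)]/((t * k) (t x)) tk.
have ty : t y = 0 by rewrite /y bop_raddB -[t (t (t x))]/((t * t * t) x) ttt subrr.
rewrite -(@nsq0 R H) -ty; apply: cvg_nsq_ge (st y) _; rewrite near_simpl.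
apply: filterS filterT => n _ /=.
by have := s_incr y (leq0n n); have := nsq_ge0 (s n y - s 0%N y); lra.
Qed.

End sign.

(** * Approximation by projections *)

Section spectral.
Context {R : realType} {H : hilbertType R} (M : vonNeumannAlgebra H).
Local Notation C := R[i].
Implicit Types (S T h k p q : bop H) (x y z : H).

Lemma proj_rin p x y : proj p -> rin (p x) y = rin (p x) (p y).
Proof. by case=> pp ap; rewrite -[p x in LHS]/(p x) -{1}pp bopME rin_adj ap. Qed.

(** A substitute for the spectral theorem: p is the spectral projection of h for
    the interval (1/2, 1], obtained from the sign t of 2 h - 1 as (t^2 + t) / 2.
    The pair (p, 2 h - p) consists of the first binary digit of h and the rest. *)
Lemma first_digit h : vnb M h -> sa h -> unit_interval h ->
  exists p, [/\ vnb M p, proj p & unit_interval (h + h - p)].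
Proof.
move=> Mh sh uh; pose k := h + h - 1.
have Mk : vnb M k by apply: vnbB; [exact: vnbD|exact: vnb1].
have sk : sa k by rewrite /sa adjB adjD sh adj1.
have kc : contractive k.
  move=> x; have := unit_interval_nsq x sh uh.
  have -> : k x = h x + h x - x by [rewrite !rin_expand].
  by rewrite nsqB nsqD rinDl -/(nsq (h x)) -!/(nsq _); lra.
have [t [[Mt st tc tk ttt] [tpos ttk]]] := sign_operator Mk sk kc.
pose P := t * t.
have tP : t * P = t by rewrite mulrA.
have Pt : P * t = t by [].
have PP : P * P = P by rewrite /P mulrA ttt.
have proj_half (e : R) : e ^+ 2 = 1 -> proj ((2^-1 : R)%:C%C *: (P + e%:C%C *: t)).
  move=> e2; split; last by rewrite adjZr adjD adjZr adjM st.
  rewrite bopZl bopZr mulrDl !mulrDr !bopZl !bopZr PP Pt tP -/P.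
  have -> : e%:C%C *: (e%:C%C *: P) = P by rewrite scalerA -rmorphM -expr2 e2 rmorph1 scale1r.
  by apply: bop_ext => x; apply: inner_ext => z; rewrite !rin_expand; lra.
pose p := (2^-1 : R)%:C%C *: (P + (1 : R)%:C%C *: t).
pose p' := (2^-1 : R)%:C%C *: (P + (-1 : R)%:C%C *: t).
have Pp : proj p by apply: proj_half; rewrite expr1n.
have Pp' : proj p' by apply: proj_half; rewrite sqrrN expr1n.
exists p; split=> //.
  by apply/vnbZ/vnbD; [exact: vnbM|exact: vnbZ].
pose a := k * t.
have aE y : 0 <= rin (a y) y <= nsq y.
  rewrite /a -tk bopME tpos /= rin_sa//.
  by have := rin_le (k y) (t y); have := kc y; have := tc y; lra.
have at_ : a * t = t * a by rewrite /a -[in LHS]tk !mulrA.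
have aP : a * P = P * a by rewrite /P mulrA at_ -mulrA at_ mulrA.
have comm_half (e : R) : a * ((2^-1 : R)%:C%C *: (P + e%:C%C *: t)) =
    ((2^-1 : R)%:C%C *: (P + e%:C%C *: t)) * a.
  by rewrite bopZr bopZl mulrDr mulrDl bopZr bopZl aP at_.
have ap : a * p = p * a by exact: comm_half.
have ap' : a * p' = p' * a by exact: comm_half.
have corner q x : proj q -> a * q = q * a -> 0 <= rin (a (q x)) x <= nsq (q x).
  move=> Pq aq; rewrite -[a (q x)]/((a * q) x) aq bopME proj_rin// -[q (a x)]/((q * a) x).
  by rewrite -aq bopME; have := aE (q x).
move=> x; have := corner p x Pp ap; have := corner p' x Pp' ap'.
have PPr : proj P by split=> //; rewrite /P adjM st.
have E0 : nsq ((1 - P) x) = nsq x - rin (P x) x.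
  by rewrite (nsq_projB x PPr proj_one (mulr1 _)) bop1E (proj_nsq x PPr).
have n0 : 0 <= nsq ((1 - P) x) by exact: nsq_ge0.
have kE : k = a * p - a * p'.
  have -> : a * p - a * p' = a * t.
    by rewrite -mulrBr; congr (_ * _); apply: bop_ext => y; apply: inner_ext => z;
      rewrite !rin_expand; lra.
  by rewrite at_ /a -tk mulrA ttk.
have hh : h + h - p = 1 + (a * p - a * p') - p by rewrite -kE /k addrCA subrr addr0.
have E1 : nsq (p x) + nsq (p' x) = rin (P x) x.
  by rewrite !proj_nsq// /p /p' !rin_expand; lra.
rewrite hh bopBE bopDE bopBE bop1E !bopME !(rinBl, rinDl) -(proj_nsq x Pp) -/(nsq x).
by move=> /andP[h1 h2] /andP[h3 h4]; apply/andP; split; lra.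
Qed.

(** The form in which the norm density of the span of the projections is used.
    By first_digit, a map that kills projections satisfies
    Phi h = Phi (2 h - p) / 2, which divides the bound c on |Phi|^2 by 4 each time;
    a general T is a combination of operators between 0 and q. *)
Lemma vanish_on_projections (q : bop H) (Phi : bop H -> H) (c : R) :
  proj q -> vnb M q ->
  (forall a S T, Phi (a *: S + T) = a *: Phi S + Phi T) ->
  (forall T, sa T -> unit_interval T -> nsq (Phi T) <= c) ->
  (forall p, vnb M p -> proj p -> ple p q -> Phi p = 0) ->
  forall T, vnb M T -> q * T * q = T -> Phi T = 0.
Proof.
move=> Pq Mq lPhi Phic Phi0.
have P0 : Phi 0 = 0 by have := lPhi (-1) 0 0; rewrite !scaleN1r !addNr.
have PD S T : Phi (S + T) = Phi S + Phi T by have := lPhi 1 S T; rewrite !scale1r.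
have PZ a T : Phi (a *: T) = a *: Phi T by have := lPhi a T 0; rewrite P0 !addr0.
have c0 : 0 <= c.
  apply: le_trans (nsq_ge0 (Phi 0)) (Phic 0 _ _); first exact: adj0.
  by move=> x; rewrite rin0l lexx nsq_ge0.
have digits n : forall h, vnb M h -> sa h -> unit_interval h -> q * h * q = h ->
    nsq (Phi h) <= c / 4 ^+ n.
  elim: n => [|n IH] h Mh sh uh qh; first by rewrite expr0 divr1; exact: Phic.
  have [p [Mp Pp up]] := first_digit Mh sh uh.
  have hq : h * q = h by rewrite -qh -!mulrA proj_id.
  have qh' : q * h = h by rewrite -qh !mulrA proj_id.
  have pq : ple p q.
    apply/eqP; rewrite eq_sym -subr_eq0; apply/eqP; apply: bop_ext => x.
    have -> : p - p * q = p * (1 - q) by rewrite mulrBr mulr1.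
    apply: nsq_eq0; apply/eqP; rewrite eq_le nsq_ge0 andbT bopME.
    have /andP[+ _] := up ((1 - q) x).
    have h0 : h ((1 - q) x) = 0.
      by rewrite -bopME mulrBr mulr1 hq subrr.
    rewrite bopBE bopDE h0 addr0 sub0r rinNl oppr_ge0.
    by rewrite proj_nsq.
  have -> : h = (2^-1 : R)%:C%C *: (p + (h + h - p)).
    by apply: bop_ext => x; apply: inner_ext => z; rewrite !rin_expand; lra.
  rewrite PZ PD Phi0// add0r nsqZr (exprS 4 n).
  have := IH (h + h - p); have -> : q * (h + h - p) * q = h + h - p.
    by rewrite mulrBr mulrDr qh' mulrBl mulrDl hq (ple_sym Pp Pq pq) pq.
  have s2 : sa (h + h - p) by rewrite /sa adjB adjD sh (proj_adj Pp).
  have M2 : vnb M (h + h - p) by apply: vnbB => //; exact: vnbD.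
  move=> /(_ M2 s2 up erefl) h2.
  have -> : c / (4 * 4 ^+ n) = 4^-1 * (c / 4 ^+ n) by rewrite invfM mulrCA.
  by lra.
have unit0 h : vnb M h -> sa h -> unit_interval h -> q * h * q = h -> Phi h = 0.
  move=> Mh sh uh qh; apply: nsq_eq0; apply/eqP; rewrite eq_le nsq_ge0 andbT.
  apply/ler_addgt0Pr => e e0; rewrite add0r.
  have [n hn] : exists n : nat, c / e <= n%:R.
    by exists (Num.truncn (c / e)).+1; rewrite ltW// truncnS_gt.
  apply: le_trans (digits n h Mh sh uh qh) _.
  have p4 : 0 < (4 : R) ^+ n by rewrite exprn_gt0.
  rewrite ler_pdivrMr//; rewrite ler_pdivrMr// in hn; apply: le_trans hn _.
  rewrite mulrC ler_wpM2l ?ltW//.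
  by rewrite -natrX ltr_nat ltn_expl.
have self0 T : vnb M T -> sa T -> q * T * q = T -> Phi T = 0.
  move=> MT sT qT; have [c' c'0 cT] := bop_bounded T.
  pose b := 1 + c'; have b0 : 0 < b by rewrite /b; lra.
  have bT x : - (b * nsq (q x)) <= rin (T x) x <= b * nsq (q x).
    have -> : rin (T x) x = rin (T (q x)) (q x).
      by rewrite -{1}qT !bopME rin_adj proj_adj.
    have := rin_le (T (q x)) (q x); have := rin_le (- T (q x)) (q x).
    rewrite rinNl nsqN; have := cT (q x); have := nsq_ge0 (q x); rewrite /b.
    by move=> ? ? ? ?; apply/andP; split; nra.
  pose h := (2^-1 : R)%:C%C *: (b^-1%:C%C *: T + q).
  have Mh : vnb M h by apply/vnbZ/vnbD => //; exact: vnbZ.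
  have sh : sa h by rewrite /sa adjZr adjD adjZr sT (proj_adj Pq).
  have qh : q * h * q = h.
    by rewrite /h bopZr bopZl mulrDr mulrDl bopZr bopZl qT !proj_id.
  have uh : unit_interval h.
    move=> x; rewrite /h !rin_expand -(proj_nsq x Pq).
    have /andP[l1 l2] := bT x; have nq := nsq_proj_le x Pq; have n0 := nsq_ge0 (q x).
    have e1 : - nsq (q x) <= b^-1 * rin (T x) x.
      by rewrite mulrC ler_pdivlMr// mulNr mulrC.
    have e2 : b^-1 * rin (T x) x <= nsq (q x).
      by rewrite mulrC ler_pdivrMr// mulrC.
    by apply/andP; split; lra.
  have := unit0 h Mh sh uh qh; rewrite /h PZ PD PZ (Phi0 q)//; last exact: ple_refl.
  rewrite addr0 scalerA => /eqP; rewrite scaler_eq0 -rmorphM fmorph_eq0 => /orP[|/eqP//].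
  by rewrite mulf_eq0 !invr_eq0 pnatr_eq0 /= gt_eqF.
move=> T MT qT.
have qaT : q * adj T * q = adj T.
  by rewrite -{2}qT !adjM (proj_adj Pq) mulrA.
have := self0 (T + adj T) (vnbD MT (vnb_adj MT)).
rewrite /sa adjD adjK addrC mulrDr mulrDl qT qaT PD => /(_ erefl erefl) h1.
pose S := 'i%C *: (T + - adj T).
have := self0 S (vnbZ _ (vnbB MT (vnb_adj MT))).
rewrite /sa /S adjZ adjB adjK.
have -> : ('i^*)%C *: (adj T - T) = 'i%C *: (T - adj T) :> bop H.
  rewrite -[adj T - T]opprB scalerN -scaleNr; congr (_ *: _).
  by apply/eqP; rewrite eq_complex /= oppr0 opprK !eqxx.
rewrite bopZr bopZl mulrBr mulrBl qT qaT PZ PD -[- adj T]scaleN1r PZ scaleN1r.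
move=> /(_ erefl erefl)/eqP; rewrite scaler_eq0 => /orP[|/eqP h2].
  by rewrite eq_complex /= oner_eq0 andbF.
have : 2 *: Phi T = 0.
  rewrite scaler_nat mulr2n; move: h2; rewrite scaleN1r => /subr0_eq h2.
  by rewrite {2}h2.
by move=> /eqP; rewrite scaler_eq0 pnatr_eq0 => /eqP.
Qed.

(** The commutator with T is a bounded linear map on the corner q M q; it is
    not 0, so by vanish_on_projections it does not kill all projections. *)
Lemma exists_noncommuting_projection q S T : proj q -> vnb M q -> vnb M S ->
  q * S * q = S -> S * T <> T * S ->
  exists p, [/\ vnb M p, proj p, ple p q & p * T <> T * p].
Proof.
move=> Pq Mq MS qS ST; apply: contrapT => np; apply: ST; apply: bop_ext => z.
apply/eqP; rewrite -subr_eq0; apply/eqP.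
have [c c0 cT] := bop_bounded T.
apply: (@vanish_on_projections q (fun X => (X * T) z - (T * X) z) (4 * (c * nsq z)) Pq Mq) MS qS.
- move=> a X Y; rewrite mulrDl mulrDr bopZl bopZr !bopDE !bopZE scalerBr opprD.
  by rewrite addrACA.
- move=> X sX uX; apply: le_trans (nsqD_le _ _) _; rewrite nsqN.
  have Xc w : nsq (X w) <= nsq w.
    by have := unit_interval_nsq w sX uX; have /andP[] := uX w; lra.
  have := Xc (T z); have := cT z; have := cT (X z); rewrite !bopME.
  have : c * nsq (X z) <= c * nsq z by rewrite ler_wpM2l// ltW.
  by lra.
- move=> p Mp Pp pq; have pT : p * T = T * p.
    by apply: contrapT => h; apply: np; exists p.
  by rewrite pT subrr.
Qed.

Definition minimal_projection q := [/\ vnb M q, proj q, q <> 0 &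
  forall p, vnb M p -> proj p -> ple p q -> p = 0 \/ p = q].

(** On q M q a state at a unit vector x0 of qH is the only candidate for a scalar
    lambda with q T q = lambda q. It works for 0 and q, which are all the projections
    under q, and so for all T by vanish_on_projections. *)
Lemma minimal_projection_corner q T : minimal_projection q -> vnb M T ->
  exists a : C, q * T * q = a *: q.
Proof.
move=> [Mq Pq q0 qmin] MT.
have [x1 qx1] : exists x, q x <> 0.
  apply: contrapT => h; apply: q0; apply: bop_ext => x.
  by apply: contrapT => qx; apply: h; exists x.
pose x0 := ((Num.sqrt (nsq (q x1)))^-1)%:C%C *: q x1.
have n0 := nsq_gt0 qx1.
have x01 : nsq x0 = 1 by rewrite nsqZr exprVn sqr_sqrtr ?ltW// mulVf ?gt_eqF.
have qx0 : q x0 = x0 by rewrite /x0 bop_raddZ -bopME proj_id.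
exists (inner ((q * T * q) x0) x0); apply: bop_ext => z.
apply/eqP; rewrite -subr_eq0 bopZE; apply/eqP.
apply: (@vanish_on_projections q (fun X => X z - inner (X x0) x0 *: q z) (4 * nsq z) Pq Mq).
- move=> a X Y; rewrite !bopDE !bopZE innerDl innerZl scalerDl scalerBr scalerA opprD.
  by rewrite addrACA.
- move=> X sX uX; apply: le_trans (nsqD_le _ _) _; rewrite nsqN.
  have Xc w : nsq (X w) <= nsq w.
    by have := unit_interval_nsq w sX uX; have /andP[] := uX w; lra.
  have := Xc z; have := Xc x0; have := normc_inner_sqr (X x0) x0; rewrite x01 mulr1 nsqZ.
  have := nsq_proj_le z Pq; have := nsq_ge0 (q z); set r := _ + _.
  have : 0 <= r by rewrite /r addr_ge0 ?sqr_ge0.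
  move=> r0 h1 h2 h3 h4 h5.
  have : r * nsq (q z) <= 1 * nsq z by apply: ler_pM => //; exact: le_trans h4.
  by lra.
- move=> p Mp Pp pq; have [->|->] := qmin p Mp Pp pq.
    by rewrite !bop0E inner0l scale0r subrr.
  by rewrite qx0 innerxx x01 rmorph1 scale1r subrr.
- by apply: vnbM => //; exact: vnbM.
- by rewrite -!mulrA proj_id// !mulrA proj_id.
Qed.

End spectral.

(** * Chains of projections *)

Section chains.
Context {R : realType} {H : hilbertType R} (M : vonNeumannAlgebra H).
Implicit Types (S T P p q e : bop H) (x y z : H) (A : set (bop H)).

Definition projs : set (bop H) := [set p | vnb M p /\ proj p].
Definition pchain A := A `<=` projs /\ forall p q, A p -> A q -> ple p q \/ ple q p.

(** The supremum is the strong limit along the chain itself, which is directed. *)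
Lemma pchain_sup A : pchain A -> A !=set0 -> exists P, [/\ projs P,
  forall p, A p -> ple p P,
  forall q, (forall p, A p -> ple p q) -> ple P q &
  forall x c, (forall p, A p -> nsq (p x) <= c) -> nsq (P x) <= c].
Proof.
move=> [AP Atot] A0.
have Arefl p : A p -> ple p p by move=> /AP[_]; exact: ple_refl.
have FP : ProperFilter (section_filter A ple).
  apply: section_filter_proper => //.
    by move=> p q r; exact: ple_trans.
  move=> p q Ap Aq; have [pq|qp] := Atot p q Ap Aq.
    by exists q => //; split=> //; exact: Arefl.
  by exists p => //; split=> //; exact: Arefl.
set F := section_filter A ple in FP.
have FA : F A by have [p Ap] := A0; exists p => // q [].
have Fge p : A p -> F [set q | A q /\ ple p q] by move=> Ap; exists p.
have lims x : exists y : H, (fun T : bop H => T x) @ F --> y.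
  apply: (increasing_cvg (c := nsq x) (u := fun T : bop H => T x) FP) => //.
    move=> p q Ap Aq pq; rewrite -bopBE nsq_projB//; [exact: (AP _ Ap).2|exact: (AP _ Aq).2].
  by move=> p Ap; apply: nsq_proj_le; exact: (AP _ Ap).2.
have [|P FPx Pc] := strong_limit FP (c := 1) _ lims.
  apply: filterS FA => p Ap x; rewrite mul1r; apply: nsq_proj_le; exact: (AP _ Ap).2.
have FaP p x y : A p -> (fun T : bop H => p (T x)) @ F --> y -> p (P x) = y.
  move=> Ap; apply: cvg_unique => //.
  exact: cvg_bop (FPx x).
have ub p : A p -> ple p P.
  move=> Ap; apply: bop_ext => x; rewrite bopME; apply: FaP => //.
  apply: cvg_near_eq (cvg_cst (p x)).
  by apply: filterS (Fge p Ap) => q [_ pq]; rewrite -bopME pq.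
have sP : sa P by apply: sa_limit FPx; apply: filterS FA => p /AP[_ []].
have PP : P * P = P.
  apply: bop_ext => x; rewrite bopME; apply: (cvg_unique _ (FPx (P x))) => //.
  apply: cvg_near_eq (FPx x).
  by apply: filterS FA => q /ub qP; rewrite -bopME qP.
exists P; split=> //.
- split=> //; apply: (@vnb_lim _ _ M F) => //.
  by apply: filterS FA => p /AP[].
- move=> q qub; apply: bop_ext => x; rewrite bopME.
  apply: (cvg_unique _ (FPx (q x))) => //.
  apply: cvg_near_eq (FPx x).
  by apply: filterS FA => p /qub pq; rewrite -bopME pq.
- move=> x c h; apply: cvg_nsq_le (FPx x) _; rewrite near_simpl.
  by apply: filterS FA => p; exact: h.
Qed.

Lemma pleC p q : proj p -> proj q -> ple p q -> ple (1 - q) (1 - p).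
Proof.
move=> Pp Pq pq; rewrite /ple mulrBr mulr1 mulrBl mul1r (ple_sym Pp Pq pq).
by rewrite subrr subr0.
Qed.

Lemma projsC p : projs p -> projs (1 - p).
Proof. by move=> [Mp Pp]; split; [exact: vnbB (vnb1 M) Mp|exact: projC]. Qed.

Lemma pchain_inf A : pchain A -> A !=set0 -> exists P, [/\ projs P,
  forall p, A p -> ple P p,
  forall q, projs q -> (forall p, A p -> ple q p) -> ple q P &
  forall x c, (forall p, A p -> c <= nsq (p x)) -> c <= nsq (P x)].
Proof.
move=> [AP Atot] [p0 Ap0]; pose B := [set 1 - p | p in A].
have CC q : 1 - (1 - q) = q :> bop H by rewrite opprB addrC subrK.
have [||P [PP Pub Plub Pnsq]] := @pchain_sup B.
- split; first by move=> _ [p Ap <-]; apply: projsC; exact: AP.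
  move=> _ _ [p Ap <-] [q Aq <-].
  have [pq|qp] := Atot p q Ap Aq; [right|left]; apply: pleC => //;
    by [exact: (AP _ Ap).2|exact: (AP _ Aq).2].
- by exists (1 - p0); exists p0.
exists (1 - P); split.
- exact: projsC.
- move=> p Ap; rewrite -[p]CC; apply: pleC; [|exact: PP.2|by apply: Pub; exists p].
  by apply: projC; exact: (AP _ Ap).2.
- move=> q [Mq Pq] h; rewrite -[q]CC; apply: pleC; [exact: PP.2|exact: projC|].
  apply: Plub => _ [p Ap <-]; apply: pleC => //; first exact: (AP _ Ap).2.
  exact: h.
- move=> x c h; rewrite (nsq_projB x PP.2 proj_one (mulr1 _)).
  suff : nsq (P x) <= nsq x - c by rewrite bop1E; lra.
  apply: Pnsq => _ [p Ap <-]; rewrite (nsq_projB x (AP _ Ap).2 proj_one (mulr1 _)).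
  by have := h p Ap; rewrite bop1E; lra.
Qed.

(** A maximal chain of projections without minimal elements has no gaps, so
    p |-> |p y|^2 takes on it all intermediate values. *)
Lemma continuous_chain e : projs e ->
  (forall q, minimal_projection M q -> ~ ple q e) ->
  exists A, [/\ pchain A, forall p, A p -> ple p e &
    forall y c, 0 <= c <= nsq (e y) -> exists2 p, A p & nsq (p y) = c].
Proof.
move=> Pe nomin.
have smaller q : projs q -> ple q e -> q <> 0 ->
    exists p, [/\ projs p, ple p q, p <> 0 & p <> q].
  move=> [Mq Pq] qe q0; apply: contrapT => h; apply: (nomin q) => //; split=> //.
  move=> p Mp Pp pq; have [->|/eqP p0] := eqVneq p 0; first by left.
  have [->|/eqP pq'] := eqVneq p q; first by right.
  by exfalso; apply: h; exists p.
have [|A [[Ac Ae] Amax]] := @Zorn_bigcup _ [set A | pchain A /\ forall p, A p -> ple p e].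
  move=> F FP Ftot; split; last by move=> p [A FA Ap]; exact: (FP _ FA).2.
  split=> [p [A FA Ap]|p q [A FA Ap] [B FB Bq]]; first exact: (FP _ FA).1.1.
  have [AB|BA] := Ftot A B FA FB.
    by apply: (FP _ FB).1.2 => //; exact: AB.
  by apply: (FP _ FA).1.2 => //; exact: BA.
have full r : projs r -> ple r e -> (forall p, A p -> ple p r \/ ple r p) -> A r.
  move=> Pr re rA; apply: contrapT => nAr; apply: (Amax (A `|` [set r])).
    split; first by move=> p Ap; left.
    by move=> h; apply: nAr; apply: h; right.
  split; last by move=> p [/Ae//|->].
  split=> [p [/Ac.1//|->//]|p q [Ap|->] [Aq|->]].
  - exact: Ac.2.
  - exact: rA.
  - by have [] := rA q Aq; [right|left].
  - by left; apply: ple_refl; exact: Pr.2.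
exists A; split=> // y c /andP[c0 ce].
have A0 : A 0.
  apply: full; [split; [exact: vnb0|exact: proj0]|exact: ple0|].
  by move=> p _; right; exact: ple0.
have A_e : A e by apply: full => //; [apply: ple_refl; exact: Pe.2|move=> p Ap; left; exact: Ae].
(* The supremum l of the lower part and the infimum u of the upper part belong
   to the maximal chain. If neither attains c, then u - l is not 0, and a smaller
   projection under it can be added to l, against maximality. *)
pose L := [set p | A p /\ nsq (p y) <= c]; pose U := [set p | A p /\ c <= nsq (p y)].
have sub_chain B : B `<=` A -> pchain B.
  move=> BA; split; first by move=> p /BA; exact: Ac.1.
  by move=> p q /BA Ap /BA Aq; exact: Ac.2.
have L0 : L 0 by split=> //; rewrite bop0E nsq0.
have Ue : U e by split.
have [l [Pl lub llub lnsq]] : exists P, [/\ projs P, forall p, L p -> ple p P,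
  forall q, (forall p, L p -> ple p q) -> ple P q &
  forall x c, (forall p, L p -> nsq (p x) <= c) -> nsq (P x) <= c].
  by apply: pchain_sup; [apply: sub_chain => p []|exists 0].
have [u [Pu ulb uglb unsq]] : exists P, [/\ projs P, forall p, U p -> ple P p,
  forall q, projs q -> (forall p, U p -> ple q p) -> ple q P &
  forall x c, (forall p, U p -> c <= nsq (p x)) -> c <= nsq (P x)].
  by apply: pchain_inf; [apply: sub_chain => p []|exists e].
have LU p q : L p -> A q -> ~ L q -> ple p q.
  move=> [Ap pc] Aq nLq; have [//|qp] := Ac.2 _ _ Ap Aq.
  exfalso; apply: nLq; split=> //; apply: le_trans pc.
  by apply: ple_nsq => //; [exact: (Ac.1 _ Aq).2|exact: (Ac.1 _ Ap).2].
have UL p q : U p -> A q -> ~ U q -> ple q p.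
  move=> [Ap pc] Aq nUq; have [pq|//] := Ac.2 _ _ Ap Aq.
  exfalso; apply: nUq; split=> //; apply: le_trans pc _.
  by apply: ple_nsq => //; [exact: (Ac.1 _ Ap).2|exact: (Ac.1 _ Aq).2].
have Al : A l.
  apply: full => //; first by apply: llub => p [Ap _]; exact: Ae.
  move=> p Ap; have [Lp|nLp] := pselect (L p); first by left; exact: lub.
  by right; apply: llub => q Lq; exact: LU.
have Au : A u.
  apply: full => //; first exact: ulb.
  move=> p Ap; have [Up|nUp] := pselect (U p); first by right; exact: ulb.
  by left; apply: uglb; [exact: Ac.1|move=> q Uq; exact: UL].
have lc : nsq (l y) <= c by apply: lnsq => p [].
have uc : c <= nsq (u y) by apply: unsq => p [].
have [Ul|nUl] := pselect (U l); first by exists l => //; apply: le_anti; rewrite lc Ul.2.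
have [Lu|nLu] := pselect (L u); first by exists u => //; apply: le_anti; rewrite uc Lu.2.
exfalso.
have lu : ple l u by apply: LU => //; split.
have Pul : projs (u - l) by split; [exact: vnbB Pu.1 Pl.1|exact: projB Pl.2 Pu.2 lu].
have ul_u : ple (u - l) u.
  by rewrite /ple mulrBl (proj_id Pu.2) lu.
have ul0 : u - l <> 0.
  by move/subr0_eq => ul; apply: nUl; split=> //; rewrite -ul.
have [p [Pp pul p0 pul']] := smaller _ Pul (ple_trans ul_u (Ae _ Au)) ul0.
have pl : p * l = 0.
  by rewrite -pul -mulrA mulrBl (proj_id Pl.2) (ple_sym Pl.2 Pu.2 lu) subrr mulr0.
have lp : l * p = 0 by have := congr1 adj pl; rewrite adjM adj0 (proj_adj Pp.2) (proj_adj Pl.2).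
pose r := l + p.
have Pr : projs r by split; [exact: vnbD Pl.1 Pp.1|exact: projD Pl.2 Pp.2 lp].
have ru : ple r u by rewrite /ple mulrDl lu (ple_trans pul ul_u).
have lr : ple l r by rewrite /ple mulrDr (proj_id Pl.2) lp addr0.
have Ar : A r.
  apply: full => //; first exact: ple_trans ru (Ae _ Au).
  move=> q Aq; have [qc|cq] := leP (nsq (q y)) c.
    by left; apply: ple_trans lr; apply: lub; split.
  by right; apply: ple_trans ru _; apply: ulb; split=> //; exact: ltW.
have [rc|cr] := leP (nsq (r y)) c.
  have : ple r l by apply: lub; split.
  rewrite /ple /r mulrDl (proj_id Pl.2) pl addr0 => /esym/eqP.
  by rewrite -subr_eq0 addrAC subrr add0r => /eqP.
have ur : ple u r by apply: ulb; split=> //; exact: ltW.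
by apply: pul'; rewrite -(ple_antisym Pr.2 Pu.2 ru ur) /r addrAC subrr add0r.
Qed.

End chains.

(** * Coefficients of conjugates *)

Section unitaries.
Context {R : realType} {H : hilbertType R} (M : vonNeumannAlgebra H).
Local Notation C := R[i].
Implicit Types (S T p q e w : bop H) (x y z xi eta : H).
Local Notation U := (unitary_group M).

Definition cabs2 (z : C) : R := Re z ^+ 2 + Im z ^+ 2.

Lemma unitary_groupP (u : U) : vn_set M (set_val u) /\ unitary (set_val u).
Proof. exact: set_mem (valP u). Qed.

Definition ubop (u : U) : bop H := Bop (let: conj _ (And3 b _ _) := unitary_groupP u in b).

Definition unitary_bop w := adj w * w = 1 /\ w * adj w = 1.

Lemma ubop_vnb u : vnb M (ubop u).
Proof. exact: (unitary_groupP u).1. Qed.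
Lemma ubop_unitary u : unitary_bop (ubop u).
Proof.
have [_ [_ h1 h2]] := unitary_groupP u.
have E : adjoint (set_val u : H -> H) = adj (ubop u) by rewrite -adjoint_bop.
rewrite E in h1 h2; split; apply: bop_ext => x; rewrite bopME bop1E.
  by have := congr1 (@^~ x) h1.
by have := congr1 (@^~ x) h2.
Qed.
Lemma ubopM u v : ubop (u * v)%g = ubop u * ubop v.
Proof. exact: bop_ext. Qed.
Lemma ubopV u : ubop (u^-1)%g = adj (ubop u).
Proof. by apply: bop_ext => x; rewrite -adjoint_bop. Qed.
Lemma ubop1 : ubop 1%g = 1.
Proof. exact: bop_ext. Qed.

Lemma ubop_surj w : vnb M w -> unitary_bop w -> exists u, ubop u = w.
Proof.
move=> Mw [w1 w2].
have h : (bfun w : H -> H) \in unitaries M.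
  rewrite inE; split=> //; split; first exact: bfunP.
    by apply/funext => x; rewrite adjoint_bop /= -[LHS]/((adj w * w) x) w1.
  by apply/funext => x; rewrite adjoint_bop /= -[LHS]/((w * adj w) x) w2.
exists (exist (fun v => v \in unitaries M) (bfun w) h); exact: bop_ext.
Qed.

Lemma star_coefE xi T eta u :
  star_coef xi T eta u = inner ((ubop u * T * adj (ubop u)) xi) eta.
Proof.
change (inner (ubop u (T (adjoint (ubop u) xi))) eta =
  inner (ubop u (T (adj (ubop u) xi))) eta).
by rewrite adjoint_bop.
Qed.

(** A sequence of right translates has a uniform cluster point, near which two of
    its terms are close to each other. *)
Lemma AP_not_separated {G : groupTopologicalType} (f : G -> cplx R) (g : nat -> G) (e : R) :
  AP f -> 0 < e ->
  ~ (forall n m, (n < m)%N -> exists s : G, e <= cabs2 (f (s * g n)%g - f (s * g m)%g)).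
Proof.
move=> [_ _]; rewrite precompactE => cpt e0 sep.
pose u n : {uniform G -> cplx R} := rtranslate f (g n).
have [|phi [_ clphi]] := cpt (u @ \oo) _.
  by exists 0%N => // n _; apply: subset_closure; exists (g n).
pose r := Num.sqrt (e / 8); have e8 : 0 < e / 8 by lra.
have r0 : 0 < r by rewrite sqrtr_gt0.
pose B : set {uniform G -> cplx R} := [set h | forall s, ball (phi s : cplx R) r%:C%C (h s)].
have nB : nbhs phi B.
  apply/uniform_nbhs; exists [set zw | ball (zw.1 : cplx R) r%:C%C zw.2].
  split; last by move=> h hs s; exact: (hs s I).
  rewrite -entourage_ballE; exists r%:C%C => //=; by rewrite ltcR.
have close n s : B (u n) -> cabs2 (f (s * g n)%g - phi s) < e / 8.
  move=> /(_ s)/(cplx_ball _ _ r0); rewrite sqr_sqrtr ?ltW// /cabs2.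
  rewrite /u /rtranslate; case: (f _) (phi s) => a b [c d] /=.
  by rewrite -sqrrN opprB -[in X in _ + X]sqrrN opprB.
have [_ [[n _ <-] Bn]] : (u @` setT) `&` B !=set0.
  by apply: clphi => //; exists 0%N => // n _; exists n.
have [_ [[m nm <-] Bm]] : (u @` [set m | (n < m)%N]) `&` B !=set0.
  by apply: clphi => //; exists n.+1 => // m nm; exists m.
have [s] := sep n m nm; have := close n s Bn; have := close m s Bm.
rewrite /cabs2; case: (f (s * g n)%g) (f (s * g m)%g) (phi s) => a b [c d] [i j] /=.
by have := sqr_ge0 (a + c - 2 * i); have := sqr_ge0 (b + d - 2 * j); lra.
Qed.

(** The translates by w_n of the coefficient of T, evaluated at v. *)
Lemma ap_not_separated T xi eta (w : nat -> bop H) (e : R) :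
  ap M T -> (forall n, vnb M (w n) /\ unitary_bop (w n)) -> 0 < e ->
  ~ (forall n m, (n < m)%N -> exists v, [/\ vnb M v, unitary_bop v &
      e <= cabs2 (inner ((v * (w n * T * adj (w n)) * adj v) xi) eta -
                 inner ((v * (w m * T * adj (w m)) * adj v) xi) eta)]).
Proof.
move=> [_ /(_ xi eta) apT] Uw e0 sep.
have /choice[g gw] n : exists u, ubop u = w n by apply: ubop_surj; case: (Uw n).
apply: (AP_not_separated (g := g) apT e0) => n m /sep[v [Mv Uv h]].
have [s sv] := ubop_surj Mv Uv; exists s; rewrite !star_coefE !ubopM sv !gw !adjM.
by rewrite !mulrA in h *.
Qed.

End unitaries.

(** * Minimal projections under noncentral projections *)

(** The increments of an increasing sequence of projections are orthogonal, so
    that signs make of their sum a symmetry. *)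
Section alternating_sums.
Context {R : realType} {H : hilbertType R}.
Variables (a : nat -> bop H).
Hypotheses (Pa : forall k, proj (a k)) (aS : forall k, ple (a k) (a k.+1)) (a0 : a 0 = 0).

Definition alternating_sum K : bop H := \sum_(k < K) (-1) ^+ k *: (a k.+1 - a k).
Local Notation W := alternating_sum.

Lemma alternating_sumS K : W K.+1 = W K + (-1) ^+ K *: (a K.+1 - a K).
Proof. exact: big_ord_recr. Qed.

Lemma alternating_sum_sa K : adj (W K) = W K.
Proof.
rewrite /W adj_sum; apply: eq_bigr => k _.
by rewrite adjZ rmorphXn rmorphN1 adjB !proj_adj.
Qed.

Lemma alternating_sum_le K : W K * a K = W K.
Proof.
elim: K => [|K IH]; first by rewrite /W big_ord0 mul0r.
rewrite alternating_sumS mulrDl -{1}IH -mulrA aS IH bopZl mulrBl aS.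
by rewrite proj_id.
Qed.

Lemma alternating_sum_sqr K : W K * W K = a K.
Proof.
elim: K => [|K IH]; first by rewrite /W big_ord0 mul0r a0.
have aD : a K * (a K.+1 - a K) = 0 by rewrite mulrBr aS proj_id// subrr.
have WD : W K * (a K.+1 - a K) = 0 by rewrite -alternating_sum_le -mulrA aD mulr0.
have DW : (a K.+1 - a K) * W K = 0.
  have := congr1 adj WD; rewrite adjM adj0 alternating_sum_sa adjB.
  by rewrite (proj_adj (Pa K)) (proj_adj (Pa K.+1)).
rewrite alternating_sumS mulrDl !mulrDr !bopZl !bopZr WD DW IH !scaler0 add0r addr0.
rewrite scalerA -expr2 sqrr_sign scale1r proj_id; first by rewrite addrC subrK.
exact: projB.
Qed.

End alternating_sums.

Section rademacher.
Context {R : realType} {H : hilbertType R} (M : vonNeumannAlgebra H).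
Local Notation C := R[i].
Variables (e : bop H) (A : set (bop H)) (y : H).
Hypotheses (Pe : projs M e) (Ac : pchain M A) (Ae : forall p, A p -> ple p e)
  (ey : e y = y) (y0 : 0 < nsq y)
  (Acont : forall c, 0 <= c <= nsq y -> exists2 p, A p & nsq (p y) = c).

(** The parameter of p is |p y|^2 / |y|^2. Inside the chain, monotonicity in the
    parameter is automatic; 0 and e are put at the ends by hand, as the elements
    chosen for the values 0 and 1 may be different ones. *)
Lemma chain_parametrization : exists Q : R -> bop H, [/\ forall t, projs M (Q t),
  Q 0 = 0, Q 1 = e, forall s t, s <= t -> ple (Q s) (Q t) &
  forall s t, 0 <= s -> s <= t -> t <= 1 -> rin (Q s y) (Q t y) = s * nsq y].
Proof.
have h t : exists p, 0 < t < 1 -> A p /\ nsq (p y) = t * nsq y.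
  have [t01|] := boolP (0 < t < 1); last by exists 0.
  have [|p Ap py] := @Acont (t * nsq y); last by exists p.
  case/andP: t01 => t0 t1; apply/andP; split; first by rewrite mulr_ge0 ?ltW.
  by rewrite ler_piMl ?ltW.
have [P PP] := choice h.
pose Q t := if t <= 0 then 0 else if 1 <= t then e else P t.
have QE t : [\/ t <= 0 /\ Q t = 0, [/\ 0 < t, 1 <= t & Q t = e] |
    [/\ 0 < t < 1, A (Q t) & nsq (Q t y) = t * nsq y]].
  rewrite /Q; have [t0|t0] := leP t 0; first by constructor 1.
  have [t1|t1] := leP 1 t; first by constructor 2.
  by constructor 3; have [|] := PP t; rewrite ?t0.
have PQ t : projs M (Q t).
  have [[_ ->]|[_ _ ->]|[_ At _]] := QE t => //.
  - by split; [exact: vnb0|exact: proj0].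
  - exact: Ac.1.
have Qmono s t : s <= t -> ple (Q s) (Q t).
  move=> st; have [[s0 ->]|[s0 s1 ->]|[s01 As Es]] := QE s; first exact: ple0.
    have [[t0 _]|[_ _ ->]|[t01 _ _]] := QE t; last by lra.
      by lra.
    by apply: ple_refl; exact: Pe.2.
  have [[t0 _]|[_ _ ->]|[t01 At Et]] := QE t; first by lra.
    exact: Ae.
  have [->|nst] := eqVneq s t; first by apply: ple_refl; exact: (PQ t).2.
  have {}st : s < t by rewrite lt_neqAle nst.
  have [//|/(ple_nsq y (PQ t).2 (PQ s).2)] := Ac.2 _ _ As At.
  by rewrite Et Es ler_pM2r// leNgt st.
have Qnsq t : 0 <= t <= 1 -> nsq (Q t y) = t * nsq y.
  move=> /andP[t0 t1]; have [[t0' ->]|[_ t1' ->]|[_ _ ->//]] := QE t.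
    by rewrite bop0E nsq0 (_ : t = 0) ?mul0r//; lra.
  by rewrite ey (_ : t = 1) ?mul1r//; lra.
exists Q; split=> //; first by rewrite /Q lexx.
  by rewrite /Q ler10 lexx.
move=> s t s0 st t1; rewrite -Qnsq; last by apply/andP; split => //; lra.
rewrite -[in LHS](proj_adj (PQ t).2) -rin_adj -bopME (ple_sym (PQ s).2 (PQ t).2 (Qmono _ _ st)).
by rewrite (proj_nsq _ (PQ s).2).
Qed.

(** Analogues of the Rademacher functions: symmetries w_n of e M e for which
    the vectors w_n y are orthogonal. *)
Lemma rademacher : exists w : nat -> bop H, [/\ forall n, vnb M (w n),
  forall n, adj (w n) = w n, forall n, w n * w n = e, forall n, w n * e = w n &
  forall m n, (m < n)%N -> rin (w m y) (w n y) = 0].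
Proof.
have [Q [PQ Q0 Q1 Qmono Qrin]] := chain_parametrization.
pose a n k := Q (k%:R / 2 ^+ n.+1).
have p2 n : 0 < 2 ^+ n :> R by rewrite exprn_gt0.
have Pa n k : proj (a n k) by exact: (PQ _).2.
have a0 n : a n 0%N = 0 by rewrite /a mul0r Q0.
have aS n k : ple (a n k) (a n k.+1).
  by apply: Qmono; rewrite ler_pM2r ?invr_gt0// ler_nat.
have aK n : a n (2 ^ n.+1)%N = e by rewrite /a natrX divff ?Q1// gt_eqF.
pose W n := alternating_sum (a n).
(* On the dyadic intervals of length 2^-n the signs of w_n are + on the left half
   and - on the right half, so the partial sums over whole intervals do not see
   the projections Q at the dyadic points of level n. *)
have orth n i j : (i <= 2 ^ n)%N -> (j <= 2 ^ n)%N ->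
    rin (W n i.*2 y) (Q (j%:R / 2 ^+ n) y) = 0.
  move=> + jn; elim: i => [|i IH] ik; first by rewrite /W /alternating_sum big_ord0 rin0l.
  rewrite doubleS /W !alternating_sumS exprS -[(-1) ^+ _]signr_odd odd_double expr0.
  rewrite mulr1 scaleN1r scale1r !(bopDE, bopNE, bopBE) !(rinDl, rinBl, rinNl).
  have {}IH := IH (ltnW ik); rewrite -/(W n) IH add0r.
  have -> : j%:R / 2 ^+ n = (j.*2)%:R / 2 ^+ n.+1 :> R.
    by rewrite exprS -mul2n natrM invfM mulrACA divff ?mul1r// pnatr_eq0.
  have val k l : (k <= l <= 2 ^ n.+1)%N ->
      rin (a n k y) (Q (l%:R / 2 ^+ n.+1) y) = k%:R / 2 ^+ n.+1 * nsq y.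
    move=> /andP[kl ln]; apply: Qrin.
    - by rewrite divr_ge0// ltW.
    - by rewrite ler_pM2r ?invr_gt0// ler_nat.
    - by rewrite ler_pdivrMr// mul1r -natrX ler_nat.
  have valC k l : (l <= k <= 2 ^ n.+1)%N ->
      rin (a n k y) (Q (l%:R / 2 ^+ n.+1) y) = l%:R / 2 ^+ n.+1 * nsq y.
    move=> /andP[kl ln]; rewrite rinC; apply: Qrin.
    - by rewrite divr_ge0// ltW.
    - by rewrite ler_pM2r ?invr_gt0// ler_nat.
    - by rewrite ler_pdivrMr// mul1r -natrX ler_nat.
  set N := (2 ^ n)%N in ik jn *; have En : (2 ^ n.+1 = N.*2)%N by rewrite expnS mul2n.
  have [ji|ij] := leqP j i.
    have h k : (i.*2 <= k <= i.*2.+2)%N -> (j.*2 <= k <= 2 ^ n.+1)%N.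
      by rewrite En => /andP[]; lia.
    by rewrite !valC ?h ?leqnn ?leqnSn ?leqW//; ring.
  have h k : (i.*2 <= k <= i.*2.+2)%N -> (k <= j.*2 <= 2 ^ n.+1)%N.
    by rewrite En => /andP[]; lia.
  by rewrite !val ?h ?leqnn ?leqnSn ?leqW// -![_.+1%:R]natr1; ring.
pose w n := W n (2 ^ n.+1)%N.
exists w; split=> [n|n|n|n|m n mn].
- apply: vnb_sum => k _; apply: vnbZ; exact: vnbB (PQ _).1 (PQ _).1.
- exact: alternating_sum_sa.
- by rewrite /w /W alternating_sum_sqr.
- by rewrite /w /W -{1}(aK n) alternating_sum_le.
have wn j : (j <= 2 ^ n)%N -> rin (w n y) (Q (j%:R / 2 ^+ n) y) = 0.
  by move=> jn; rewrite /w expnS mul2n; exact: orth.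
have wna k : (k <= 2 ^ m.+1)%N -> rin (a m k y) (w n y) = 0.
  move=> km; rewrite rinC; have := wn (k * 2 ^ (n - m.+1))%N.
  rewrite natrM natrX -[in X in _ -> rin _ (Q (_ / X) _) = _](subnKC mn) exprD.
  rewrite invfM mulrACA divff ?mulr1; last by rewrite gt_eqF.
  apply; by rewrite -[in X in (_ <= 2 ^ X)%N](subnKC mn) expnD leq_mul2r km orbT.
rewrite /w /W /alternating_sum bop_sumE.
elim/big_ind: _ => [|u v u0 v0|k _]; first by rewrite rin0l.
  by rewrite rinDl u0 v0 addr0.
rewrite bopZE; have -> : ((-1) ^+ k : C) = ((-1) ^+ k : R)%:C%C.
  by rewrite rmorphXn rmorphN1.
by rewrite rinZl bopBE rinBl !wna ?subrr ?mulr0// ltnW.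
Qed.

End rademacher.

Section minimal_projections.
Context {R : realType} {H : hilbertType R} (M : vonNeumannAlgebra H).
Implicit Types (S T p q e w : bop H) (x y z xi eta : H).

(** The conjugates of v = e S (1 - e) by the symmetries w_n + (1 - e) are w_n v,
    and they are uniformly separated. *)
Lemma ap_minimal_projection e S : vn_set M `<=` ap M -> projs M e -> vnb M S ->
  e * S <> S * e -> exists2 q, minimal_projection M q & ple q e.
Proof.
move=> Map Pe MS eS.
suff main S' : vnb M S' -> e * S' * (1 - e) <> 0 ->
    exists2 q, minimal_projection M q & ple q e.
  have [h|] := pselect (e * S * (1 - e) = 0); last exact: main.
  apply: (main (adj S)); first exact: vnb_adj.
  move=> h'; apply: eS; move: h (congr1 adj h').
  rewrite !adjM adjB adj1 adjK adj0 (proj_adj Pe.2) mulrBr mulr1 mulrBl mul1r mulrA.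
  by move=> /subr0_eq h1 /subr0_eq h2; rewrite h1 h2.
move=> {}MS v0; set v := _ * _ * _ in v0; apply: contrapT => nomin.
have [x vx] : exists x, v x <> 0.
  apply: contrapT => h; apply: v0; apply: bop_ext => x.
  by apply: contrapT => vx; apply: h; exists x.
pose y := v x; have y0 : 0 < nsq y by exact: nsq_gt0.
have ev : e * v = v by rewrite /v !mulrA (proj_id Pe.2).
have ey : e y = y by rewrite /y -bopME ev.
have [|A [Ac Ae Acont]] := @continuous_chain _ _ M e Pe.
  by move=> q qmin qe; apply: nomin; exists q.
have {}Acont c : 0 <= c <= nsq y -> exists2 p, A p & nsq (p y) = c.
  by rewrite -{1}ey; exact: Acont.
have [w [Mw saw ww we worth]] := rademacher Pe Ac Ae ey y0 Acont.
have ew n : e * w n = w n.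
  by have := congr1 adj (we n); rewrite adjM saw (proj_adj Pe.2).
have [f fE] : exists f : bop H, f = 1 - e by exists (1 - e).
pose g n := w n + f.
have wf n : w n * f = 0 by rewrite fE mulrBr mulr1 we subrr.
have fw n : f * w n = 0 by rewrite fE mulrBl mul1r ew subrr.
have Pf : proj f by rewrite fE; exact: projC Pe.2.
have sg n : adj (g n) = g n by rewrite adjD saw (proj_adj Pf).
have gg n : g n * g n = 1.
  rewrite /g mulrDl !mulrDr ww wf fw addr0 add0r (proj_id Pf).
  by rewrite fE addrC subrK.
have vf : v * f = v by rewrite /v -fE -mulrA (proj_id Pf).
have fv : f * v = 0 by rewrite fE mulrBl mul1r ev subrr.
have vg n : v * g n = v by rewrite /g mulrDr vf -{1}vf -mulrA fw mulr0 add0r.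
have gv n : g n * v = w n * v by rewrite /g mulrDl fv addr0.
have Mf : vnb M f by rewrite fE; exact: (projsC Pe).1.
have Mg n : vnb M (g n) by exact: vnbD.
have Ug n : unitary_bop (g n) by rewrite /unitary_bop sg gg.
have Mv : vnb M v by rewrite /v -fE; exact: vnbM (vnbM Pe.1 MS) Mf.
have e0 : 0 < nsq y ^+ 2 by rewrite exprn_gt0.
apply: (@ap_not_separated _ _ M v x y g (nsq y ^+ 2)) => //; first exact: Map.
move=> n m nm; exists (g n); split=> //; rewrite !sg.
have -> : g n * (g n * v * g n) * g n = v.
  rewrite -(mulrA (g n) v) vg (mulrA (g n)) gg mul1r; exact: vg.
have -> : g n * (g m * v * g m) * g n = g n * (w m * v).
  rewrite -(mulrA (g m) v) vg gv -(mulrA (g n) (_ * v)) -(mulrA (w m) v).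
  by rewrite vg.
have -> : g n * (w m * v) = w n * (w m * v).
  by rewrite /g mulrDl [f * _]mulrA fw mul0r addr0.
rewrite -innerBl /cabs2.
have -> : Re (inner (v x - (w n * (w m * v)) x) y) = nsq y.
  change (rin (y - w n (w m y)) y = nsq y).
  by rewrite rinBl (rin_adj (w n)) saw rinC worth// subr0.
by rewrite lerDl sqr_ge0.
Qed.

End minimal_projections.

(** * Minimal projections and finite-dimensional factors *)

Section atoms.
Context {R : realType} {H : hilbertType R} (M : vonNeumannAlgebra H).
Local Notation C := R[i].
Implicit Types (S T p q b c z : bop H) (x y xi eta : H) (l : seq (bop H)).

(** z is a central projection and M z a finite-dimensional factor. *)
Record factor_summand z : Prop := {
  fs_proj : projs M z ;
  fs_neq0 : z <> 0 ;
  fs_central : forall T, vnb M T -> z * T = T * z ;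
  fs_findim : exists (K : finType) (f : K -> bop H), (forall k, vnb M (f k)) /\
     forall T, vnb M T -> exists a : K -> C, T * z = \sum_k a k *: f k ;
  fs_factor : forall S, vnb M S -> S * z = S ->
    (forall T, vnb M T -> T * z = T -> S * T = T * S) -> exists a : C, S = a *: z
}.

Section minimal.
Variable q : bop H.
Hypothesis qmin : minimal_projection M q.

Let Mq : vnb M q. Proof. by case: qmin. Qed.
Let Pq : proj q. Proof. by case: qmin. Qed.
Let q0 : q <> 0. Proof. by case: qmin. Qed.

(** On Mq, b^* a is a scalar multiple of q for all a and b: it serves as an
    inner product, for which these families are orthonormal. *)
Fixpoint orthonormal_seq l : Prop := if l is b :: l' then
  [/\ vnb M b, b * q = b, adj b * b = q & forall c, c \in l' -> adj c * b = 0] /\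
  orthonormal_seq l' else True.

Lemma orthonormal_seqP l : orthonormal_seq l -> forall b, b \in l ->
  [/\ vnb M b, b * q = b & adj b * b = q].
Proof.
elim: l => [//|b l IH] /= [[Mb bq bb _] ol] c; rewrite inE => /orP[/eqP->//|].
exact: IH.
Qed.

Definition frame_sum l : bop H := \sum_(b <- l) b * adj b.

Lemma q_adj b : b * q = b -> q * adj b = adj b.
Proof. by move=> bq; rewrite -{2}bq adjM (proj_adj Pq). Qed.

Lemma frame_sum_mem l b : orthonormal_seq l -> b \in l -> frame_sum l * b = b.
Proof.
elim: l => [//|c l IH] /= [[Mc cq cc cl] ol]; rewrite inE /frame_sum big_cons mulrDl.
move=> /orP[/eqP->|bl].
  rewrite -mulrA cc cq mulr_suml big_seq big1 ?addr0// => d dl.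
  by rewrite -mulrA cl// mulr0.
have cb : adj c * b = 0 by have := congr1 adj (cl b bl); rewrite adjM adjK adj0.
by rewrite -mulrA cb mulr0 add0r; exact: IH.
Qed.

Lemma frame_sum_adj l : adj (frame_sum l) = frame_sum l.
Proof. by rewrite /frame_sum adj_sum; apply: eq_bigr => b _; rewrite adjM adjK. Qed.

Lemma frame_sum_vnb l : orthonormal_seq l -> vnb M (frame_sum l).
Proof.
move=> ol; rewrite /frame_sum big_seq; apply: vnb_sum => b bl.
have [Mb _ _] := orthonormal_seqP ol bl; exact: vnbM Mb (vnb_adj Mb).
Qed.

(** The Gram-Schmidt step. The remainder b' satisfies b'^* b' = a q with a scalar
    a > 0, because q is minimal; dividing by the square root of a normalizes it. *)
Lemma orthonormal_seq_extend l T : orthonormal_seq l -> vnb M T ->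
  frame_sum l * (T * q) <> T * q -> exists b, orthonormal_seq (b :: l).
Proof.
move=> ol MT nT; pose b' := T * q - frame_sum l * (T * q).
have b'0 : b' <> 0 by move/subr0_eq => h; apply: nT; rewrite -h.
have Mb' : vnb M b' by apply: vnbB; [|apply: vnbM; [exact: frame_sum_vnb|]]; exact: vnbM.
have b'q : b' * q = b' by rewrite /b' mulrBl -!mulrA (proj_id Pq).
have lb' c : c \in l -> adj c * b' = 0.
  move=> cl; have E : adj c * frame_sum l = adj c.
    by have := congr1 adj (frame_sum_mem ol cl); rewrite adjM frame_sum_adj.
  by rewrite /b' mulrBr [adj c * (frame_sum l * _)]mulrA E subrr.
have [a aE] := minimal_projection_corner qmin (vnbM (vnb_adj Mb') Mb').
have {}aE : adj b' * b' = a *: q by rewrite -aE mulrA q_adj// -mulrA b'q.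
have [x qx] : exists x, q x <> 0.
  apply: contrapT => h; apply: q0; apply: bop_ext => x.
  by apply: contrapT => qx; apply: h; exists x.
have n0 := nsq_gt0 qx.
have qqx : q (q x) = q x by rewrite -bopME (proj_id Pq).
have aR : a = (Re a)%:C%C.
  have := congr1 (fun T : bop H => inner (T (q x)) (q x)) aE.
  rewrite bopME inner_adjl innerxx bopZE qqx innerZl innerxx.
  case: (a) => u v /= [_] /esym/eqP; rewrite mulr0 add0r mulf_eq0 [nsq _ == 0]gt_eqF// orbF.
  by move/eqP => ->.
have a0 : 0 < Re a.
  have E : nsq (b' (q x)) = Re a * nsq (q x).
    by rewrite nsq_bop aE {1}aR bopZE rinZl qqx.
  have : 0 <= Re a by rewrite -(pmulr_lge0 _ n0) -E nsq_ge0.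
  rewrite le_eqVlt => /orP[/eqP a0|//]; exfalso; apply: b'0; apply: bop_eq0.
  by rewrite aE aR -a0 rmorph0 scale0r.
pose r := (Num.sqrt (Re a))^-1.
have r2 : r * (r * Re a) = 1.
  by rewrite mulrA -expr2 exprVn sqr_sqrtr ?ltW// mulVf// gt_eqF.
exists (r%:C%C *: b'); split=> //; split.
- exact: vnbZ.
- by rewrite bopZl b'q.
- by rewrite adjZr bopZl bopZr aE aR !scalerA -!rmorphM/= -mulrA r2 rmorph1 scale1r.
- by move=> c cl; rewrite bopZr lb'// scaler0.
Qed.

(** An infinite orthonormal sequence would give a uniformly separated sequence in
    the conjugacy class of b = a_0: the symmetry 1 - d d^* with d = a_n - b exchanges
    b and a_n and fixes the other ones. *)
Lemma ap_no_orthonormal_sequence (a : nat -> bop H) : vn_set M `<=` ap M ->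
  (forall n, [/\ vnb M (a n), a n * q = a n, adj (a n) * a n = q & q * a n = 0]) ->
  (forall m n, m <> n -> adj (a m) * a n = 0) -> False.
Proof.
move=> Map aP aorth.
have [x qx] : exists x, q x <> 0.
  apply: contrapT => h; apply: q0; apply: bop_ext => x.
  by apply: contrapT => qx; apply: h; exists x.
have n0 := nsq_gt0 qx.
have [b bE] : exists b, b = a 0%N by exists (a 0%N).
have [Mb bq bb qb] : [/\ vnb M b, b * q = b, adj b * b = q & q * b = 0] by rewrite bE.
have [A AE] : exists A : nat -> bop H, A = fun n => a n.+1 by exists (fun n => a n.+1).
have [MA Aq AA qA] : [/\ forall n, vnb M (A n), forall n, A n * q = A n,
    forall n, adj (A n) * A n = q & forall n, q * A n = 0].
  by rewrite AE; split=> n; case: (aP n.+1).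
have Ab n : adj (A n) * b = 0 by rewrite AE bE aorth.
have bA n : adj b * A n = 0 by rewrite AE bE aorth.
have AAn n m : n <> m -> adj (A n) * A m = 0.
  by rewrite AE => nm; apply: aorth => -[].
have [d dE] : exists d : nat -> bop H, forall n, d n = A n - b by exists (fun n => A n - b).
have dq n : d n * q = d n by rewrite dE mulrBl Aq bq.
have qd n : q * d n = 0 by rewrite dE mulrBr qA qb subrr.
have dd n : adj (d n) * d n = q + q.
  by rewrite dE adjB mulrBl !mulrBr AA bb Ab bA subr0 sub0r opprK.
have db n : adj (d n) * b = - q by rewrite dE adjB mulrBl Ab bb sub0r.
have dA n : adj (d n) * A n = q by rewrite dE adjB mulrBl AA bA subr0.
have dAm n m : n <> m -> adj (d n) * A m = 0.
  by move=> nm; rewrite dE adjB mulrBl AAn// bA subr0.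
have [g gE] : exists g : nat -> bop H, forall n, g n = 1 - d n * adj (d n).
  by exists (fun n => 1 - d n * adj (d n)).
have sg n : adj (g n) = g n by rewrite gE adjB adj1 adjM adjK.
have gg n : g n * g n = 1.
  rewrite gE mulrBl mul1r mulrBr mulr1 -[d n * adj _ * _]mulrA [adj _ * (_ * _)]mulrA dd.
  have -> : (q + q) * adj (d n) = adj (d n) + adj (d n) by rewrite mulrDl q_adj.
  by rewrite mulrDr opprB addrK subrK.
have gb n : g n * b = A n by rewrite gE mulrBl mul1r -mulrA db mulrN dq opprK dE addrC subrK.
have gA n : g n * A n = b by rewrite gE mulrBl mul1r -mulrA dA dq dE opprB addrC subrK.
have gAm n m : n <> m -> g n * A m = A m.
  by move=> nm; rewrite gE mulrBl mul1r -mulrA dAm// mulr0 subr0.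
have kill c n : c * q = c -> c * g n = c.
  by move=> cq; rewrite gE mulrBr mulr1 mulrA -{2}cq -(mulrA c q) qd mulr0 mul0r subr0.
have Md n : vnb M (d n) by rewrite dE; exact: vnbB.
have Mg n : vnb M (g n) by rewrite gE; apply: vnbB (vnb1 M) _; exact: vnbM (Md n) (vnb_adj (Md n)).
have Ug n : unitary_bop (g n) by rewrite /unitary_bop sg gg.
have e0 : 0 < nsq (q x) ^+ 2 by rewrite exprn_gt0.
apply: (@ap_not_separated _ _ M b (q x) (b (q x)) g (nsq (q x) ^+ 2)) => //; first exact: Map.
move=> n m nm; exists (g n); split=> //; rewrite !sg.
rewrite gb (kill (A n))// gA (kill b)// gb (kill (A m))// gAm; last by move=> E; rewrite E ltnn in nm.
rewrite (kill (A m))// -innerBl /cabs2 -/(rin _ _) rinBl.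
have -> : rin (b (q x)) (b (q x)) = nsq (q x).
  by rewrite -/(nsq _) nsq_bop bb -bopME (proj_id Pq).
have -> : rin (A m (q x)) (b (q x)) = 0.
  by rewrite rinC -rin_adjl -bopME Ab bop0E rin0l.
by rewrite subr0 lerDl sqr_ge0.
Qed.

(** Starting with q ensures that all further members b satisfy q b = 0. *)
Lemma ap_finite_frame : vn_set M `<=` ap M -> exists l, [/\ orthonormal_seq l, q \in l &
  forall T, vnb M T -> frame_sum l * (T * q) = T * q].
Proof.
move=> Map; apply: contrapT => nofr.
have ext l : exists b, orthonormal_seq l /\ q \in l -> orthonormal_seq (b :: l).
  have [[ol ql]|] := pselect (orthonormal_seq l /\ q \in l); last by exists 0.
  have [T MT nT] : exists2 T, vnb M T & frame_sum l * (T * q) <> T * q.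
    apply: contrapT => h; apply: nofr; exists l; split=> // T MT.
    by apply: contrapT => h'; apply: h; exists T.
  by have [b bl] := orthonormal_seq_extend ol MT nT; exists b.
have [E EP] := choice ext.
pose L n := iter n (fun l => E l :: l) [:: q].
have LP n : orthonormal_seq (L n) /\ q \in L n.
  elim: n => [|n [ol ql]]; last by split; [exact: EP|rewrite inE ql orbT].
  split; last by rewrite inE.
    by split=> //; split=> //; rewrite ?(proj_adj Pq) (proj_id Pq).
pose a n := E (L n).
have oa n : orthonormal_seq (a n :: L n) := EP _ (LP n).
have mem m n : (m < n)%N -> a m \in L n.
  elim: n => [//|n IH]; rewrite ltnS leq_eqVlt => /orP[/eqP->|/IH mn]; rewrite inE ?eqxx//.
  by rewrite mn orbT.
have orth m n : (m < n)%N -> adj (a m) * a n = 0.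
  by move=> mn; have [[_ _ _ h] _] := oa n; apply: h; exact: mem.
apply: (@ap_no_orthonormal_sequence a Map) => [n|m n mn].
  have [[Ma aq aa aL] _] := oa n; split=> //.
  by rewrite -{1}(proj_adj Pq); apply: aL; exact: (LP n).2.
have [mltn|nltm|//] := ltngtP m n; first exact: orth.
by rewrite -[LHS]adjK adjM adjK orth// adj0.
Qed.

(** Let z be the sum of the b b^* over an orthonormal basis of M q. As z acts as
    the identity on M q, z T z = T z for T in M; passing to adjoints, z is
    central. The coefficients of T z in the matrix units b_i b_j^* are the scalars
    in b_i^* T b_j = a q, and a central element is determined by its action on q. *)
Lemma minimal_projection_summand : vn_set M `<=` ap M ->
  exists2 z, factor_summand z & q * z = q.
Proof.
move=> Map; have [l [ol ql lfull]] := ap_finite_frame Map.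
have lP := orthonormal_seqP ol.
pose z := frame_sum l.
have Mz : vnb M z := frame_sum_vnb ol.
have sz : adj z = z := frame_sum_adj l.
have zTb T b : vnb M T -> b \in l -> z * (T * b) = T * b.
  move=> MT /lP[Mb bq _]; rewrite -{1 2}bq !mulrA -(mulrA _ T) -(mulrA T b) -mulrA.
  rewrite (mulrA T b q) lfull//; exact: vnbM.
have zTz T : vnb M T -> z * T * z = T * z.
  move=> MT; rewrite /z {2 3}/frame_sum !mulr_sumr big_seq [RHS]big_seq.
  apply: eq_bigr => b bl; rewrite mulrA [T * (b * _)]mulrA -(mulrA z) [z * (_ * _)]zTb//.
have zc T : vnb M T -> z * T = T * z.
  move=> MT; rewrite -zTz//; have := zTz _ (vnb_adj MT).
  by move/(congr1 adj); rewrite !adjM adjK sz mulrA.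
have zz : z * z = z by have := zTz _ (vnb1 M); rewrite mulr1 mul1r.
have zq : z * q = q by exact: frame_sum_mem.
have cz c : c \in l -> c * z = c.
  by move=> cl; have [Mc _ _] := lP c cl; rewrite -zc//; exact: frame_sum_mem.
exists z; last exact: cz.
have Tz T : T * z = \sum_(c <- l) T * c * adj c.
  by rewrite /z /frame_sum mulr_sumr; apply: eq_bigr => c _; rewrite mulrA.
split=> //.
- by move=> z0; apply: q0; rewrite -zq z0 mul0r.
- pose n := size l; pose b (i : 'I_n) := l`_i.
  have bl i : b i \in l by exact: mem_nth.
  exists ('I_n * 'I_n)%type; exists (fun k => b k.1 * adj (b k.2)); split=> [k|T MT].
    have [M1 _ _] := lP _ (bl k.1); have [M2 _ _] := lP _ (bl k.2).
    exact: vnbM M1 (vnb_adj M2).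
  have /choice[a aE] (k : 'I_n * 'I_n) : exists a : C, adj (b k.1) * (T * b k.2) = a *: q.
    have [M1 b1 _] := lP _ (bl k.1); have [M2 b2 _] := lP _ (bl k.2).
    have [a aE] := minimal_projection_corner qmin (vnbM (vnb_adj M1) (vnbM MT M2)).
    by exists a; rewrite -aE !mulrA q_adj// -!mulrA b2.
  exists a; transitivity (\sum_i \sum_j a (i, j) *: (b i * adj (b j))); last first.
    by rewrite pair_bigA; apply: eq_bigr => -[].
  rewrite exchange_big /= Tz (big_nth 0) big_mkord; apply: eq_bigr => j _.
  rewrite -/(b j) -[T * b j]zTb// /z /frame_sum mulr_suml (big_nth 0) big_mkord mulr_suml.
  apply: eq_bigr => i _; rewrite -/(b i) -mulrA -(mulrA (b i)) [adj (b i) * (_ * _)]mulrA.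
  have [M1 b1 _] := lP _ (bl i).
  have -> : adj (b i) * (T * b j) = a (i, j) *: q := aE (i, j).
  by rewrite bopZl bopZr mulrA b1.
- move=> S MS Sz Sc.
  have Sl c : c \in l -> S * c = c * S.
    by move=> cl; have [Mc _ _] := lP c cl; apply: Sc => //; exact: cz.
  have [a aE] := minimal_projection_corner qmin MS; exists a.
  have Sq : S * q = a *: q by rewrite -aE -Sl// -mulrA (proj_id Pq).
  rewrite -Sz Tz /z /frame_sum scaler_sumr big_seq [RHS]big_seq; apply: eq_bigr => c cl.
  have [Mc cq _] := lP c cl.
  by rewrite -{1}cq mulrA Sl// -(mulrA c) Sq bopZr cq bopZl.
Qed.

End minimal.
End atoms.

(** * Central summands *)

Section corners.
Context {R : realType} {H : hilbertType R} (M : vonNeumannAlgebra H).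
Local Notation C := R[i].
Implicit Types (S T p q b c z : bop H) (x y xi eta : H).

Definition central z := projs M z /\ forall T, vnb M T -> z * T = T * z.

Definition corner z : set (H -> H) := [set T | exists2 S, vnb M S & T = bfun (S * z)].

Lemma bfun_inj S T : bfun S = bfun T -> S = T.
Proof. by move=> ST; apply: bop_ext => x; rewrite ST. Qed.

Lemma corner_mem z T : projs M z -> corner z (bfun T) <-> vnb M T /\ T * z = T.
Proof.
move=> [Mz Pz]; split=> [[S MS /bfun_inj ->]|[MT Tz]].
  by split; [exact: vnbM|rewrite -mulrA (proj_id Pz)].
by exists T; rewrite // Tz.
Qed.

Lemma corner_lift z (T : H -> H) : projs M z -> corner z T ->
  exists T', [/\ T = bfun T', vnb M T' & T' * z = T'].
Proof.
move=> Pz NT; case: (NT) => S MS E; exists (S * z); rewrite E in NT *.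
by have [] := (corner_mem (S * z) Pz).1 NT.
Qed.

(** For the weak closure: T |-> T z is weakly continuous, so that T z = T
    persists in the limit. *)
Lemma corner_von_neumann z : central z -> von_neumann_on (bfun z) (corner z).
Proof.
move=> [Pz zc]; have [Mz pz] := Pz; split.
- by move=> _ [S _ ->]; exact: bfunP.
- by exists 1; [exact: vnb1|rewrite mul1r].
- move=> _ [S MS ->]; apply/funext => x /=; rewrite -[LHS]/((z * (S * z)) x).
  by rewrite mulrA zc// -mulrA (proj_id pz).
- by move=> _ [S MS ->]; apply/funext => x /=; rewrite -[z (z x)]/((z * z) x) (proj_id pz).
- move=> a _ _ [S MS ->] [T MT ->]; exists (a *: S + T); first exact: vnbP.
  by apply/funext.
- move=> _ _ [S MS ->] [T MT ->]; exists (S * z * T); last by apply/funext.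
  by apply: vnbM => //; exact: vnbM.
- move=> _ [S MS ->]; exists (adj S); first exact: vnb_adj.
  by rewrite adjoint_bop adjM (proj_adj pz) zc//; exact: vnb_adj.
- move=> T [clT bT].
  have MT : vn_set M T.
    apply: (vn_wot_closed (vn_setP M)); split=> //; apply: closureS clT.
    by move=> _ [S MS ->]; exact: vnbM.
  apply/(corner_mem (Bop bT) Pz); split=> //; apply: bop_ext => x; apply: inner_ext => y.
  apply/eqP; rewrite -subr_eq0 -normr_le0; apply/ler_addgt0Pr => e e0; rewrite add0r.
  have e4 : 0 < (e / 2) ^+ 2 by rewrite exprn_gt0// divr_gt0.
  have nearT w : nbhs (T : wot H) [set S : wot H | `|rin (S w) y - rin (T w) y| < e / 2].
    have /cvg_cplxP/(_ _ e4) := @wot_inner_continuous _ _ w y T.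
    apply: filterS => S /= hS; rewrite /rin -ltr_sqr ?nnegrE ?normr_ge0 ?(divr_ge0 (ltW e0))//.
    rewrite real_normK ?num_real//; move: hS.
    case: (inner (S w) y) (inner (T w) y) => a b [c d] /=.
    by have := sqr_ge0 (b - d); lra.
  have [_ [[S MS ->] [h1 h2]]] := clT _ (filterI (nearT (z x)) (nearT x)).
  rewrite bopME /=; have E : (S * z) (z x) = (S * z) x by rewrite !bopME -[z (z x)]/((z * z) x) (proj_id pz).
  have {}h1 : `|rin ((S * z) (z x)) y - rin (T (z x)) y| < e / 2 := h1.
  have {}h2 : `|rin ((S * z) x) y - rin (T x) y| < e / 2 := h2.
  rewrite E distrC in h1.
  by rewrite -(subrKA (rin ((S * z) x) y)); apply: le_trans (ler_normD _ _) _; lra.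
Qed.

Lemma bfun_sum I (r : seq I) (P : pred I) (F : I -> bop H) :
  bfun (\sum_(i <- r | P i) F i) = \sum_(i <- r | P i) bfun (F i).
Proof. by apply/funext => x; rewrite bop_sumE fct_sumE. Qed.

Lemma factor_summand_corner z : factor_summand M z ->
  is_factor (bfun z) (corner z) /\ is_finite_dimensional (corner z).
Proof.
case=> Pz z0 zc [K [f [Mf fspan]]] zfac; split.
  split; first by move=> h; apply: z0; apply: bop_ext => x; rewrite h.
  rewrite eqEsubset; split=> [S [NS Sc]|_ [a _ <-]].
    have [S' [SE MS Sz]] := corner_lift Pz NS.
    have [|a aE] := zfac S' MS Sz.
      move=> T MT Tz; apply: bfun_inj; rewrite SE in Sc.
      by apply: (Sc (bfun T)); apply/(corner_mem _ Pz).
    by exists a => //; rewrite SE aE.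
  split.
    by exists (a *: (1 : bop H)); [apply: vnbZ; exact: vnb1|rewrite bopZl mul1r].
  move=> T NT; have [T' [-> MT Tz]] := corner_lift Pz NT.
  have E : (a *: z) * T' = T' * (a *: z) by rewrite bopZl bopZr zc.
  by have := congr1 (@bfun _ _) E.
exists #|K|, (fun i => bfun (f (enum_val i) * z)); split.
  by move=> i; exists (f (enum_val i)).
move=> T NT; have [T' [-> MT Tz]] := corner_lift Pz NT.
have [a aE] := fspan _ MT; exists (fun i => a (enum_val i)).
transitivity (bfun (\sum_k a k *: (f k * z))).
  congr bfun; rewrite -{1}Tz -{1}Tz aE mulr_suml; apply: eq_bigr => k _.
  by rewrite bopZl.
rewrite bfun_sum (reindex (@enum_val K predT))/=; last exact: onW_bij (enum_val_bij _).
by apply: eq_bigr => i _.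
Qed.

Lemma normE_le (c : R) x y : 0 <= c -> nsq x <= c ^+ 2 * nsq y -> `|x| <= c%:C%C * `|y|.
Proof.
move=> c0 xy; rewrite !normE -rmorphM/= lecR [X in X * _](_ : c = Num.sqrt (c ^+ 2)).
  by rewrite -sqrtrM ?sqr_ge0// ler_wsqrtr.
by rewrite sqrtr_sqr ger0_norm.
Qed.

Lemma normE_ge (c : C) x y : `|x| <= c * `|y| -> nsq x <= Re c ^+ 2 * nsq y.
Proof.
rewrite !normE lecE; case: c => a b /= /andP[_]; rewrite mulr0 subr0 => h.
rewrite -(sqr_sqrtr (nsq_ge0 x)) -(sqr_sqrtr (nsq_ge0 y)) -exprMn.
by rewrite ler_sqr ?nnegrE ?sqrtr_ge0//; apply: le_trans h; exact: sqrtr_ge0.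
Qed.

Section direct_sum_of_corners.
Variable pp : nat -> bop H.
Hypotheses (ppc : forall i, central (pp i)) (ppo : forall i j, i <> j -> pp i * pp j = 0)
  (ppsum : forall x, \sum_(i < n) pp i x @[n --> \oo] --> x).

(** A bounded family t_i in the corners has partial sums bounded by the same
    constant, since they act on orthogonal vectors; so their strong limit is a
    bounded operator and lies in M. *)
Lemma direct_sum_of_corners : direct_sum M (fun i => bfun (pp i)) (fun i => corner (pp i)).
Proof.
have Ppp i : projs M (pp i) := (ppc i).1.
split; [by move=> i; exact: corner_von_neumann| | |].
- move=> i j ij; apply/funext => x /=; rewrite -[LHS]/((pp i * pp j) x).
  by rewrite ppo// bop0E.
- exact: ppsum.
rewrite eqEsubset; split=> [T MT|T [t [Nt [Cb tC] tT]]].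
  have [T' MT' TE] := vnb_lift MT; exists (fun i => bfun (T' * pp i)); split.
  - by move=> i; exists T'.
  - have [c c0 Tc] := bop_bounded T'; exists (Num.sqrt c)%:C%C => i x.
    apply: normE_le; first exact: sqrtr_ge0.
    rewrite (sqr_sqrtr (ltW c0)) bopME; apply: le_trans (Tc _) _.
    by rewrite ler_pM2l// nsq_proj_le//; exact: (Ppp i).2.
  - move=> x; rewrite -TE.
    have -> : (fun n => \sum_(i < n) (T' * pp i) x) = T' \o (fun n => \sum_(i < n) pp i x).
      by apply/funext => n /=; rewrite linear_sum.
    exact: cvg_bop (@ppsum x).
have /choice[b bP] i := corner_lift (Ppp i) (Nt i).
have tE i : t i = bfun (b i) by case: (bP i).
have Mb i : vnb M (b i) by case: (bP i).
have bpp i : b i * pp i = b i by case: (bP i).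
have ppb i : pp i * b i = b i by rewrite (ppc i).2.
pose B n := \sum_(i < n) b i; pose P n := \sum_(i < n) pp i.
have BS n : B n.+1 = B n + b n by exact: big_ord_recr.
have PS n : P n.+1 = P n + pp n by exact: big_ord_recr.
have ppB n m : (n <= m)%N -> pp m * B n = 0.
  move=> nm; rewrite /B mulr_sumr big1// => i _; rewrite -ppb mulrA ppo ?mul0r//.
  by move=> E; have := leq_trans (ltn_ord i) nm; rewrite E ltnn.
have ppP n m : (n <= m)%N -> pp m * P n = 0.
  move=> nm; rewrite /P mulr_sumr big1// => i _; rewrite ppo//.
  by move=> E; have := leq_trans (ltn_ord i) nm; rewrite E ltnn.
have PP n : proj (P n).
  elim: n => [|n IH]; first by rewrite /P big_ord0; exact: proj0.
  rewrite PS addrC; apply: projD => //; [exact: (Ppp n).2|exact: ppP].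
pose c := Re Cb ^+ 2; have c0 : 0 <= c by exact: sqr_ge0.
have bc i x : nsq (b i x) <= c * nsq x.
  by apply: normE_ge; rewrite -tE; exact: tC.
have Bc n x : nsq (B n x) <= c * nsq (P n x).
  elim: n => [|n IH]; first by rewrite /B /P !big_ord0 !bop0E nsq0 mulr0.
  rewrite BS PS !bopDE !nsqD.
  have -> : rin (B n x) (b n x) = 0.
    by rewrite -{1}ppb bopME -rin_adjl (proj_adj (Ppp n).2) -bopME ppB// bop0E rin0l.
  have -> : rin (P n x) (pp n x) = 0.
    rewrite -{1}(proj_id (Ppp n).2) bopME -rin_adjl (proj_adj (Ppp n).2) -bopME ppP//.
    by rewrite bop0E rin0l.
  have : nsq (b n x) <= c * nsq (pp n x) by rewrite -{1}bpp bopME; exact: bc.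
  by lra.
have lims x : exists y : H, (fun T : bop H => T x) @ (B @ \oo) --> y.
  exists (T x); have -> : (fun T : bop H => T x) @ (B @ \oo) = (fun n => \sum_(i < n) t i x) @ \oo.
    by congr (_ @ \oo); apply/funext => n; rewrite /= bop_sumE; apply: eq_bigr => i _; rewrite tE.
  exact: tT.
have [|L BL _] := strong_limit (fmap_proper_filter B eventually_filter) (c := c) _ lims.
  exists 0%N => // n _ x; apply: le_trans (Bc n x) _.
  by rewrite ler_wpM2l// nsq_proj_le.
have -> : T = bfun L.
  apply/funext => x; apply: (cvg_unique _ (tT x)) => //.
  have -> : (fun n => \sum_(i < n) t i x) = (fun n => B n x).
    by apply/funext => n; rewrite bop_sumE; apply: eq_bigr => i _; rewrite tE.
  exact: BL.
apply: (@vnb_lim _ _ M (B @ \oo)) => //.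
by exists 0%N => // n _; apply: vnb_sum.
Qed.

End direct_sum_of_corners.

(** The product is an idempotent in the centre of each of the two factors: it is
    0 or equal to both. *)
Lemma factor_summands_orthogonal z1 z2 : factor_summand M z1 -> factor_summand M z2 ->
  z1 <> z2 -> z1 * z2 = 0.
Proof.
have half a b : factor_summand M a -> factor_summand M b -> a * b = 0 \/ a * b = b.
  move=> Fa Fb; have Pa := fs_proj Fa; have Pb := fs_proj Fb.
  have ac := fs_central Fa; have bc := fs_central Fb.
  have Mab : vnb M (a * b) := vnbM Pa.1 Pb.1.
  have abb : a * b * b = a * b by rewrite -mulrA (proj_id Pb.2).
  have [|s sE] := fs_factor Fb Mab abb.
    by move=> T MT Tb; rewrite -mulrA bc// mulrA ac// mulrA.
  have : s ^+ 2 *: b = s *: b.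
    have : a * b * (a * b) = a * b.
      by rewrite -mulrA (mulrA b) -(ac b Pb.1) abb mulrA (proj_id Pa.2).
    by rewrite sE bopZl bopZr (proj_id Pb.2) scalerA -expr2.
  move/eqP; rewrite -subr_eq0 -scalerBl scaler_eq0 => /orP[|/eqP b0]; last first.
    by case: (fs_neq0 Fb).
  rewrite expr2 -{3}[s]mul1r -mulrBl mulf_eq0 subr_eq0 => /orP[/eqP s1|/eqP s0].
    by right; rewrite sE s1 scale1r.
  by left; rewrite sE s0 scale0r.
move=> F1 F2 ne; have [//|E1] := half z1 z2 F1 F2.
have [E2|E2] := half z2 z1 F2 F1.
  by rewrite (fs_central F1)//; exact: (fs_proj F2).1.
by case: ne; rewrite -E2 -(fs_central F1)//; exact: (fs_proj F2).1.
Qed.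

(** Orthogonal unit vectors are at distance sqrt 2: a separable space leaves
    room for countably many orthogonal projections only. *)
Lemma factor_summands_countable : separable_space H -> exists zs : nat -> bop H,
  [/\ forall k, zs k = 0 \/ factor_summand M (zs k),
      forall k l, k <> l -> zs k * zs l = 0 &
      forall z, factor_summand M z -> exists k, zs k = z].
Proof.
move=> [D /countable_injP[f finj] Ddense].
have h z : exists d, factor_summand M z -> D d /\ exists x, [/\ z x = x, nsq x = 1 & nsq (d - x) < 8^-1].
  have [Fz|nF] := pselect (factor_summand M z); last by exists 0.
  have [x1 zx1] : exists x, z x <> 0.
    apply: contrapT => hz; apply: (fs_neq0 Fz); apply: bop_ext => x.
    by apply: contrapT => zx; apply: hz; exists x.
  have n0 := nsq_gt0 zx1; pose x := ((Num.sqrt (nsq (z x1)))^-1)%:C%C *: z x1.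
  have x01 : nsq x = 1 by rewrite nsqZr exprVn sqr_sqrtr ?ltW// mulVf ?gt_eqF.
  have zx : z x = x by rewrite /x bop_raddZ -bopME (proj_id (fs_proj Fz).2).
  pose r : R := 4^-1; have r0 : 0 < r by rewrite /r; lra.
  have [|d [/= dx Dd]] := Ddense (interior (ball x r%:C%C)) _ (@open_interior _ _).
    by exists x; apply: nbhsx_ballx; rewrite ltcR.
  exists d => _; split=> //; exists x; split=> //.
  have /(ball_nsq _ _ r0) := interior_subset dx.
  by rewrite -nsqN opprB /r; lra.
have [d dP] := choice h.
have dinj z1 z2 : factor_summand M z1 -> factor_summand M z2 -> f (d z1) = f (d z2) -> z1 = z2.
  move=> F1 F2 fE; have [D1 [x1 [zx1 n1 d1]]] := dP _ F1; have [D2 [x2 [zx2 n2 d2]]] := dP _ F2.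
  have dE : d z1 = d z2 by apply: finj => //; rewrite inE.
  apply: contrapT => /(factor_summands_orthogonal F1 F2) z12.
  have : nsq (x1 - x2) < 1.
    have -> : x1 - x2 = (d z1 - x2) + - (d z1 - x1) by rewrite opprB [RHS]addrC addrA subrK.
    by apply: le_lt_trans (nsqD_le _ _) _; rewrite nsqN {1}dE; lra.
  rewrite nsqB n1 n2; have -> : rin x1 x2 = 0.
    by rewrite -zx1 -zx2 rin_adj (proj_adj (fs_proj F1).2) -bopME z12 bop0E rin0r.
  by lra.
have g k : exists z, (exists2 z', factor_summand M z' & f (d z') = k) /\ factor_summand M z /\ f (d z) = k
    \/ ~ (exists2 z', factor_summand M z' & f (d z') = k) /\ z = 0.
  have [[z Fz zk]|nz] := pselect (exists2 z', factor_summand M z' & f (d z') = k).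
    by exists z; left; split; [exists z|].
  by exists 0; right.
have [zs zsP] := choice g; exists zs; split.
- by move=> k; have [[_ [Fz _]]|[_ ->]] := zsP k; [right|left].
- move=> k l kl; have [[_ [Fk kE]]|[_ ->]] := zsP k; last by rewrite mul0r.
  have [[_ [Fl lE]]|[_ ->]] := zsP l; last by rewrite mulr0.
  by apply: factor_summands_orthogonal => // E; apply: kl; rewrite -kE -lE E.
- move=> z Fz; exists (f (d z)); have [[_ [Fk kE]]|[nz _]] := zsP (f (d z)).
    exact: dinj.
  by case: nz; exists z.
Qed.

End corners.

(** * The decomposition when M is contained in ap(M) *)

Section necessity.
Context {R : realType} {H : hilbertType R} (M : vonNeumannAlgebra H).
Hypothesis separableH : separable_space H.
Hypothesis Map : vn_set M `<=` ap M.
Implicit Types (S T p q b c z : bop H) (x y xi eta : H).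

Lemma central0 : central M 0.
Proof.
split; first by split; [exact: vnb0|exact: proj0].
by move=> T _; rewrite mul0r mulr0.
Qed.

Lemma corner0 : corner M 0 = [set (0 : H -> H)].
Proof.
rewrite eqEsubset; split=> [_ [S _ ->]|_ ->]; first by rewrite mulr0; apply/funext.
by exists 0; [exact: vnb0|rewrite mulr0; apply/funext].
Qed.

Section sum_of_central.
Variable zs : nat -> bop H.
Hypotheses (zc : forall k, central M (zs k)) (zo : forall k l, k <> l -> zs k * zs l = 0).

(** The partial sums form a chain of projections, and a monotone sequence
    converges strongly to its supremum. *)
Lemma sum_of_central : exists P, [/\ central M P, forall k, ple (zs k) P &
  forall x, \sum_(k < n) zs k x @[n --> \oo] --> P x].
Proof.
pose S n := \sum_(k < n) zs k.
have Ss n : S n.+1 = S n + zs n by exact: big_ord_recr.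
have zS n m : (n <= m)%N -> S n * zs m = 0.
  move=> nm; rewrite /S mulr_suml big1// => i _; rewrite zo//.
  by move=> E; have := leq_trans (ltn_ord i) nm; rewrite E ltnn.
have PS n : projs M (S n).
  split; first by apply: vnb_sum => k _; exact: (zc k).1.1.
  elim: n => [|n IH]; first by rewrite /S big_ord0; exact: proj0.
  by rewrite Ss; apply: projD => //; [exact: (zc n).1.2|exact: zS].
have SS n : ple (S n) (S n.+1).
  by rewrite /ple Ss mulrDr (proj_id (PS n).2) zS// addr0.
have Smono n m : (n <= m)%N -> ple (S n) (S m).
  move=> /subnK <-; elim: (m - n)%N => [|i IH]; first by apply: ple_refl; exact: (PS n).2.
  by rewrite addSn; exact: ple_trans IH (SS _).
have [||P [PP Pub _ Pnsq]] := @pchain_sup _ _ M (range S).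
- split; first by move=> _ [n _ <-].
  move=> _ _ [n _ <-] [m _ <-].
  by have [nm|/ltnW mn] := leqP n m; [left|right]; exact: Smono.
- by exists (S 0%N); exists 0%N.
have {}Pub n : ple (S n) P by apply: Pub; exists n.
have SP x : S n x @[n --> \oo] --> P x.
  apply/cvg_nsqP => e e0.
  have [n nP] : exists n, nsq (P x) - e < nsq (S n x).
    apply: contrapT => h; have : nsq (P x) <= nsq (P x) - e; last by lra.
    apply: Pnsq => _ [n _ <-]; rewrite leNgt; apply/negP => h'; apply: h.
    by exists n.
  exists n => // m /= nm; rewrite -nsqN opprB -bopBE (nsq_projB x (PS m).2 PP.2 (Pub m)).
  by have := ple_nsq x (PS n).2 (PS m).2 (Smono _ _ nm); lra.
exists P; split=> [|k|x].
- split=> // T MT; apply: bop_ext => x; rewrite !bopME.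
  apply: (cvg_unique _ (@SP (T x))) => //.
  have -> : (fun n => S n (T x)) = (fun n => T (S n x)).
    apply/funext => n; rewrite -!bopME; congr (bfun _ x).
    by rewrite /S mulr_suml mulr_sumr; apply: eq_bigr => k _; exact: (zc k).2.
  exact: cvg_bop (@SP x).
- apply: ple_trans (Pub k.+1); rewrite /ple Ss mulrDr (proj_id (zc k).1.2).
  by rewrite ((zc k).2 _ (PS k).1) zS// add0r.
- have -> : (fun n => \sum_(k < n) zs k x) = (fun n => S n x).
    by apply/funext => n; rewrite bop_sumE.
  exact: SP.
Qed.

End sum_of_central.

(** The diffuse abelian part is the complement of all finite-dimensional factor
    summands. There is no minimal projection in it, as this would lie under such a
    summand. So there are no atoms, and by ap_minimal_projection all projections
    in it are central. *)
Lemma ap_direct_sum : exists (p : nat -> H -> H) (N : nat -> set (H -> H)),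
  [/\ direct_sum M p N, is_abelian (N 0%N), is_diffuse (N 0%N) &
    forall k : nat, N k.+1 = [set 0] \/
      (is_factor (p k.+1) (N k.+1) /\ is_finite_dimensional (N k.+1))].
Proof.
have [zs [zsP zso zsfull]] := factor_summands_countable M separableH.
have zc k : central M (zs k).
  have [->|F] := zsP k; first exact: central0.
  by split; [exact: fs_proj F|exact: fs_central F].
have [P [[PP Pc] zP Psum]] := sum_of_central zc zso.
pose p0 := 1 - P.
have Pp0 : projs M p0 := projsC PP.
have zp0 k : zs k * p0 = 0 by rewrite mulrBr mulr1 zP subrr.
have p0z k : p0 * zs k = 0.
  by have := congr1 adj (zp0 k); rewrite adjM adj0 (proj_adj Pp0.2) (proj_adj (zc k).1.2).
have p0c : central M p0.
  by split=> // T MT; rewrite mulrBl mulrBr mul1r mulr1 Pc.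
have nomin q : minimal_projection M q -> q * p0 = q -> False.
  move=> qmin qp0; have [z Fz qz] := minimal_projection_summand qmin Map.
  have [k zk] := zsfull z Fz; have [_ _ q0 _] := qmin; apply: q0.
  by rewrite -qp0 -qz -zk -mulrA zp0 mulr0.
pose pp i := if i is k.+1 then zs k else p0.
exists (fun i => bfun (pp i)), (fun i => corner M (pp i)); split.
- apply: direct_sum_of_corners.
  + by case.
  + by case=> [|i] [|j] //= ij; apply: zso => E; apply: ij; rewrite E.
  + move=> x; rewrite -cvg_shiftS.
    have -> : (fun n => \sum_(i < n.+1) pp i x) = (fun n => p0 x + \sum_(k < n) zs k x).
      by apply/funext => n; rewrite big_ord_recl.
    have lim : (fun n => p0 x + \sum_(k < n) zs k x) @ \oo --> p0 x + P x.
      by apply: cvgD; [exact: cvg_cst|exact: Psum].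
    by have E : p0 x + P x = x; [rewrite bopBE subrK|rewrite E in lim].
- move=> S T NS NT; have [S' [SE MS Sp]] := corner_lift Pp0 NS.
  have [T' [TE MT Tp]] := corner_lift Pp0 NT.
  suff ST : S' * T' = T' * S' by have := congr1 (@bfun _ _) ST; rewrite SE TE.
  apply: contrapT => nST.
  have pS : p0 * S' * p0 = S' by rewrite p0c.2// Sp Sp.
  have [p [Mp Ppr pp0 npT]] := exists_noncommuting_projection Pp0.2 Pp0.1 MS pS nST.
  have [q qmin qp] := ap_minimal_projection Map (conj Mp Ppr) MT npT.
  by apply: (nomin q qmin); exact: ple_trans qp pp0.
- move=> e [Ne [be ee ae] e0 eNe].
  have [e' [eE Me' ep0]] := corner_lift Pp0 Ne.
  have Pe' : proj e'.
    split; apply: bfun_inj; first by rewrite -[RHS]eE -[in RHS]ee eE.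
    by rewrite -adjoint_bop -eE ae.
  apply: (nomin e') => //; split=> //.
    by move=> e'0; apply: e0; rewrite eE e'0; apply/funext.
  move=> p Mp Ppr pe; have pp0 : p * p0 = p by rewrite -pe -mulrA ep0.
  have : [set e \o (T \o e) | T in corner M p0] (bfun (e' * (p * e'))).
    exists (bfun p); first exact/(corner_mem p Pp0).
    by rewrite eE; apply/funext.
  rewrite pe (ple_sym Ppr Pe' pe) eNe => -[c _ cE].
  have {}cE : c *: e' = p by apply: bfun_inj; rewrite -cE eE; apply/funext.
  have : c ^+ 2 *: e' = c *: e'.
    by rewrite cE -(proj_id Ppr) -cE bopZl bopZr (proj_id Pe') scalerA.
  move/eqP; rewrite -subr_eq0 -scalerBl scaler_eq0 => /orP[|/eqP e'0]; last first.
    by left; rewrite -cE e'0 scaler0.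
  rewrite expr2 -{3}[c]mul1r -mulrBl mulf_eq0 subr_eq0 => /orP[/eqP c1|/eqP c0].
    by right; rewrite -cE c1 scale1r.
  by left; rewrite -cE c0 scale0r.
- move=> k; have [E|F] := zsP k; [left|right].
    by rewrite /= E corner0.
  exact: factor_summand_corner F.
Qed.

End necessity.

(** * Total boundedness by finite colourings *)

(** Total boundedness is handled by finite colourings of the index set, with
    close values on indices of the same colour: colourings combine by products
    and pull back along maps. *)
Section colourings.
Context {R : realType}.
Local Notation C := R[i].

Lemma cabs2_ge0 (z : C) : 0 <= cabs2 z.
Proof. by rewrite addr_ge0 ?sqr_ge0. Qed.
Lemma cabs2D (z w : C) : cabs2 (z + w) <= 2 * cabs2 z + 2 * cabs2 w.
Proof.
rewrite /cabs2; case: z w => a b [c d] /=.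
by have := sqr_ge0 (a - c); have := sqr_ge0 (b - d); lra.
Qed.
Lemma cabs2N (z : C) : cabs2 (- z) = cabs2 z.
Proof. by case: z => a b; rewrite /cabs2/= !sqrrN. Qed.
Lemma cabs2B (z w : C) : cabs2 (z - w) = cabs2 (w - z).
Proof. by rewrite -cabs2N opprB. Qed.
Lemma cabs2_triangle (u v w : C) : cabs2 (u - w) <= 2 * cabs2 (u - v) + 2 * cabs2 (v - w).
Proof. by rewrite -(subrKA v u); exact: cabs2D. Qed.

Definition finitely_coloured {I S : Type} (F : I -> S -> C) :=
  forall e : R, 0 < e -> exists (K : finType) (c : I -> K),
    forall i j, c i = c j -> forall s, cabs2 (F i s - F j s) < e.

Lemma real_grid (b d : R) : 0 < d -> exists (N : nat) (c : R -> 'I_N.+1),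
  forall x y, `|x| <= b -> `|y| <= b -> c x = c y -> `|x - y| < d.
Proof.
move=> d0; pose g x := Num.truncn ((x + b) / d); pose N := g b.
exists N, (fun x => inord (g x)) => x y.
have gP z : `|z| <= b -> (g z <= N)%N /\ (g z)%:R * d <= z + b < (g z).+1%:R * d.
  rewrite ler_norml => /andP[z1 z2].
  have zb : 0 <= (z + b) / d by rewrite divr_ge0 ?(ltW d0)//; lra.
  have bb : 0 <= (b + b) / d by rewrite divr_ge0 ?(ltW d0)//; lra.
  split; first by apply: le_truncn; rewrite ler_pM2r ?invr_gt0//; lra.
  by rewrite -ler_pdivlMr// -ltr_pdivrMr// truncn_itv.
move=> /gP[xN /andP[x1 x2]] /gP[yN /andP[y1 y2]] /(congr1 val).
rewrite /= !inordK ?ltnS// => E; rewrite E in x1 x2.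
by rewrite ltr_norml; move: x2 y2; rewrite -!natr1 !mulrDl mul1r => ? ?; apply/andP; split; lra.
Qed.

Lemma cplx_grid (b e : R) : 0 < e -> exists (K : finType) (c : C -> K),
  forall z w, cabs2 z <= b -> cabs2 w <= b -> c z = c w -> cabs2 (z - w) < e.
Proof.
move=> e0; pose d := Num.sqrt (e / 2); have d0 : 0 < d by rewrite sqrtr_gt0; lra.
have d2 : d ^+ 2 = e / 2 by rewrite sqr_sqrtr//; lra.
have [N [c cP]] := real_grid (1 + `|b|) d0.
exists ('I_N.+1 * 'I_N.+1)%type, (fun z => (c (Re z), c (Im z))).
move=> z w; rewrite /cabs2; case: z w => x y [x' y'] /= zb wb [/cP h1 /cP h2].
have bnd (t s : R) : t ^+ 2 + s ^+ 2 <= b -> `|t| <= 1 + `|b|.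
  move=> h; rewrite -ler_sqr ?nnegrE ?addr_ge0// real_normK ?num_real//.
  have := sqr_ge0 s; have := ler_norm b; have := normr_ge0 b; nra.
have := h1 (bnd _ _ zb) (bnd _ _ wb).
rewrite addrC in zb; rewrite addrC in wb.
have := h2 (bnd _ _ zb) (bnd _ _ wb).
have sq (t : R) : `|t| < d -> t ^+ 2 < e / 2.
  by move=> td; rewrite -d2 -(real_normK (num_real t)) ltr_sqr ?nnegrE ?(ltW d0).
by move=> /sq ? /sq ?; lra.
Qed.

(** The two orbits of a function on a group are the rows and the columns of one
    matrix, so only one of them has to be examined. A column s is coloured by its
    approximate entries in one row of each colour. *)
Lemma finitely_coloured_transpose {I S : Type} (F : I -> S -> C) (b : R) :
  (forall i s, cabs2 (F i s) <= b) -> finitely_coloured F ->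
  finitely_coloured (fun s i => F i s).
Proof.
move=> Fb tF e e0; have e16 : 0 < e / 16 by lra.
have [K [c cP]] := tF _ e16; have [L [g gP]] := cplx_grid b e16.
have h k : exists i : option I, forall j, c j = k -> exists2 i', i = Some i' & c i' = k.
  have [[i ik]|nk] := pselect (exists i, c i = k); first by exists (Some i) => j _; exists i.
  by exists None => j jk; case: nk; exists j.
have [r rP] := choice h.
exists {ffun K -> option L}, (fun s => [ffun k => omap (fun i => g (F i s)) (r k)]).
move=> s t /ffunP st i; have [i' ri ci] := rP (c i) i erefl.
have := st (c i); rewrite !ffunE ri /= => -[] /(gP _ _ (Fb _ _) (Fb _ _)) h1.
have h2 := cP _ _ ci; have := h2 s; have := h2 t; rewrite [cabs2 (_ - F i s)]cabs2B => h3 h4.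
apply: le_lt_trans (cabs2_triangle _ (F i' s) _) _.
have := cabs2_triangle (F i' s) (F i' t) (F i t); lra.
Qed.

Lemma cplx_complete {I : Type} (U : set_system I) (UP : ProperFilter U) (f : I -> C) :
  (forall r : R, 0 < r -> exists2 B, U B & forall h k, B h -> B k -> cabs2 (f h - f k) < r) ->
  exists z : C, forall r : R, 0 < r -> U [set h | cabs2 (f h - z) < r].
Proof.
move=> fC.
have part (g : C -> R) : (forall z w, (g z - g w) ^+ 2 <= cabs2 (z - w)) ->
    exists a : R, forall r : R, 0 < r -> U [set h | (g (f h) - a) ^+ 2 < r].
  move=> gle; have : cvg ((g \o f) @ U).
    apply: cauchy_cvg; apply/cauchy_ballP => e e0.
    have [B UB Be] := fC _ (exprn_gt0 2 e0).
    exists ((g \o f) @` B, (g \o f) @` B) => /=.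
      suff h : U ((g \o f) @^-1` ((g \o f) @` B)) by split.
      by apply: filterS UB => h Bh; exists h.
    move=> -[_ _] [/= [h Bh <-] [k Bk <-]]; rewrite -ball_normE /ball_/=.
    rewrite -ltr_sqr ?nnegrE ?(ltW e0)// real_normK ?num_real//.
    exact: le_lt_trans (gle _ _) (Be _ _ Bh Bk).
  move=> gcv; exists (lim ((g \o f) @ U)) => r r0.
  have s0 : 0 < Num.sqrt r by rewrite sqrtr_gt0.
  have /cvgrPdist_lt/(_ _ s0) : (g \o f) @ U --> lim ((g \o f) @ U) by [].
  apply: filterS => h /=; rewrite -ltr_sqr ?nnegrE ?(ltW s0)// real_normK ?num_real//.
  by rewrite sqr_sqrtr ?ltW// -sqrrN opprB.
have [|a aP] := part (@complex.Re R).
  by move=> z w; rewrite /cabs2; case: z w => ? ? [? ?] /=; rewrite lerDl sqr_ge0.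
have [|b bP] := part (@complex.Im R).
  by move=> z w; rewrite /cabs2; case: z w => ? ? [? ?] /=; rewrite lerDr sqr_ge0.
exists (a +i* b)%C => r r0; have r2 : 0 < r / 2 by lra.
apply: filterS2 (aP _ r2) (bP _ r2) => h /=; rewrite /cabs2.
by case: (f h) => u v /=; lra.
Qed.

Lemma ultra_colour {T : Type} (U : set_system T) (UU : UltraFilter U) (K : finType)
  (A : K -> set T) : U (\bigcup_k A k) -> exists k, U (A k).
Proof.
move=> UA; apply: contrapT => nA.
have UC k : U (~` A k).
  by have [UAk|//] := in_ultra_setVsetC (A k) UU; case: nA; exists k.
have : U (\bigcap_(k in [set k | k \in enum K]) ~` A k).
  elim: (enum K) => [|k s IH]; first by apply: filterS filterT => t _ k.
  apply: filterS2 (UC k) IH => t tk ts l /=; rewrite inE => /orP[/eqP->//|ls].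
  exact: ts.
move=> UI; have [t [[k _ Akt] tI]] := filter_ex (filterI UA UI).
by apply: (tI k) => //=; rewrite mem_enum.
Qed.

(** By its colours, an ultrafilter on the closure of the range contains sets of
    arbitrarily small uniform diameter, so it converges to its pointwise limit. *)
Lemma finitely_coloured_precompact {G : choiceType} {J : Type} (F : J -> {uniform G -> cplx R}) :
  finitely_coloured (fun i s => F i s : C) -> precompact (range F).
Proof.
move=> tF; rewrite precompactE compact_ultra => U UU Ucl.
have UP : ProperFilter U by exact: ultra_proper.
pose near (e : R) (phi : {uniform G -> cplx R}) : set {uniform G -> cplx R} :=
  [set h | forall s, cabs2 ((phi s : C) - h s) < e].
have nnear e phi : 0 < e -> nbhs phi (near e phi).
  move=> e0; have r0 : 0 < Num.sqrt e by rewrite sqrtr_gt0.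
  apply/uniform_nbhs; exists [set zw | ball (zw.1 : cplx R) (Num.sqrt e)%:C%C zw.2].
  split; first by rewrite -entourage_ballE; exists (Num.sqrt e)%:C%C => //=; rewrite ltcR.
  move=> h hs s; have /(cplx_ball _ _ r0) := hs s I.
  by rewrite sqr_sqrtr ?ltW.
have small e : 0 < e -> exists2 B, U B & forall h k, B h -> B k ->
    forall s, cabs2 ((h s : C) - k s) < e.
  move=> e0; have e16 : 0 < e / 16 by lra.
  have [K [c cP]] := tF _ e16.
  pose A k := [set h : {uniform G -> cplx R} | exists2 i, c i = k & near (e / 16) h (F i)].
  have [k UA] : exists k, U (A k).
    apply: ultra_colour; apply: filterS Ucl => h hcl.
    have [_ [[i _ <-] hi]] := hcl _ (nnear _ h e16).
    by exists (c i) => //; exists i.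
  exists (A k) => // h h' [i ik hi] [j jk hj] s.
  apply: le_lt_trans (cabs2_triangle _ (F i s) _) _.
  have := cabs2_triangle (F i s) (F j s) (h' s).
  have := hi s; have := hj s; rewrite [cabs2 (h' s - _)]cabs2B.
  by have := cP i j (etrans ik (esym jk)) s; lra.
have /choice[phi phiP] s : exists z : C, forall r : R, 0 < r ->
    U [set h : {uniform G -> cplx R} | cabs2 ((h s : C) - z) < r].
  apply: cplx_complete => r r0; have [B UB Br] := small r r0.
  by exists B => // h k Bh Bk; exact: Br.
pose Phi : {uniform G -> cplx R} := phi.
have Unear e : 0 < e -> U (near e Phi).
  move=> e0; have e4 : 0 < e / 4 by lra.
  have [B UB0 Be] := small _ e4; apply: filterS (UB0) => h Bh s.
  have [k [/= ks Bk]] := filter_ex (filterI (phiP s _ e4) UB0).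
  apply: le_lt_trans (cabs2_triangle _ (k s) _) _.
  by rewrite [cabs2 (_ - k s)]cabs2B; have := Be _ _ Bk Bh s; lra.
have UPhi : U --> Phi.
  move=> P /uniform_nbhs[E [entE EP]]; rewrite -entourage_ballE in entE.
  case: entE => r /= r0 rE; have rR : (Re r)%:C%C = r by rewrite RRe_real// gtr0_real.
  have re0 : 0 < Re r by rewrite -ltcR rR.
  apply: filterS (Unear _ (exprn_gt0 2 re0)) => h hn; apply: EP => s _; apply: rE => /=.
  by rewrite -rR; exact: (cplx_ball _ _ re0).2 (hn s).
exists Phi; split=> //; apply: (closed_closure (A := range F)) => P /UPhi UPP.
by have [h] := filter_ex (filterI Ucl UPP); exists h.
Qed.

End colourings.

(** * Almost periodicity for direct sums *)

Section operator_colourings.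
Context {R : realType} {H : hilbertType R}.
Local Notation C := R[i].
Implicit Types (S T : bop H) (x y : H).

(** Totally bounded families for the operator norm. *)
Definition norm_coloured {I : Type} (A : I -> bop H) :=
  forall e : R, 0 < e -> exists (K : finType) (c : I -> K),
    forall i j, c i = c j -> forall x, nsq ((A i - A j) x) <= e * nsq x.

Lemma norm_coloured_const {I : Type} T : norm_coloured (fun _ : I => T).
Proof.
move=> e e0; exists unit, (fun=> tt) => i j _ x.
by rewrite subrr bop0E nsq0 mulr_ge0 ?nsq_ge0// ltW.
Qed.

Lemma norm_colouredD {I : Type} (A B : I -> bop H) :
  norm_coloured A -> norm_coloured B -> norm_coloured (fun i => A i + B i).
Proof.
move=> tA tB e e0; have e4 : 0 < e / 4 by lra.
have [K [c cP]] := tA _ e4; have [L [d dP]] := tB _ e4.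
exists (K * L)%type, (fun i => (c i, d i)) => i j [/cP h1 /dP h2] x.
rewrite opprD addrACA bopDE; apply: le_trans (nsqD_le _ _) _.
by have := h1 x; have := h2 x; lra.
Qed.

Lemma norm_coloured_sum {I J : Type} (r : seq J) (A : J -> I -> bop H) :
  (forall k, norm_coloured (A k)) -> norm_coloured (fun i => \sum_(k <- r) A k i).
Proof.
move=> tA; elim: r => [|k r IH].
  by under eq_fun do rewrite big_nil; exact: norm_coloured_const.
by under eq_fun do rewrite big_cons; exact: norm_colouredD.
Qed.

Lemma norm_coloured_scale {I : Type} (f : I -> C) (b : R) T :
  (forall i, cabs2 (f i) <= b) -> norm_coloured (fun i => f i *: T).
Proof.
move=> fb e e0; have [t t0 Tt] := bop_bounded T.
have [K [c cP]] := @cplx_grid R b (e / t) (divr_gt0 e0 t0).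
exists K, (fun i => c (f i)) => i j /(cP _ _ (fb i) (fb j)) h x.
rewrite -scalerBl bopZE nsqZ -/(cabs2 _); rewrite ltr_pdivlMr// in h.
apply: le_trans (_ : cabs2 (f i - f j) * (t * nsq x) <= _).
  by rewrite ler_wpM2l ?cabs2_ge0.
by rewrite mulrA ler_wpM2r ?nsq_ge0// ltW.
Qed.

(** Coordinates on a finite-dimensional space of operators are combinations of
    matrix coefficients <T x_j | y_j>, hence bounded by the norm of T: take
    coefficients whose restrictions to the space have maximal rank. *)
Lemma matrix_coefficients_span n (b : 'I_n -> bop H) :
  exists m (u v : 'I_m -> H) (G : 'M[C]_(n, m)), forall T,
    (exists a : 'I_n -> C, T = \sum_i a i *: b i) ->
    T = \sum_i \sum_j (inner (T (u j)) (v j) *: (G i j *: b i)).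
Proof.
pose Mx m (u v : 'I_m -> H) : 'M[C]_(m, n) := \matrix_(j, i) inner (b i (u j)) (v j).
pose P r := `[< exists m (u v : 'I_m -> H), \rank (Mx m u v) = r >].
have exP : exists r, P r.
  exists (\rank (Mx 0%N (fun=> 0) (fun=> 0))); apply/asboolP.
  by exists 0%N, (fun=> 0), (fun=> 0).
have ubP r : P r -> (r <= n)%N.
  by move=> /asboolP[m [u [v <-]]]; exact: rank_leq_col.
case: (ex_maxnP exP ubP) => r /asboolP[m [u [v ruv]]] rmax.
exists m, u, v, (pinvmx (Mx m u v)) => T [a TE].
have coef (c : 'I_n -> C) x y :
    inner ((\sum_i c i *: b i) x) y = \sum_i c i * inner (b i x) y.
  rewrite bop_sumE; elim/big_rec2: _ => [|i z w _ <-]; first by rewrite inner0l.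
  by rewrite innerDl bopZE innerZl.
pose ca : 'cV[C]_n := \col_i a i.
pose w : 'cV[C]_m := \col_j inner (T (u j)) (v j).
have wE : w = Mx m u v *m ca.
  apply/matrixP => j k; rewrite !mxE TE coef; apply: eq_bigr => i _.
  by rewrite !mxE mulrC.
pose c' := pinvmx (Mx m u v) *m w.
have E : Mx m u v *m c' = Mx m u v *m ca.
  have E0 := mulmxKpV (submx_refl (Mx m u v)).
  by transitivity (Mx m u v *m pinvmx (Mx m u v) *m Mx m u v *m ca);
    [rewrite /c' wE !mulmxA|rewrite E0].
have -> : \sum_i \sum_j (inner (T (u j)) (v j) *: (pinvmx (Mx m u v) i j *: b i)) =
    \sum_i c' i 0 *: b i.
  apply: eq_bigr => i _; rewrite /c' mxE scaler_suml; apply: eq_bigr => j _.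
  by rewrite scalerA [w _ _]mxE mulrC.
apply: bop_ext => x; apply: inner_ext => y; rewrite /rin; congr complex.Re.
(* A new pair of vectors adds a row to the matrix of coefficients; by maximality
   of the rank this row depends on the others. *)
pose u' (k : 'I_(1 + m)) := if fintype.split k is inr j then u j else x.
pose v' (k : 'I_(1 + m)) := if fintype.split k is inr j then v j else y.
pose row : 'rV[C]_n := \row_i inner (b i x) y.
have Mx' : Mx (1 + m)%N u' v' = col_mx row (Mx m u v).
  apply/matrixP => k i; rewrite !mxE /u' /v'.
  by case: (fintype.splitP k) => k' _; rewrite mxE.
have sub : (row <= Mx m u v)%MS.
  have h : (Mx m u v <= row + Mx m u v)%MS by exact: addsmxSr.
  apply: submx_trans (addsmxSl row (Mx m u v)) _.
  rewrite -(mxrank_leqif_sup h) eqn_leq mxrankS//= ruv.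
  by apply: rmax; apply/asboolP; exists (1 + m)%N, u', v'; rewrite Mx' addsmxE.
have [D DE] := submxP sub.
have rowE (c : 'cV[C]_n) : (row *m c) 0 0 = inner ((\sum_i c i 0 *: b i) x) y.
  by rewrite coef mxE; apply: eq_bigr => i _; rewrite mxE mulrC.
rewrite -rowE DE -mulmxA E mulmxA -DE rowE TE; congr (inner (bfun _ x) y).
by apply: eq_bigr => i _; rewrite mxE.
Qed.

Lemma norm_coloured_findim {I : Type} n (b : 'I_n -> bop H) (A : I -> bop H) (t : R) :
  (forall i, exists a : 'I_n -> C, A i = \sum_k a k *: b k) ->
  (forall i x, nsq (A i x) <= t * nsq x) -> norm_coloured A.
Proof.
move=> Ab At; have [m [u [v [G GP]]]] := matrix_coefficients_span b.
have -> : A = fun i => \sum_k \sum_j (inner (A i (u j)) (v j) *: (G k j *: b k)).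
  by apply/funext => i; exact: GP.
apply: norm_coloured_sum => k; apply: norm_coloured_sum => j.
apply: (@norm_coloured_scale _ _ (t * nsq (u j) * nsq (v j))) => i.
apply: le_trans (normc_inner_sqr _ _) _.
by rewrite ler_wpM2r ?nsq_ge0.
Qed.

End operator_colourings.

Section sufficiency.
Context {R : realType} {H : hilbertType R} (M : vonNeumannAlgebra H).
Local Notation C := R[i].
Local Notation U := (unitary_group M).
Implicit Types (S T : bop H) (x y xi eta w : H) (u g s : U).

Lemma unitary_nsq u x : nsq (ubop u x) = nsq x.
Proof. by have [h _] := ubop_unitary u; rewrite nsq_bop h bop1E. Qed.
Lemma unitary_adj_nsq u x : nsq (adj (ubop u) x) = nsq x.
Proof. by have [_ h] := ubop_unitary u; rewrite nsq_bop adjK h bop1E. Qed.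

Lemma unitary_rin_near u x y (e : R) : 0 < e ->
  \forall g \near u, `|rin (ubop g x) y - rin (ubop u x) y| < e.
Proof.
move=> e0; have e2 : 0 < e ^+ 2 by rewrite exprn_gt0.
have cU : continuous (set_val : U -> wot H) by exact: initial_continuous.
have h1 : nbhs (set_val u : wot H) [set t : wot H |
    cabs2 (inner (t x) y - inner ((set_val u : wot H) x) y) < e ^+ 2].
  by have /cvg_cplxP/(_ _ e2) := @wot_inner_continuous _ _ x y (set_val u).
apply: (@filterS _ _ (nbhs_filter u) _ _ _ (cU u _ h1)) => g /= h.
rewrite -ltr_sqr ?nnegrE ?normr_ge0 ?(ltW e0)// real_normK ?num_real//.
apply: le_lt_trans h; rewrite /rin /=.
by case: (inner _ _) (inner _ _) => a b [c d] /=; rewrite lerDl sqr_ge0.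
Qed.

(** |g x - u x|^2 = 2 |x|^2 - 2 Re <g x, u x>, so that weak convergence of
    unitaries implies strong convergence. *)
Lemma unitary_near u x (e : R) : 0 < e ->
  \forall g \near u, nsq (ubop g x - ubop u x) < e.
Proof.
move=> e0; have e2 : 0 < e / 2 by lra.
apply: filterS (unitary_rin_near u x (ubop u x) e2) => g.
by rewrite ltr_norml nsqB !unitary_nsq -/(nsq _) unitary_nsq => /andP[h1 h2]; lra.
Qed.

Lemma unitary_adj_near u x (e : R) : 0 < e ->
  \forall g \near u, nsq (adj (ubop g) x - adj (ubop u) x) < e.
Proof.
move=> e0; have e2 : 0 < e / 2 by lra.
apply: filterS (unitary_rin_near u (adj (ubop u) x) x e2) => g.
rewrite ltr_norml nsqB !unitary_adj_nsq -[ubop u _]bopME (ubop_unitary u).2 bop1E.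
by rewrite -/(nsq x) (rin_adjl _ x) rinC => /andP[h1 h2]; lra.
Qed.

Section coefficient.
Variables (T : bop H) (xi eta : H).
Let f : U -> cplx R := star_coef xi T eta.

Let fE u : f u = inner (T (adj (ubop u) xi)) (adj (ubop u) eta).
Proof. by rewrite /f star_coefE !bopME adjP. Qed.

Lemma sesquilinear_diff S x x' y y' (c : R) : (forall z, nsq (S z) <= c * nsq z) ->
  cabs2 (inner (S x) y - inner (S x') y') <=
  2 * (c * nsq (x - x') * nsq y) + 2 * (c * nsq x' * nsq (y - y')).
Proof.
move=> Sc; have -> : inner (S x) y - inner (S x') y' =
    inner (S (x - x')) y + inner (S x') (y - y').
  by rewrite bop_raddB innerBl innerBr addrA subrK.
apply: le_trans (cabs2D _ _) _.
have h z t : cabs2 (inner (S z) t) <= c * nsq z * nsq t.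
  by apply: le_trans (normc_inner_sqr _ _) _; rewrite ler_wpM2r ?nsq_ge0.
by have := h (x - x') y; have := h x' (y - y'); lra.
Qed.

Let c := sval (cid2 (bop_bounded T)).
Let c0 : 0 < c. Proof. by rewrite /c; case: cid2. Qed.
Let Tc x : nsq (T x) <= c * nsq x. Proof. by rewrite /c; case: cid2. Qed.
Let k := 1 + c * nsq xi + c * nsq eta.
Let k0 : 0 < k.
Proof. by rewrite /k addrAC -addrA ltr_pwDl// addr_ge0// mulr_ge0 ?nsq_ge0// ltW. Qed.

Let bound (a b r : R) : 0 <= a -> 0 <= b -> 0 < r -> a < r / (8 * k) -> b < r / (8 * k) ->
  2 * (c * a * nsq eta) + 2 * (c * nsq xi * b) < r.
Proof.
move=> a0 b0 r0; have k8 : 0 < 8 * k by rewrite mulr_gt0.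
rewrite !ltr_pdivlMr// => ha hb.
have x0 : 0 <= c * nsq xi by rewrite mulr_ge0 ?nsq_ge0// ltW.
have y0 : 0 <= c * nsq eta by rewrite mulr_ge0 ?nsq_ge0// ltW.
have h1 : a * (c * nsq eta) <= a * k by rewrite ler_wpM2l// /k; lra.
have h2 : b * (c * nsq xi) <= b * k by rewrite ler_wpM2l// /k; lra.
lra.
Qed.

Lemma coefficient_continuous : continuous f.
Proof.
move=> u; apply: (proj2 (cvg_cplxP (nbhs_filter u) f (f u))) => r r0.
have rk : 0 < r / (8 * k) by rewrite divr_gt0// mulr_gt0.
apply: filterS2 (unitary_adj_near u xi rk) (unitary_adj_near u eta rk) => g h1 h2.
rewrite -/(cabs2 _) !fE; apply: le_lt_trans (sesquilinear_diff _ _ _ _ Tc) _.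
by rewrite !unitary_adj_nsq bound ?nsq_ge0.
Qed.

Lemma coefficient_le u : cabs2 (f u) <= c * nsq xi * nsq eta.
Proof.
rewrite fE; apply: le_trans (normc_inner_sqr _ _) _.
rewrite unitary_adj_nsq ler_wpM2r ?nsq_ge0//.
by apply: le_trans (Tc _) _; rewrite unitary_adj_nsq.
Qed.

Lemma coefficient_Cbr : Cbr f.
Proof.
split.
  split; first exact: coefficient_continuous.
  pose B := 1 + c * nsq xi * nsq eta.
  have B0 : 0 <= B by rewrite /B addr_ge0// !mulr_ge0 ?nsq_ge0// ltW.
  exists B%:C%C; split; first by apply: ger0_real; rewrite ler0c.
  move=> z Bz u _ /=; apply: le_trans (ltW Bz); rewrite normc_def lecR -/(cabs2 _).
  have cu := coefficient_le u; have c1 := cabs2_ge0 (f u).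
  rewrite -[B]ger0_norm; last by rewrite /B; lra.
  by rewrite -sqrtr_sqr ler_wsqrtr// /B; nra.
move=> P /uniform_nbhs[E [entE EP]]; rewrite -entourage_ballE in entE.
case: entE => r /= r0 rE; have rR : (Re r)%:C%C = r by rewrite RRe_real// gtr0_real.
have re0 : 0 < Re r by rewrite -ltcR rR.
have r2 : 0 < Re r ^+ 2 by rewrite exprn_gt0.
have rk : 0 < Re r ^+ 2 / (8 * k) by rewrite divr_gt0// mulr_gt0.
apply: filterS2 (unitary_near 1%g xi rk) (unitary_near 1%g eta rk) => g h1 h2.
apply: EP => s _; apply: rE => /=; rewrite -rR; apply/(cplx_ball _ _ re0).
rewrite -/(cabs2 _) cabs2B /ltranslate /f !star_coefE ubopM ubopV.
rewrite adjM adjK; pose S := ubop s * T * adj (ubop s).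
have -> : adj (ubop g) * ubop s * T * (adj (ubop s) * ubop g) = adj (ubop g) * S * ubop g.
  by rewrite /S !mulrA.
rewrite bopME [_ (ubop g xi)]bopME inner_adjl -/S.
have Sc z : nsq (S z) <= c * nsq z.
  by rewrite /S !bopME unitary_nsq; apply: le_trans (Tc _) _; rewrite unitary_adj_nsq.
apply: le_lt_trans (sesquilinear_diff _ _ _ _ Sc) _.
by rewrite ubop1 !bop1E in h1 h2; rewrite unitary_nsq bound ?nsq_ge0.
Qed.

(** f is uniformly approximated by coefficients of the truncations
    g T g^* P_n, because P_n commutes with g. *)
Lemma coefficient_AP (P : nat -> bop H) :
  (forall n g, P n * adj (ubop g) = adj (ubop g) * P n) ->
  (forall x, P n x @[n --> \oo] --> x) ->
  (forall n, norm_coloured (fun g => ubop g * T * adj (ubop g) * P n)) -> AP f.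
Proof.
move=> Pc Plim PT.
pose F (g s : U) : C := f (s * g)%g.
have FE g s : F g s = inner ((ubop g * T * adj (ubop g)) (adj (ubop s) xi)) (adj (ubop s) eta).
  by rewrite /F /f star_coefE ubopM adjM -adjP -!bopME !mulrA.
have tF : finitely_coloured F.
  (* d is the tolerance for which bound holds with r = e / 8. *)
  move=> e e0; pose d := e / (64 * k); have d0 : 0 < d by rewrite divr_gt0// mulr_gt0.
  have /cvg_nsqP/(_ _ d0) [N _ /(_ N (leqnn N))] := @Plim xi.
  rewrite /= -nsqN opprB => Nd.
  pose d' := e / (16 * (1 + nsq xi * nsq eta)).
  have q0 : 0 <= nsq xi * nsq eta by rewrite mulr_ge0 ?nsq_ge0.
  have q1 : 0 < 1 + nsq xi * nsq eta by lra.
  have d'0 : 0 < d' by rewrite divr_gt0// mulr_gt0.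
  have [K [col colP]] := PT N _ d'0; exists K, col => g h gh s.
  pose X g := ubop g * T * adj (ubop g).
  have Xc g' z : nsq (X g' z) <= c * nsq z.
    by rewrite /X !bopME unitary_nsq; apply: le_trans (Tc _) _; rewrite unitary_adj_nsq.
  pose y := adj (ubop s) xi; pose t := adj (ubop s) eta.
  have tail g' : cabs2 (inner (X g' y) t - inner ((X g' * P N) y) t) <= e / 16.
    have -> : inner (X g' y) t - inner ((X g' * P N) y) t = inner (X g' (y - P N y)) t.
      by rewrite bop_raddB innerBl.
    have -> : y - P N y = adj (ubop s) (xi - P N xi).
      by rewrite bop_raddB -[P N y]/((P N * adj (ubop s)) xi) Pc.
    apply: le_trans (normc_inner_sqr _ _) _.
    apply: le_trans (_ : c * nsq (xi - P N xi) * nsq eta <= _).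
      rewrite unitary_adj_nsq ler_wpM2r ?nsq_ge0//.
      by apply: le_trans (Xc _ _) _; rewrite unitary_adj_nsq.
    have := @bound (nsq (xi - P N xi)) 0 (e / 8).
    have E4 : e / 8 / (8 * k) = d by rewrite /d; field; rewrite gt_eqF.
    have E0 : (0 : R) < e / 8 by lra.
    rewrite E4 nsq_ge0 => /(_ isT (lexx 0) E0 Nd d0); lra.
  have mid : cabs2 (inner ((X g * P N) y) t - inner ((X h * P N) y) t) <= e / 16.
    rewrite -innerBl -bopBE; apply: le_trans (normc_inner_sqr _ _) _.
    rewrite unitary_adj_nsq; apply: le_trans (_ : d' * nsq xi * nsq eta <= _).
      rewrite ler_wpM2r ?nsq_ge0//; have := colP g h gh y.
      by rewrite unitary_adj_nsq.
    rewrite -mulrA /d' mulrAC ler_pdivrMr ?mulr_gt0//.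
    have : e * (nsq xi * nsq eta) <= e * (1 + nsq xi * nsq eta) by rewrite ler_wpM2l ?ltW//; lra.
    by lra.
  rewrite !FE -/(X g) -/(X h) -/y -/t.
  apply: le_lt_trans (cabs2_triangle _ (inner ((X g * P N) y) t) _) _.
  have := cabs2_triangle (inner ((X g * P N) y) t) (inner ((X h * P N) y) t) (inner (X h y) t).
  have := tail g; have := tail h; rewrite [in X in X -> _]cabs2B; lra.
split; first exact: coefficient_Cbr.
  have h : finitely_coloured (fun s g : U => F s (g^-1)%g).
    move=> e e0; have [K [col colP]] := tF e e0.
    by exists K, col => g g' E s; exact: colP.
  apply: finitely_coloured_precompact.
  have Fb i s : cabs2 (F i (s^-1)%g) <= c * nsq xi * nsq eta by exact: coefficient_le.
  exact: finitely_coloured_transpose Fb h.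
apply: finitely_coloured_precompact.
by move=> e e0; exact: tF.
Qed.

End coefficient.

Section direct_sum.
Variables (p : nat -> H -> H) (N : nat -> set (H -> H)).
Hypotheses (MpN : direct_sum M p N)
  (Nk : forall k, is_abelian (N k) \/ is_finite_dimensional (N k)).

(** The conjugates g T g^* P_i are constant in g on an abelian summand and run
    through a bounded part of the span of finitely many operators on a
    finite-dimensional one. *)
Lemma direct_sum_ap : vn_set M `<=` ap M.
Proof.
have [vN po psum ME] := MpN.
have /choice[P PE] i : exists P : bop H, bfun P = p i.
  by exists (Bop (vn_bounded (vN i) (vn_unit (vN i)))).
have block X i : vnb M X -> [/\ N i (bfun (X * P i)), X * P i = P i * X & P i * P i = P i].
  rewrite /vnb/= ME => -[t [Nt _ tX]].
  have tp j x : t j (p j x) = t j x.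
    by rewrite -[LHS]/((t j \o p j) x) (vn_unitr (vN j))//.
  have pt j x : p j (t j x) = t j x.
    by rewrite -[LHS]/((p j \o t j) x) (vn_unitl (vN j))//.
  have pp j l x : j <> l -> p j (p l x) = 0.
    by move=> jl; rewrite -[LHS]/((p j \o p l) x) po.
  have lint j : t j 0 = 0.
    have [lj _] := vn_bounded (vN j) (Nt j).
    by have := lj (-1) 0 0; rewrite !scaleN1r !addNr.
  have single (v : nat -> H) : (forall j, j <> i -> v j = 0) ->
      \sum_(j < n) v j @[n --> \oo] --> v i.
    move=> v0; apply/cvg_nsqP => e e0; exists i.+1 => // n /= ni.
    rewrite (bigD1 (Ordinal ni))//= big1 ?addr0 ?subrr ?nsq0// => j ji.
    by apply: v0 => E; move/eqP: ji; apply; exact: val_inj.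
  have Xp x : X (p i x) = t i x.
    apply: (cvg_unique _ (@tX (p i x))) => //.
    have h : forall j, j <> i -> t j (p i x) = 0.
      by move=> j ji; rewrite -tp pp// lint.
    by have := single (fun j => t j (p i x)) h; rewrite tp.
  have pX x : p i (X x) = t i x.
    have := cvg_bop (T := P i) _ (@tX x); rewrite PE => h.
    apply: (cvg_unique _ (h _)) => //.
    have -> : (fun n => p i (\sum_(j < n) t j x)) = (fun n => \sum_(j < n) p i (t j x)).
      by apply/funext => n; rewrite -PE linear_sum.
    have h' : forall j, j <> i -> p i (t j x) = 0.
      by move=> j ji; rewrite -pt pp//; exact/nesym.
    by have := single (fun j => p i (t j x)) h'; rewrite pt.
  split.
  - have E : bfun (X * P i) = t i by apply/funext => x; rewrite bopME PE Xp.
    by move: (Nt i); rewrite -E.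
  - by apply: bop_ext => x; rewrite !bopME !PE Xp pX.
  - apply: bop_ext => x; rewrite bopME !PE.
    by have /(congr1 (@^~ x)) := vn_unitl (vN i) (vn_unit (vN i)).
move=> T0 MT0; have [T MT TE] := vnb_lift MT0; rewrite -TE.
split=> [|xi eta]; first exact: bfunP.
pose S n := \sum_(i < n) P i.
apply: (@coefficient_AP T xi eta S).
- move=> n g; rewrite /S mulr_suml mulr_sumr; apply: eq_bigr => i _.
  by have [_ -> _] := block _ i (vnb_adj (ubop_vnb g)).
- move=> x; have -> : (fun n => S n x) = (fun n => \sum_(i < n) p i x).
    by apply/funext => n; rewrite /S bop_sumE; apply: eq_bigr => i _; rewrite PE.
  exact: psum.
move=> n.
have -> : (fun g => ubop g * T * adj (ubop g) * S n) =
    (fun g => \sum_(i <- index_enum 'I_n) ubop g * T * adj (ubop g) * P i).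
  by apply/funext => g; rewrite /S mulr_sumr.
apply: norm_coloured_sum => i; have Mg g := ubop_vnb g.
have MX g : vnb M (ubop g * T * adj (ubop g)) := vnbM (vnbM (Mg g) MT) (vnb_adj (Mg g)).
have [ab|[m [b [Nb bspan]]]] := Nk i.
  have -> : (fun g => ubop g * T * adj (ubop g) * P i) = fun=> T * P i.
    apply/funext => g; have [N1 E1 PP] := block _ i (Mg g).
    have [N2 E2 _] := block _ i MT; have [_ E3 _] := block _ i (vnb_adj (Mg g)).
    have comm : (ubop g * P i) * (T * P i) = (T * P i) * (ubop g * P i).
      by have := ab _ _ N1 N2 => h; apply: bop_ext => x; have := congr1 (@^~ x) h.
    have gPg : ubop g * P i * adj (ubop g) = P i.
      by rewrite -mulrA -E3 mulrA (ubop_unitary g).2 mul1r.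
    have PTP : P i * (T * P i) = T * P i by rewrite mulrA -E2 -mulrA PP.
    have -> : ubop g * T * adj (ubop g) * P i = (ubop g * P i) * (T * P i) * adj (ubop g).
      by rewrite -(mulrA (ubop g) (P i)) PTP -(mulrA (ubop g * T)) E3 !mulrA.
    by rewrite comm -(mulrA (T * P i)) gPg -mulrA PP.
  exact: norm_coloured_const.
have /choice[b' b'E] j : exists S : bop H, bfun S = b j.
  by exists (Bop (vn_bounded (vN i) (Nb j))).
have [c c0 Tc] := bop_bounded T; have [d d0 Pd] := bop_bounded (P i).
apply: (@norm_coloured_findim _ _ _ m b' _ (c * d)) => [g|g x].
  have [NX _ _] := block _ i (MX g); have [a aE] := bspan _ NX; exists a.
  apply: bop_ext => x; rewrite aE fct_sumE bop_sumE; apply: eq_bigr => j _.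
  by rewrite -b'E.
rewrite !bopME unitary_nsq; apply: le_trans (Tc _) _.
by rewrite unitary_adj_nsq -mulrA ler_pM2l.
Qed.

End direct_sum.
End sufficiency.

Theorem theorem1p5 (R : realType) (H : hilbertType R)
    (separableH : separable_space H) (M : vonNeumannAlgebra H) :
  (M `<=` ap M <->
   exists (p : nat -> H -> H) (N : nat -> set (H -> H)),
     [/\ direct_sum M p N,
         is_abelian (N 0%N),
         is_diffuse (N 0%N) &
         forall k : nat, N k.+1 = [set 0] \/
           (is_factor (p k.+1) (N k.+1) /\ is_finite_dimensional (N k.+1))]) /\
  (M `<=` ap M <->
   exists (p : nat -> H -> H) (N : nat -> set (H -> H)),
     direct_sum M p N /\
     forall k : nat, is_abelian (N k) \/ is_finite_dimensional (N k)).
Proof.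
have sum_ap p N : direct_sum M p N ->
    (forall k, is_abelian (N k) \/ is_finite_dimensional (N k)) -> M `<=` ap M.
  exact: direct_sum_ap.
have weaken (N : nat -> set (H -> H)) : is_abelian (N 0%N) ->
    (forall k, N k.+1 = [set 0] \/
       exists2 q, is_factor q (N k.+1) & is_finite_dimensional (N k.+1)) ->
    forall k, is_abelian (N k) \/ is_finite_dimensional (N k).
  move=> N0 NS [|k]; first by left.
  by case: (NS k) => [->|[_ _]]; [left => S T -> ->|right].
split; split.
- exact: ap_direct_sum.
- move=> [p [N [MpN N0 _ NS]]]; apply: (sum_ap p N MpN); apply: weaken => // k.
  by case: (NS k) => [|[f d]]; [left|right; exists (p k.+1)].
- move=> Map; have [p [N [MpN N0 _ NS]]] := ap_direct_sum separableH Map.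
  exists p, N; split=> //; apply: weaken => // k.
  by case: (NS k) => [|[f d]]; [left|right; exists (p k.+1)].
- by move=> [p [N [MpN Nk]]]; exact: (sum_ap p N).
Qed.
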